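(* Let $k$ be a field of characteristic zero, let $E$ be a $k$-vector space of dimension $n\geq 1$, let $T_2$ be a non-singular symmetric metric on $E$, and let $O_n$ be the orthogonal group of $T_2$. With $w_\sigma$, $a_\sigma$, $S'_m$ and $r(\sigma)$ as defined in the context, put, for each $m>0$ and $[\sigma],[\sigma']\in S'_m$, $$\lambda_{\sigma\sigma'}=\frac{w_\sigma(a_{\sigma'})}{n^{r(\sigma)}\cdot n^{r(\sigma')}},\qquad (\lambda_{[\sigma]})_{[\sigma]\in S'_m}=(\lambda_{\sigma\sigma'})^{-1}_{[\sigma],[\sigma']\in S'_m}\cdot(1,\ldots,1).$$ Then the invariant integral on $O_n$ is $$w_{O_n}=1+\sum_{m>0}\ \sum_{[\sigma]\in S'_m}\lambda_{[\sigma]}\cdot\frac{w_\sigma}{n^{r(\sigma)}} .$$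
   Context: The invariant integral $w_{O_n}\in A_{O_n}^*={\rm Hom}_k(A_{O_n},k)$ is the unique $O_n$-invariant linear form on the ring of functions $A_{O_n}$ with $w_{O_n}(1)=1$. Let $M_n={\rm End}_k(E)$ be the affine variety of endomorphisms, $A_{M_n}=\bigoplus_r S^r({\rm End}_k(E)^* )$ its ring of polynomial functions. Since $O_n\subset M_n$ is closed, $A_{O_n}^*\subset A_{M_n}^*$ (linear forms vanishing on the ideal of $O_n$). One identifies $A_{M_n}^*=\prod_r({\rm End}_k(E)^{\otimes r})^{S_r}=\prod_r S^r{\rm End}_k(E)$, where the symmetric tensor $T\otimes\overset{r}{\cdots}\otimes T$ ($T\in{\rm End}_k(E)$) is the linear form sending a homogeneous polynomial $p$ of degree $r$ to $p(T)$ and all other homogeneous components to $0$; here $S^r$ is embedded in the $r$-th tensor power by symmetrization $\frac1{r!}\sum_{\tau\in S_r}\tau$, and a bar denotes the class in $S^r$ (as a symmetric tensor, the symmetrization). The term $1$ of $w_{O_n}$ is the unit of $S^0{\rm End}_k(E)=k$. Let $T^2\in E\otimes E$ be the metric on $E^*$ dual to $T_2$ (the metric on $E^*$ obtained by transporting $T_2$ through the polarity $E\simeq E^*$, i.e. the inverse matrix). For $\sigma\in S_m$ let $T^2_{1\sigma(1)}\otimes\cdots\otimes T^2_{m\sigma(m)}\in E^{\otimes 2m}$ be the tensor $\tau(T^2\otimes\overset{m}{\cdots}\otimes T^2)$, where $\tau\in S_{2m}$ is $\tau(2i-1)=2i-1$, $\tau(2i)=2\sigma(i)$; that is, the $i$-th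 copy of $T^2$ occupies the positions $2i-1$ and $2\sigma(i)$. Define $$w_\sigma:=\overline{T_2\otimes\overset{m}{\cdots}\otimes T_2\otimes T^2_{1\sigma(1)}\otimes\cdots\otimes T^2_{m\sigma(m)}}\in S^{2m}{\rm End}_k(E),$$ where $E^{*\otimes 2m}\otimes E^{\otimes 2m}$ is identified with ${\rm End}_k(E)^{\otimes 2m}=(E^*\otimes E)^{\otimes 2m}$ by pairing the $j$-th factor $E^*$ with the $j$-th factor $E$ (and the $i$-th copy of $T_2$ occupies positions $2i-1,2i$). Define $a_\sigma\in S^{2m}({\rm End}_k(E)^* )$ by the same expression $\overline{T_2\otimes\cdots\otimes T_2\otimes T^2_{1\sigma(1)}\otimes\cdots\otimes T^2_{m\sigma(m)}}$, with $E^{*\otimes 2m}\otimes E^{\otimes 2m}$ now identified with $({\rm End}_k(E)^* )^{\otimes 2m}$, ${\rm End}_k(E)^*=(E^*\otimes E)^*=E\otimes E^*$; equivalently $a_\sigma$ is the homogeneous polynomial function of degree $2m$ on ${\rm End}_k(E)$ whose value at $T$ is the full contraction of $T_2^{\otimes m}\otimes T^2_{1\sigma(1)}\otimes\cdots\otimes T^2_{m\sigma(m)}$ with $T^{\otimes 2m}$. $w_\sigma(a_{\sigma'})$ is the value of the linear form $w_\sigma$ on $a_{\sigma'}$. Both $w_\sigma$ and $a_\sigma$ depend only on the conjugacy class $[\sigma]$. $S'_m$ is the set of conjugacy classes $[\sigma]$ of $S_m$ such that $\sigma$ is a product of disjoint cycles of order less than or equal to $n$, and $r(\sigma)$ is the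 number of disjoint cycles of $\sigma$ (including cycles of order $1$). *)

(* Defs.v *)
From HB Require Import structures.
From mathcomp Require Import all_boot all_order all_fingroup all_algebra.
From mathcomp Require Import mpoly.

Set Implicit Arguments.
Unset Strict Implicit.
Unset Printing Implicit Defensive.

Import GRing.Theory.
Local Open Scope ring_scope.

(* The ring A_M of polynomial functions on M_n is {mpoly k[n * n]}: the variable
   of index mxvec_index i j is the coordinate function X_ij : T |-> T i j, where
   endomorphisms are matrices acting on columns, T e_j = \sum_i T i j e_i. *)

Section GenericMatrix.
Variables (R : nzRingType) (n : nat).

Definition generic_mx : 'M[{mpoly R[n * n]}]_n :=
  \matrix_(i, j) 'X_(mxvec_index i j).

(* The inverse of (i, j) |-> mxvec_index i j. *)
Definition mxindex_pair (v : 'I_(n * n)) : 'I_n * 'I_n :=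
  enum_val (cast_ord (esym (mxvec_cast n n)) v).

End GenericMatrix.

Section OrthogonalGroup.
Variables (k : fieldType) (n : nat) (G : 'M[k]_n).

(* The R-points of the group scheme O_n of the metric of Gram matrix G; such a g
   is automatically invertible when G is. *)
Definition orthogonal_point (R : comAlgType k) (g : 'M[R]_n) : Prop :=
  g^T *m map_mx (in_alg R) G *m g = map_mx (in_alg R) G.

Definition orthogonal_eqs : 'M[{mpoly k[n * n]}]_n :=
  (generic_mx k n)^T *m map_mx (@mpolyC (n * n) k) G *m generic_mx k n
  - map_mx (@mpolyC (n * n) k) G.

(* The ideal of O_n in A_M, so that the ring of functions of O_n is the
   quotient of A_M by it. *)
Definition orthogonal_ideal (p : {mpoly k[n * n]}) : Prop :=
  exists Q : 'M[{mpoly k[n * n]}]_n,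
    p = \sum_i \sum_j Q i j * orthogonal_eqs i j.

(* The polynomial functions X |-> p (g X) and X |-> p (X g) on M_n over R. *)
Definition lshift_mpoly (R : comAlgType k) (g : 'M[R]_n) (p : {mpoly k[n * n]})
    : {mpoly R[n * n]} :=
  mmap (@mpolyC (n * n) R \o in_alg R)
       (fun v => mxvec (map_mx (@mpolyC (n * n) R) g *m generic_mx R n) 0 v) p.

Definition rshift_mpoly (R : comAlgType k) (g : 'M[R]_n) (p : {mpoly k[n * n]})
    : {mpoly R[n * n]} :=
  mmap (@mpolyC (n * n) R \o in_alg R)
       (fun v => mxvec (generic_mx R n *m map_mx (@mpolyC (n * n) R) g) 0 v) p.

(* The R-linear extension to A_M (x) R of a linear form w on A_M. *)
Definition extend_form (w : {mpoly k[n * n]} -> k) (R : comAlgType k)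
    (q : {mpoly R[n * n]}) : R :=
  \sum_(mm <- msupp q) w 'X_[mm] *: q@_mm.

(* Linear forms on the ring of functions of O_n are the linear forms on A_M
   vanishing on the ideal of O_n.  Invariance is invariance under the points of
   O_n with values in every commutative k-algebra. *)
Definition left_invariant_integral (w : {mpoly k[n * n]} -> k) : Prop :=
  [/\ scalar w,
      forall p, orthogonal_ideal p -> w p = 0,
      forall (R : comAlgType k) (g : 'M[R]_n), orthogonal_point g ->
        forall p, extend_form w (lshift_mpoly g p) = (w p)%:A
    & w 1 = 1].

Definition right_invariant_integral (w : {mpoly k[n * n]} -> k) : Prop :=
  [/\ scalar w,
      forall p, orthogonal_ideal p -> w p = 0,
      forall (R : comAlgType k) (g : 'M[R]_n), orthogonal_point g ->
        forall p, extend_form w (rshift_mpoly g p) = (w p)%:A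
    & w 1 = 1].

End OrthogonalGroup.

Section SymmetricTensors.
Variables (k : fieldType) (n : nat).

(* t : tensor r stands for the element
   \sum_u t u E_(u_1) (x) ... (x) E_(u_r) of the r-th tensor power of End(E),
   where E_(i, j) is the matrix unit delta_mx i j. *)
Definition tensor (r : nat) : Type := r.-tuple ('I_n * 'I_n) -> k.

Definition symmetrize (r : nat) (t : tensor r) : tensor r :=
  fun u => (r`!%:R)^-1 * \sum_(tau : 'S_r) t [tuple tnth u (tau i) | i < r].

Definition pure_power (r : nat) (T : 'M[k]_n) : tensor r :=
  fun u => \prod_(i < r) T (tnth u i).1 (tnth u i).2.
Arguments pure_power r T : clear implicits.

(* The linear form on A_M defined by a symmetric tensor t of degree r: its value
   on the monomial X_(u_1) ... X_(u_r) is the coordinate t u (which depends only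
   on the multiset of the u_i), and it kills the monomials of degree <> r, on
   which insub returns None.  It sends T (x) ... (x) T to p |-> p_r(T), with p_r
   the component of degree r of p: see tensor_form_pure_power. *)
Definition tensor_form (r : nat) (t : tensor r) (p : {mpoly k[n * n]}) : k :=
  \sum_(mm <- msupp p)
     p@_mm * oapp t 0 (insub [seq mxindex_pair v | v <- m2s mm]).

Lemma prod_m2s (R : comNzRingType) N (mm : 'X_{1..N}) (F : 'I_N -> R) :
  \prod_(v <- m2s mm) F v = \prod_v F v ^+ mm v.
Proof.
rewrite /m2s big_flatten /= big_map big_enum /=; apply: eq_bigr => v _.
by rewrite big_nseq -Monoid.iteropE.
Qed.

Lemma tensor_form_pure_power r (T : 'M[k]_n) (p : {mpoly k[n * n]}) :
  tensor_form (pure_power r T) p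
  = (pihomog mdeg r p).@[fun v => mxvec T 0 v].
Proof.
rewrite pihomogE raddf_sum /= /tensor_form [RHS]big_mkcond /=.
apply: eq_bigr => mm _.
case: insubP; rewrite size_map size_m2s; last by move/negbTE->; rewrite /= mulr0.
move=> u sz_u def_u; rewrite sz_u mevalZ mevalX /=; congr (_ * _).
rewrite -prod_m2s /pure_power -(big_tuple _ _ u xpredT (fun c => T c.1 c.2)).
rewrite def_u big_map; apply: eq_bigr => v _.
case: (mxvec_indexP v) => i j.
by rewrite /mxindex_pair /mxvec_index cast_ordK enum_rankK mxvecE.
Qed.

End SymmetricTensors.

Section Invariants.
Variables (k : fieldType) (n : nat) (G : 'M[k]_n).

(* The positions 2i-1 and 2i, for i = 1, ..., m, are i.*2 and i.*2.+1 here. *)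
Lemma fst_pos_subproof m (i : 'I_m) : (i.*2 < m.*2)%N.
Proof. by rewrite ltn_double. Qed.
Lemma snd_pos_subproof m (i : 'I_m) : (i.*2.+1 < m.*2)%N.
Proof. by rewrite ltn_Sdouble. Qed.
Definition fst_pos m (i : 'I_m) : 'I_m.*2 := Ordinal (fst_pos_subproof i).
Definition snd_pos m (i : 'I_m) : 'I_m.*2 := Ordinal (snd_pos_subproof i).

(* The coordinate of T_2^(x)m (x) T^2_{1 s(1)} (x) ... (x) T^2_{m s(m)} on
   e^(j_1) (x) ... (x) e^(j_2m) (x) e_(l_1) (x) ... (x) e_(l_2m); the matrix of
   T^2 is the inverse of that of T_2. *)
Definition metric_tensor m (s : 'S_m) (j l : 'I_m.*2 -> 'I_n) : k :=
  (\prod_(i < m) G (j (fst_pos i)) (j (snd_pos i)))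
  * \prod_(i < m) invmx G (l (fst_pos i)) (l (snd_pos (s i))).

(* As an element of E^* (x) E = End(E), e^j (x) e_l is the matrix unit E_(l, j). *)
Definition w_tensor m (s : 'S_m) : tensor k n m.*2 :=
  symmetrize (fun u => metric_tensor s (fun p => (tnth u p).2)
                                       (fun p => (tnth u p).1)).

Definition w_form m (s : 'S_m) : {mpoly k[n * n]} -> k :=
  tensor_form (w_tensor s).

(* As an element of (E^* (x) E)^* = End(E)^*, e^j (x) e_l is T |-> e^j(T e_l),
   that is, the coordinate function X_jl. *)
Definition a_poly m (s : 'S_m) : {mpoly k[n * n]} :=
  \sum_(u : m.*2.-tuple ('I_n * 'I_n))
    metric_tensor s (fun p => (tnth u p).1) (fun p => (tnth u p).2)
    *: \prod_(p < m.*2) generic_mx k n (tnth u p).1 (tnth u p).2.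

(* w_form s and a_poly s only depend on the conjugacy class of s. *)
Section Conjugation.
Variables (m : nat) (t : 'S_m).

Lemma half_pos_subproof (p : 'I_m.*2) : (p./2 < m)%N.
Proof.
rewrite -ltn_double (leq_ltn_trans _ (ltn_ord p)) //.
by rewrite -{2}(odd_double_half p) leq_addl.
Qed.

Let half_pos (p : 'I_m.*2) : 'I_m := Ordinal (half_pos_subproof p).

Let move_pos (p : 'I_m.*2) : 'I_m.*2 :=
  if odd p then snd_pos (t (half_pos p)) else fst_pos (t (half_pos p)).

Let half_fst i : half_pos (fst_pos i) = i.
Proof. by apply: val_inj; rewrite /= doubleK. Qed.

Let half_snd i : half_pos (snd_pos i) = i.
Proof. by apply: val_inj; rewrite /= uphalf_double. Qed.

Let move_fst i : move_pos (fst_pos i) = fst_pos (t i).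
Proof. by rewrite /move_pos /= odd_double half_fst. Qed.

Let move_snd i : move_pos (snd_pos i) = snd_pos (t i).
Proof. by rewrite /move_pos /= odd_double half_snd. Qed.

Let move_pos_inj : injective move_pos.
Proof.
have odd_move p : odd (move_pos p) = odd p.
  by rewrite /move_pos; case: ifP => /= _; rewrite odd_double.
have half_move p : half_pos (move_pos p) = t (half_pos p).
  by rewrite /move_pos; case: ifP => _; rewrite ?half_snd ?half_fst.
move=> p q eq_pq; apply: ord_inj; rewrite -(odd_double_half p) -(odd_double_half q).
have := congr1 (fun x : 'I_m.*2 => odd x) eq_pq; rewrite !odd_move => ->.
have := congr1 half_pos eq_pq; rewrite !half_move => /perm_inj /(congr1 val) /= ->.
by [].
Qed.

Let pi : 'S_m.*2 := perm move_pos_inj.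

Lemma metric_tensor_conj (s : 'S_m) (j l : 'I_m.*2 -> 'I_n) :
  metric_tensor (s ^ t)%g j l = metric_tensor s (j \o pi) (l \o pi).
Proof.
rewrite /metric_tensor; congr (_ * _); rewrite (reindex_inj (@perm_inj _ t)) /=.
  by apply: eq_bigr => i _; rewrite !permE move_fst move_snd.
by apply: eq_bigr => i _; rewrite permJ /= !permE move_fst move_snd.
Qed.

Lemma a_poly_conj (s : 'S_m) : a_poly (s ^ t)%g = a_poly s.
Proof.
pose act (q : 'S_m.*2) (u : m.*2.-tuple ('I_n * 'I_n)) :=
  [tuple tnth u (q p) | p < m.*2].
have actK : cancel (act pi) (act pi^-1%g).
  by move=> u; apply: eq_from_tnth => p; rewrite !tnth_mktuple permKV.
rewrite /a_poly [RHS](reindex_inj (can_inj actK)) /=; apply: eq_bigr => u _.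
rewrite metric_tensor_conj; congr (_ *: _).
  rewrite /metric_tensor /=; congr (_ * _);
  by apply: eq_bigr => i _; rewrite !tnth_mktuple.
rewrite (reindex_inj (@perm_inj _ pi)) /=.
by apply: eq_bigr => p _; rewrite tnth_mktuple.
Qed.

Lemma w_form_conj (s : 'S_m) : w_form (s ^ t)%g =1 w_form s.
Proof.
move=> p; rewrite /w_form /tensor_form; apply: eq_bigr => mm _; congr (_ * _).
case: insubP => //= u _ _; rewrite /w_tensor /symmetrize; congr (_ * _).
rewrite [RHS](reindex_inj (mulgI pi)) /=; apply: eq_bigr => tau _.
rewrite metric_tensor_conj /metric_tensor /=; congr (_ * _);
by apply: eq_bigr => i _; rewrite !tnth_mktuple !permM.
Qed.

End Conjugation.

(* The number of cycles of s, fixed points included. *)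
Definition ncycles m (s : 'S_m) : nat := #|porbits s|.

Definition bounded_classes m : {set {set 'S_m}} :=
  [set C in classes [set: 'S_m] |
     [forall s in C, forall c in porbits s, #|c| <= n]%N].

Definition class_rep m (i : 'I_#|bounded_classes m|) : 'S_m :=
  repr (enum_val i).

Definition lambda_mx m : 'M[k]_#|bounded_classes m| :=
  \matrix_(i, j) (w_form (class_rep i) (a_poly (class_rep j))
    / (n%:R ^+ ncycles (class_rep i) * n%:R ^+ ncycles (class_rep j))).

Definition lambda_vec m : 'cV[k]_#|bounded_classes m| :=
  invmx (lambda_mx m) *m const_mx 1.

(* The term of degree 0 is p |-> p(0), and the term of index m only depends on
   the component of degree 2m of p, so that the terms with m >= msize p, where
   msize p = deg p + 1, vanish at p. *)
Definition integral_series (p : {mpoly k[n * n]}) : k :=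
  p@_0%MM
  + \sum_(1 <= m < msize p) \sum_(i < #|bounded_classes m|)
      lambda_vec m i 0 * (w_form (class_rep i) p
                          / n%:R ^+ ncycles (class_rep i)).

End Invariants.

Definition gram_mx (k : fieldType) (E : vectType k) (n : nat)
    (T2 : E -> E -> k) (e : n.-tuple E) : 'M[k]_n :=
  \matrix_(i, j) T2 (tnth e i) (tnth e j).

(* Main.v *)
Require Import Defs.
From HB Require Import structures.
From Stdlib Require Import ClassicalEpsilon FunctionalExtensionality.
From mathcomp Require Import all_boot all_order all_fingroup all_algebra.
From mathcomp Require Import mpoly ring.

(* Let V be the span, in the r-th tensor power of E, of the pairing tensors, which
   are the products of copies of T^2 over the perfect matchings of the r positions,
   and let V* be the span of the dual ones, made from T_2.  The pairing of V* and V
   is perfect: its Gram matrix does not depend on the metric, and for the standard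
   metric over the rationals it is the Gram matrix of a positive definite form.
   Hence there is a projection P onto V along the annihilator of V*.  Its matrix
   coefficients are the values of w_{O_n} on the monomials of degree r: the form so
   defined kills the ideal of O_n because P commutes with the contraction of two
   positions, and it is invariant because O_n fixes V and V*.  If w is the tensor of
   another left invariant integral, then P w = w, by evaluating the invariance at the
   universal point of O_n, and P w = P, because w kills the ideal; so w = P.

   The union of two perfect matchings is a bipartite graph, so the symmetric tensor P
   is a combination of the w_sigma; as the minors of size n + 1 of T^2 vanish, the
   sigma with cycles of length at most n suffice.  Applying the form to a_sigma', whose
   value on O_n is n^r(sigma'), gives the linear system satisfied by the coefficients.
   A combination of the w_sigma lies in V (x) V*, so it vanishes as soon as all the
   a_sigma' vanish on it; and the w_sigma are independent because their values at
   suitable matrices are products of the first n power sums, which are algebraically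
   independent.  Hence the matrix of the system is invertible. *)

Set Implicit Arguments.
Unset Strict Implicit.
Unset Printing Implicit Defensive.

Import GRing.Theory Num.Theory.
Local Open Scope ring_scope.

(** * Products over pairs of consecutive elements *)

(** The pairing tensors are indexed by all permutations of the positions, so each matching occurs
    many times; for r > 2n even the tensors of distinct matchings are dependent. The Gram matrix is
    therefore singular, and perfectness takes the form: a combination of pairing tensors whose Gram
    products all vanish is zero. With a pseudo-inverse this suffices to build P. As the
    pseudo-inverse involves choices, the symmetries of P are not read off its coefficients: a
    composite is computed in two ways, using that P fixes V and that its transpose fixes V*.
    Invariance is tested at points over all commutative algebras, so the generic matrix modulo the
    ideal of O_n is an allowed test point. Identities at this point hold modulo the ideal, and any
    linear form killing the ideal can be applied to them. The reduction to short cycles uses only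
    two properties of a function on S_m: constancy on classes and the alternating relations. Both
    sigma -> w_sigma(p) and sigma -> C(a_sigma), for C linear, have them, so the same coefficients
    serve for both. *)

Section PairProducts.

(** The value 0 on a leftover element makes every tensor of odd degree vanish, so degrees need no
    parity condition. *)
Fixpoint pairprod (R : pzSemiRingType) (T : Type) (f : T -> T -> R) (s : seq T) : R :=
  match s with
  | [::] => 1
  | [:: _] => 0
  | x :: y :: s' => f x y * pairprod f s'
  end.

Lemma pair_ind (T : Type) (P : seq T -> Prop) :
  P [::] -> (forall x, P [:: x]) -> (forall x y s, P s -> P [:: x, y & s]) ->
  forall s, P s.
Proof.
move=> P0 P1 P2 s; suff [] : P s /\ (forall x, P (x :: s)) by [].
by elim: s => [|y s [IHs IHxs]]; split=> // x; apply: P2.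
Qed.

Lemma pairprod_map (R : pzSemiRingType) (S T : Type) (g : S -> T) (f : T -> T -> R) s :
  pairprod f (map g s) = pairprod (fun x y => f (g x) (g y)) s.
Proof. by elim/pair_ind: s => //= x y s ->. Qed.

Lemma eq_pairprod (R : pzSemiRingType) (T : Type) (f g : T -> T -> R) s :
  f =2 g -> pairprod f s = pairprod g s.
Proof. by move=> fg; elim/pair_ind: s => //= x y s ->; rewrite fg. Qed.

Lemma eq_in_pairprod (R : pzSemiRingType) (T : eqType) (f g : T -> T -> R) s :
  {in s &, f =2 g} -> pairprod f s = pairprod g s.
Proof.
elim/pair_ind: s => //= x y s IHs fg.
rewrite fg ?inE ?eqxx ?orbT // IHs // => p q ps qs.
by rewrite fg // !inE ?ps ?qs !orbT.
Qed.

Lemma rmorph_pairprod (R S : pzSemiRingType) (h : {rmorphism R -> S}) (T : Type)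
    (f : T -> T -> R) s :
  h (pairprod f s) = pairprod (fun x y => h (f x y)) s.
Proof.
by elim/pair_ind: s => [|x|x y s IHs] /=; rewrite ?rmorph1 ?rmorph0 ?rmorphM ?IHs.
Qed.

Lemma pairprod_odd (R : pzSemiRingType) (T : Type) (f : T -> T -> R) s :
  odd (size s) -> pairprod f s = 0.
Proof. by elim/pair_ind: s => //= x y s IHs; rewrite negbK => /IHs->; rewrite mulr0. Qed.

(** Equality of the underlying perfect matchings, tested on all symmetric functions in all rings: it
    then applies at once to metric tensors and to the integer-valued colouring test [bicolored]. *)
Definition pairing_eq (T : Type) (s t : seq T) : Prop :=
  forall (R : comNzRingType) (f : T -> T -> R), (forall x y, f x y = f y x) ->
  pairprod f s = pairprod f t.

(** Brings the pair containing [x] to the front, with [x] first: commutativity moves the pair,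
    symmetry of the function turns it round. *)
Lemma pairing_pick (T : eqType) (s : seq T) x : ~~ odd (size s) -> x \in s ->
  exists y s', perm_eq s [:: x, y & s'] /\ pairing_eq s [:: x, y & s'].
Proof.
elim/pair_ind: s => [|//|a b s IHs] //=; rewrite negbK => ev_s.
rewrite !inE; case: eqVneq => [-> _|_ /=]; first by exists b, s.
case: eqVneq => [-> _|_ /= /(IHs ev_s)[y [s' [eq_s peq_s]]]].
  exists a, s; split=> [|R f fC] /=; last by rewrite fC.
  by rewrite (perm_catCA [:: a] [:: b] s).
exists y, [:: a, b & s']; split=> [|R f fC] /=; last by rewrite peq_s //= mulrCA.
rewrite -[_ :: _ :: s]/([:: a; b] ++ s) perm_sym.
rewrite -[_ :: _ :: _]/([:: x; y] ++ [:: a; b] ++ s') perm_catCA perm_cat2l.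
by rewrite perm_sym.
Qed.

End PairProducts.

Section Contraction.
Variables (R : comNzRingType) (n : nat) (G K : 'M[R]_n).
Hypotheses (K_sym : K^T = K) (KG : K *m G = 1%:M).

Let KC a b : K a b = K b a. Proof. by rewrite -{1}K_sym mxE. Qed.

(** If [x] and [y] are matched together, contracting them splits off a scalar, the full contraction
    of [G] with [K]. Otherwise their partners [z] and [z'] become matched, because K G K = K, and
    the scalar is 1. *)
Lemma pairprod_contract (I : eqType) (s : seq I) x y :
    uniq s -> ~~ odd (size s) -> x \in s -> y \in s -> x != y ->
  exists s', perm_eq s [:: x, y & s'] /\ exists c : R, forall w : I -> 'I_n,
    \sum_a \sum_b G a b *
      (let w' p := if p == x then a else if p == y then b else w p in
       pairprod (fun p q => K (w' p) (w' q)) s)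
    = c * pairprod (fun p q => K (w p) (w q)) s'.
Proof.
move=> uniq_s ev_s xs ys neq_xy.
have [z [s1 [eq_s peq_s]]] := pairing_pick ev_s xs.
have uniq_s1 : uniq [:: x, z & s1] by rewrite -(perm_uniq eq_s).
have notin_w w a b t : x \notin t -> y \notin t ->
    pairprod (fun p q => K (if p == x then a else if p == y then b else w p)
                           (if q == x then a else if q == y then b else w q)) t
    = pairprod (fun p q => K (w p) (w q)) t.
  move=> xt yt; apply: eq_in_pairprod => p q pt qt.
  have neq (r u : I) : r \notin t -> u \in t -> (u == r) = false.
    by move=> rt ut; apply/eqP => eq_ur; rewrite -eq_ur ut in rt.
  by rewrite !(neq x) ?(neq y).
have [def_z|neq_yz] := eqVneq y z.
  exists s1; rewrite def_z; split=> //; exists (\sum_a \sum_b G a b * K a b) => w.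
  rewrite mulr_suml; apply: eq_bigr => a _; rewrite mulr_suml; apply: eq_bigr => b _.
  rewrite /= peq_s => [|p q]; last exact: KC.
  move: uniq_s1; rewrite /= inE negb_or -andbA => /and4P[xz xs1 zs1 _].
  by rewrite /= -def_z notin_w ?def_z // !eqxx [z == x]eq_sym (negPf xz) mulrA.
have ev_s1 : ~~ odd (size s1) by move: ev_s; rewrite (perm_size eq_s) /= negbK.
have ys1 : y \in s1.
  by move: ys; rewrite (perm_mem eq_s) !inE eq_sym (negPf neq_xy) (negPf neq_yz).
have [z' [s2 [eq_s1 peq_s1]]] := pairing_pick ev_s1 ys1.
have eq_s2 : perm_eq s [:: x, z, y, z' & s2].
  by apply: perm_trans eq_s _; rewrite !perm_cons.
exists [:: z, z' & s2]; split.
  apply: perm_trans eq_s2 _; rewrite perm_cons.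
  by rewrite (perm_catCA [:: z] [:: y] (z' :: s2)).
exists 1 => w; rewrite mul1r /= .
move: uniq_s1; rewrite (perm_uniq eq_s) in uniq_s.
have : uniq [:: x, z, y, z' & s2] by rewrite -(perm_uniq eq_s2) (perm_uniq eq_s).
rewrite /= !inE !negb_or -!andbA => /and5P[xz xy xz' xs2] /and5P[zy zz' zs2 yz'].
move=> /and3P[ys2 z's2 _] _.
under eq_bigr do under eq_bigr do
  (rewrite peq_s /= ?peq_s1 /= ?notin_w // => *; try exact: KC).
rewrite !eqxx [z == x]eq_sym [y == x]eq_sym [z' == x]eq_sym [z' == y]eq_sym.
rewrite (negPf xz) (negPf xy) (negPf xz') (negPf zy) (negPf yz').
transitivity (((K *m G *m K) (w z) (w z')) * pairprod (fun p q => K (w p) (w q)) s2);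
  last by rewrite KG mul1mx.
rewrite -mulmxA mxE mulr_suml; apply: eq_bigr => a _; rewrite mxE mulr_sumr mulr_suml.
by apply: eq_bigr => b _; rewrite (KC a) !mulrA [G a b * _]mulrC.
Qed.

End Contraction.

(** * Pairing tensors *)

Section Words.

Lemma perm_eq_enumP d (s : seq 'I_d) :
  perm_eq s (enum 'I_d) -> exists t : 'S_d, s = [seq t i | i <- enum 'I_d].
Proof.
move=> eq_s; have sz_s : size s = d by rewrite (perm_size eq_s) size_enum_ord.
have sz_s' : size s == d by apply/eqP.
have /tuple_permP[t def_s] : perm_eq (Tuple sz_s') (ord_tuple d) by [].
exists t; have -> : s = [tuple tnth (ord_tuple d) (t i) | i < d] by exact: def_s.
by apply: eq_map => i; rewrite tnth_ord_tuple.
Qed.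

Lemma perm_eq_perm_enum d (t : 'S_d) : perm_eq [seq t i | i <- enum 'I_d] (enum 'I_d).
Proof.
apply: uniq_perm; rewrite ?(map_inj_uniq perm_inj) ?enum_uniq //.
move=> i; rewrite mem_enum inE; apply/mapP.
by exists ((t^-1)%g i); rewrite ?mem_enum ?permKV.
Qed.

Definition word_cons T d (a : T) (w : 'I_d -> T) (p : 'I_d.+1) : T :=
  oapp w a (unlift ord0 p).

Lemma word_cons0 T d a (w : 'I_d -> T) : word_cons a w ord0 = a.
Proof. by rewrite /word_cons unlift_none. Qed.

Lemma word_consS T d a (w : 'I_d -> T) p : word_cons a w (lift ord0 p) = w p.
Proof. by rewrite /word_cons liftK. Qed.

Lemma eq_word_cons T d a (w w' : 'I_d -> T) : w =1 w' -> word_cons a w =1 word_cons a w'.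
Proof. by move=> eq_w p; rewrite /word_cons; case: unlift => /=. Qed.

Lemma big_word_cons (R : nmodType) (T : finType) d (F : {ffun 'I_d.+1 -> T} -> R) :
  \sum_w F w = \sum_a \sum_(w : {ffun 'I_d -> T}) F (finfun (word_cons a w)).
Proof.
rewrite pair_big /= (reindex (fun aw : T * {ffun 'I_d -> T} => finfun (word_cons aw.1 aw.2))).
  by apply: eq_bigr => -[].
exists (fun w : {ffun 'I_d.+1 -> T} => (w ord0, [ffun p => w (lift ord0 p)])).
  move=> [a w] _ /=; congr (_, _); first by rewrite ffunE word_cons0.
  by apply/ffunP => p; rewrite !ffunE word_consS.
move=> w _; apply/ffunP => p; rewrite ffunE /= /word_cons.
by case: unliftP => [q|] -> //=; rewrite ffunE.
Qed.

Lemma big_word0 (R : nmodType) (T : finType) (F : {ffun 'I_0 -> T} -> R) w :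
  \sum_w F w = F w.
Proof.
rewrite (bigD1 w) //= big1 ?addr0 // => w' /eqP[].
by apply/ffunP => -[].
Qed.

End Words.

Section PairingTensors.
Variable R : comNzRingType.
Variable n : nat.
Implicit Types (K N : 'M[R]_n).

(** The permutation [s] encodes the matching {s(0), s(1)}, {s(2), s(3)}, ... of the positions.
    Repetitions are harmless, since only spans of these tensors matter. *)
Definition pairing_tensor K d (s : 'S_d) (w : 'I_d -> 'I_n) : R :=
  pairprod (fun p q => K (w p) (w q)) [seq s i | i <- enum 'I_d].

Lemma eq_pairing_tensor K d (s : 'S_d) (w w' : 'I_d -> 'I_n) :
  w =1 w' -> pairing_tensor K s w = pairing_tensor K s w'.
Proof. by move=> eq_w; apply: eq_pairprod => p q; rewrite !eq_w. Qed.

Lemma pairing_tensorE K d (s : 'S_d) (w : 'I_d -> 'I_n) :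
  pairing_tensor K s w = pairprod (fun p q => K (w (s p)) (w (s q))) (enum 'I_d).
Proof. exact: pairprod_map. Qed.

Lemma pairing_tensorM K d (s t : 'S_d) (w : 'I_d -> 'I_n) :
  pairing_tensor K s (w \o t) = pairing_tensor K (s * t)%g w.
Proof.
by rewrite !pairing_tensorE; apply: eq_pairprod => p q; rewrite !permM.
Qed.

Lemma pairing_tensor_perm K d (s : 'S_d) (w : 'I_d -> 'I_n) :
  pairing_tensor K s w = pairing_tensor K 1 (w \o s).
Proof. by rewrite pairing_tensorM mul1g. Qed.

Lemma pairing_tensor_odd K d (s : 'S_d) w : odd d -> pairing_tensor K s w = 0.
Proof. by move=> odd_d; apply: pairprod_odd; rewrite size_map size_enum_ord. Qed.

Lemma pairing_tensor1_cons K d (w : 'I_d.+2 -> 'I_n) :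
  pairing_tensor K 1 w = K (w ord0) (w (lift ord0 ord0))
    * pairing_tensor K 1 (fun p => w (lift ord0 (lift ord0 p))).
Proof.
rewrite !pairing_tensorE enum_ordSl enum_ordSl /= !perm1 -map_comp pairprod_map.
by congr (_ * _); apply: eq_pairprod => p q; rewrite !perm1.
Qed.

Lemma pairing_tensor1_basis K N d (y : 'I_d -> 'I_n) :
  \sum_(z : {ffun 'I_d -> 'I_n}) (\prod_p N (y p) (z p)) * pairing_tensor K 1 z
  = pairing_tensor (N *m K *m N^T) 1 y.
Proof.
elim/ltn_ind: d y => -[|[|d]] IHd y.
- rewrite (big_word0 _ [ffun p : 'I_0 => y p]) big_ord0 mul1r.
  by rewrite /pairing_tensor enum_ord0.
- rewrite big1 => [|z _]; first by rewrite pairing_tensor_odd.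
  by rewrite pairing_tensor_odd ?mulr0.
rewrite pairing_tensor1_cons -IHd ?ltnS //.
rewrite big_word_cons; under eq_bigr do rewrite big_word_cons /=.
rewrite mxE mulr_suml exchange_big /=; apply: eq_bigr => b _.
under eq_bigr do under eq_bigr do
  rewrite pairing_tensor1_cons !big_ord_recl /= !ffunE !word_consS !ffunE !word_cons0.
rewrite !mxE mulr_suml mulr_suml; apply: eq_bigr => a _; rewrite mulr_sumr.
apply: eq_bigr => z _.
have -> : \prod_(i < d) N (y (lift ord0 (lift ord0 i)))
   ((finfun (word_cons a (finfun (word_cons b z)))) (lift ord0 (lift ord0 i)))
   = \prod_(i < d) N (y (lift ord0 (lift ord0 i))) (z i).
  by apply: eq_bigr => i _; rewrite ffunE word_consS ffunE word_consS.
rewrite (@eq_pairing_tensor _ _ _ _ z) => [|p]; last first.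
  by rewrite ffunE word_consS ffunE word_consS.
by rewrite !mulrA; congr (_ * _); rewrite -!mulrA; congr (_ * _);
   rewrite [RHS]mulrC !mulrA [RHS]mulrAC mulrAC.
Qed.

(** The d-th tensor power of [N] acts on matching tensors through the congruence of the metric.
    Relabelling the positions reduces to the identity permutation, where two letters are summed out
    at a time. *)
Lemma pairing_tensor_basis K N d (s : 'S_d) (y : 'I_d -> 'I_n) :
  \sum_(z : {ffun 'I_d -> 'I_n}) (\prod_p N (y p) (z p)) * pairing_tensor K s z
  = pairing_tensor (N *m K *m N^T) s y.
Proof.
rewrite pairing_tensor_perm.
pose act (t : 'S_d) (z : {ffun 'I_d -> 'I_n}) := [ffun p => z (t p)].
have actK (t : 'S_d) : cancel (act t) (act t^-1%g).
  by move=> z; apply/ffunP => p; rewrite !ffunE permKV.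
rewrite (reindex_inj (can_inj (actK s^-1%g))) /=.
under eq_bigr => z _.
  rewrite (reindex_inj (@perm_inj _ s)) /= pairing_tensor_perm.
  under eq_bigr do rewrite ffunE permK.
  rewrite (@eq_pairing_tensor _ _ _ _ z); last by move=> p /=; rewrite ffunE permK.
  over.
exact: (pairing_tensor1_basis K N (y \o s)).
Qed.

End PairingTensors.

Section WordSums.

Lemma enum_ordSS d : enum 'I_d.+2 = [:: ord0, lift ord0 ord0 &
  [seq lift ord0 (lift ord0 p) | p <- enum 'I_d]].
Proof. by rewrite enum_ordSl enum_ordSl /= -map_comp. Qed.

Lemma perm_eq_mapP (S T : eqType) (f : S -> T) (g : T -> option S) (s : seq T) (e : seq S) :
  pcancel f g -> ocancel g f -> perm_eq s (map f e) ->
  exists2 s' : seq S, s = map f s' & perm_eq s' e.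
Proof.
move=> fK gK eq_s; exists (pmap g s); last first.
  by rewrite -(map_pK fK e); apply: perm_pmap.
rewrite (pmap_filter gK); apply/esym/all_filterP/allP => x.
by rewrite (perm_mem eq_s) => /mapP[y _ ->]; rewrite fK.
Qed.

Lemma reindex_words (R : nmodType) (T : finType) d (t : 'S_d) (F : {ffun 'I_d -> T} -> R) :
  \sum_w F w = \sum_(w : {ffun 'I_d -> T}) F [ffun p => w (t p)].
Proof.
have actK (s : 'S_d) : cancel (fun w : {ffun 'I_d -> T} => [ffun p => w (s p)])
                              (fun w => [ffun p => w (s^-1%g p)]).
  by move=> w; apply/ffunP => p; rewrite !ffunE permKV.
exact: (reindex_inj (can_inj (actK t))).
Qed.

Lemma eq_word_cons2 T d (a b : T) (w : 'I_d -> T) :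
  word_cons a (finfun (word_cons b w)) =1 word_cons a (word_cons b w).
Proof. by apply: eq_word_cons => p; rewrite ffunE. Qed.

End WordSums.

Section PairingContraction.
Variables (R : comNzRingType) (n : nat) (G K : 'M[R]_n).
Hypotheses (n_gt0 : (0 < n)%N) (K_sym : K^T = K) (KG : K *m G = 1%:M).

Lemma pairing_tensor_contract d (s : 'S_d.+2) :
  exists c (t : 'S_d), forall w : 'I_d -> 'I_n,
    \sum_a \sum_b G a b * pairing_tensor K s (word_cons a (word_cons b w))
    = c * pairing_tensor K t w.
Proof.
have [odd_d|ev_d] := boolP (odd d).
  exists 0, 1%g => w; rewrite mul0r big1 // => a _; rewrite big1 // => b _.
  by rewrite pairing_tensor_odd ?mulr0 //= negbK.
pose x : 'I_d.+2 := ord0; pose y : 'I_d.+2 := lift ord0 ord0.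
pose l (p : 'I_d) : 'I_d.+2 := lift ord0 (lift ord0 p).
pose l' (p : 'I_d.+2) : option 'I_d := obind (unlift ord0) (unlift ord0 p).
have lK : pcancel l l' by move=> p; rewrite /l' /l !liftK /= liftK.
have l'K : ocancel l' l.
  by move=> p; rewrite /l' /l; case: unliftP => [q|] -> //=; case: unliftP => [r|] -> /=.
have eq_enum : enum 'I_d.+2 = [:: x, y & map l (enum 'I_d)] := enum_ordSS d.
pose s0 := [seq s i | i <- enum 'I_d.+2].
have eq_s0 : perm_eq s0 (enum 'I_d.+2) by exact: perm_eq_perm_enum.
have [|||||s' [eq_s' [c def_c]]] := pairprod_contract K_sym KG (s := s0) (x := x) (y := y).
- by rewrite (perm_uniq eq_s0) enum_uniq.
- by rewrite (perm_size eq_s0) size_enum_ord /= negbK.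
- by rewrite (perm_mem eq_s0) mem_enum.
- by rewrite (perm_mem eq_s0) mem_enum.
- by [].
have : perm_eq s' (map l (enum 'I_d)).
  rewrite -(perm_cons y) -(perm_cons x) -eq_enum.
  by apply: perm_trans eq_s0; rewrite perm_sym.
case/(perm_eq_mapP lK l'K) => s2 def_s' /perm_eq_enumP[t def_t].
(* [def_c] speaks of words on all d + 2 positions; [a0] only fills the first two, whose letters are
   overwritten by the contraction. *)
exists c, t => w; pose a0 := Ordinal n_gt0.
have := def_c (word_cons a0 (word_cons a0 w)); rewrite def_s' pairprod_map.
rewrite /pairing_tensor -def_t => def_sum.
transitivity (c * pairprod (fun p q => K (word_cons a0 (word_cons a0 w) (l p))
   (word_cons a0 (word_cons a0 w) (l q))) s2); last first.
  by congr (_ * _); apply: eq_pairprod => p q; rewrite !word_consS.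
rewrite -{}def_sum; apply: eq_bigr => a _; apply: eq_bigr => b _.
congr (_ * _); have eq_w p : word_cons a (word_cons b w) p =
   if p == x then a else if p == y then b else word_cons a0 (word_cons a0 w) p.
  rewrite /word_cons; case: unliftP => [q|] -> //=.
  by case: unliftP => [r|] -> //=.
by apply: eq_pairprod => p q; rewrite !eq_w.
Qed.

Lemma pairing_tensor_extend d (s : 'S_d) :
  exists t : 'S_d.+2, forall a b (w : 'I_d -> 'I_n),
    pairing_tensor K t (word_cons a (word_cons b w)) = K a b * pairing_tensor K s w.
Proof.
pose l (p : 'I_d) : 'I_d.+2 := lift ord0 (lift ord0 p).
pose x : 'I_d.+2 := ord0; pose y : 'I_d.+2 := lift ord0 ord0.
have [|t def_t] := @perm_eq_enumP _ [:: x, y & map l [seq s i | i <- enum 'I_d]].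
  rewrite enum_ordSS !perm_cons.
  exact: (perm_map l (perm_eq_perm_enum s)).
exists t => a b w; rewrite /pairing_tensor -def_t /= !word_cons0 word_consS word_cons0.
by rewrite (pairprod_map l); congr (_ * _); apply: eq_pairprod => p q; rewrite !word_consS.
Qed.

End PairingContraction.

(** * Diagonalization of symmetric matrices *)

Section CharZero.
Variables (k : fieldType).
(** The proof of characteristic zero is an argument so that the ring morphism instances, which
    depend on it, can be attached to this constant. *)
Definition rat_in (k_char0 : [pchar k] =i pred0) : rat -> k := ratr.
Hypothesis k_char0 : [pchar k] =i pred0.

Lemma char0_natr_eq0 m : (m%:R == 0 :> k) = (m == 0)%N.
Proof. by move/pcharf0P: k_char0. Qed.

Lemma char0_intr_eq0 z : (z%:~R == 0 :> k) = (z == 0).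
Proof.
case: z => m; first by rewrite -pmulrn char0_natr_eq0.
by rewrite NegzE mulrNz oppr_eq0 oppr_eq0 -pmulrn char0_natr_eq0.
Qed.

(** [ratr] is computed from the reduced fraction; this allows any fraction equal to [x], which is
    what sums and products produce. *)
Lemma rat_in_frac x (a b : int) : b != 0 -> x * b%:~R = a%:~R ->
  rat_in k_char0 x * b%:~R = a%:~R.
Proof.
move=> b_neq0 xb; rewrite /rat_in /ratr mulrAC; apply: (canLR (mulfK _)).
  by rewrite char0_intr_eq0 denq_eq0.
rewrite -!intrM; congr (_%:~R); apply: (@intr_inj rat).
by rewrite !rmorphM /= -xb numqE mulrAC.
Qed.

Let den_neq0 x : (denq x)%:~R != 0 :> k.
Proof. by rewrite char0_intr_eq0 denq_eq0. Qed.

Let rat_in_num x : rat_in k_char0 x * (denq x)%:~R = (numq x)%:~R.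
Proof. by apply: rat_in_frac; rewrite ?denq_eq0 ?numqE. Qed.

Lemma rat_in_zmod_morphism : zmod_morphism (rat_in k_char0).
Proof.
move=> x y; apply: (mulIf (mulf_neq0 (den_neq0 x) (den_neq0 y))); rewrite -intrM.
rewrite (@rat_in_frac _ (numq x * denq y - numq y * denq x)) ?mulf_neq0 ?denq_eq0 //.
  rewrite [RHS]mulrBl intrM mulrA rat_in_num [X in _ = _ - _ * X]mulrC mulrA rat_in_num.
  by rewrite rmorphB !rmorphM.
by rewrite rmorphB !rmorphM /= !numqE; ring.
Qed.

Lemma rat_in_monoid_morphism : monoid_morphism (rat_in k_char0).
Proof.
split=> [|x y]; first by rewrite /rat_in /ratr divr1.
apply: (mulIf (mulf_neq0 (den_neq0 x) (den_neq0 y))); rewrite -intrM.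
rewrite (@rat_in_frac _ (numq x * numq y)) ?mulf_neq0 ?denq_eq0 //.
  by rewrite !intrM mulrACA !rat_in_num.
by rewrite !rmorphM /= !numqE mulrACA.
Qed.

End CharZero.

HB.instance Definition _ (k : fieldType) (k_char0 : [pchar k] =i pred0) := GRing.isZmodMorphism.Build rat k (@rat_in k k_char0)
  (rat_in_zmod_morphism k_char0).
HB.instance Definition _ (k : fieldType) (k_char0 : [pchar k] =i pred0) := GRing.isMonoidMorphism.Build rat k (@rat_in k k_char0)
  (rat_in_monoid_morphism k_char0).

Section Diagonalization.
Variable k : fieldType.
Hypothesis k_char0 : [pchar k] =i pred0.

(** If no basis vector is anisotropic, the diagonal vanishes, and e_i + e_j takes the value 2 K_ij,
    nonzero for some i, j as 2 is invertible. *)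
Lemma anisotropic_row n (K : 'M[k]_n) : K^T = K -> K != 0 ->
  exists v : 'rV_n, (v *m K *m v^T) 0 0 != 0.
Proof.
move=> K_sym K_neq0.
have dE i j : ((delta_mx 0 i : 'rV_n) *m K *m (delta_mx 0 j : 'rV_n)^T) 0 0 = K i j.
  by rewrite -rowE trmx_delta -colE !mxE.
have [i Kii | K_diag0] := pickP (fun i => K i i != 0).
  by exists (delta_mx 0 i); rewrite dE.
have [[i j] Kij | K0] := pickP (fun ij => K ij.1 ij.2 != 0); last first.
  by case/eqP: K_neq0; apply/matrixP => i j; rewrite mxE; apply/eqP/(negbFE (K0 (i, j))).
exists (delta_mx 0 i + delta_mx 0 j); rewrite raddfD /= !mulmxDl !mulmxDr.
have Kji : K j i = K i j by rewrite -{1}K_sym mxE.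
have Kii l : K l l = 0 by apply/eqP/(negbFE (K_diag0 l)).
rewrite mxE [X in X + _]mxE [X in _ + X]mxE !dE !Kii Kji add0r addr0 -mulr2n.
by rewrite -mulr_natr mulf_neq0 // char0_natr_eq0.
Qed.

Lemma row_in_basis n (v : 'rV[k]_n.+1) : v != 0 ->
  exists2 U : 'M_n.+1, U \in unitmx & exists c, v = c *: row 0 U.
Proof.
move=> v_neq0; exists (row_ebase v); first exact: row_ebase_unit.
exists (col_ebase v 0 0); rewrite -{1}(mulmx_ebase v) rank_rV v_neq0.
rewrite [col_ebase v]mx11_scalar mul_scalar_mx -scalemxAl mxE eqxx mulr1n.
congr (_ *: _); rewrite rowE; congr (_ *m _).
by apply/rowP => j; rewrite !mxE eqxx /= ltnS leqn0 eq_sym andbT.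
Qed.

(** Lagrange reduction: a basis starting with an anisotropic vector makes the corner [a] invertible,
    [L] clears the rest of the first row and column, and the induction applies to the Schur
    complement [C']. *)
Lemma sym_diag n (K : 'M[k]_n) : K^T = K ->
  exists2 U : 'M_n, U \in unitmx & is_diag_mx (U *m K *m U^T).
Proof.
elim: n K => [|n IHn] K K_sym.
  by exists 1%:M; rewrite ?unitmx1 //; apply/is_diag_mxP => -[].
have [->|K_neq0] := eqVneq K 0.
  by exists 1%:M; rewrite ?unitmx1 // mulmx0 mul0mx; apply/is_diag_mxP => i j; rewrite mxE.
have [v vKv] := anisotropic_row K_sym K_neq0.
have v_neq0 : v != 0 by apply: contraNneq vKv => ->; rewrite !mul0mx mxE.
have [U U_unit [c def_v]] := row_in_basis v_neq0.
pose M : 'M_(1 + n) := U *m K *m U^T.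
have M_sym : M^T = M by rewrite !trmx_mul trmxK K_sym mulmxA.
have M00 : M 0 0 != 0.
  apply: contraNneq vKv => M00.
  have -> : v *m K *m v^T = (c * c) *: (delta_mx 0 0 *m M *m (delta_mx 0 0 : 'rV_n.+1)^T).
    by rewrite def_v rowE linearZ /= trmx_mul -!scalemxAl -scalemxAr scalerA /M !mulmxA.
  by rewrite -rowE trmx_delta -colE 3!mxE M00 mulr0.
pose a := M 0 0; pose b := ursubmx M; pose C' := drsubmx M - a^-1 *: (b^T *m b).
have def_M : M = block_mx a%:M b b^T (drsubmx M).
  rewrite -{1}(submxK M) {1}[ulsubmx M]mx11_scalar 2!mxE.
  rewrite (_ : lshift n 0 = 0); last exact: val_inj.
  congr block_mx; by rewrite /b -{1}M_sym -trmx_ursub.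
have [|U' U'_unit diag_C'] := IHn C'.
  by rewrite /C' linearB linearZ /= trmx_mul trmxK -{1}M_sym trmx_drsub trmxK.
pose L : 'M_(1 + n) := block_mx 1%:M 0 (- a^-1 *: b^T) 1%:M.
have LML : L *m M *m L^T = block_mx a%:M 0 0 C'.
  rewrite {1}def_M /L tr_block_mx !trmx1 trmx0 linearZ /= trmxK !mulmx_block.
  rewrite !mul1mx !mul0mx !mulmx1 !mulmx0 !addr0 -!scalemxAl -!scalemxAr.
  rewrite mul_mx_scalar mul_scalar_mx !scalerA mulNr mulVf // !scaleN1r !addNr.
  by rewrite mul0mx scaler0 add0r scaleNr addrC.
have L_unit : L \in unitmx by rewrite unitmxE det_lblock !det1 mulr1 unitr1.
pose V : 'M_(1 + n) := block_mx 1%:M 0 0 U'.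
have V_unit : V \in unitmx by rewrite unitmxE det_ublock det1 mul1r -unitmxE.
exists (V *m L *m U).
  by rewrite !unitmx_mul U_unit [_ \in _]V_unit [_ \in _]L_unit.
rewrite !trmx_mul !mulmxA -(mulmxA _ U K) -(mulmxA _ (U *m K)) -/M.
rewrite -(mulmxA _ L M) -(mulmxA _ (L *m M)) LML.
have -> : V *m block_mx a%:M 0 0 C' *m V^T = block_mx a%:M 0 0 (U' *m C' *m U'^T).
  rewrite /V tr_block_mx !trmx0 trmx1 !mulmx_block.
  by rewrite !(mul1mx, mul0mx, mulmx0, mulmx1, addr0, add0r).
by have := is_diag_block_mx a%:M 0 0 (U' *m C' *m U'^T) (erefl 1); rewrite !eqxx diag_C' andbT scalar_mx_is_diag => ->.
Qed.

Lemma sym_diagP n (K : 'M[k]_n) : K^T = K ->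
  exists2 N : 'M_n, N \in unitmx & exists d : 'rV_n, K = N *m diag_mx d *m N^T.
Proof.
move=> /sym_diag[U U_unit /diag_mxP[d def_d]].
exists (invmx U); first by rewrite unitmx_inv.
by exists d; rewrite -def_d !mulmxA mulVmx // mul1mx -mulmxA -trmx_mul mulVmx // trmx1 mulmx1.
Qed.

End Diagonalization.

(** * The Gram matrix of the pairing tensors *)

Section DiagonalMetric.
Variables (R : comNzRingType) (n : nat).

(** If all matched letters agree, each letter fills whole pairs, so half its count is its number of
    pairs; otherwise both sides vanish. Thus a diagonal metric only scales each word by a weight
    independent of the matching. *)
Lemma pairprod_diag (I : eqType) (d : 'rV[R]_n) (w : I -> 'I_n) (s : seq I) :
  pairprod (fun p q => diag_mx d (w p) (w q)) s
  = pairprod (fun p q => (1%:M : 'M_n) (w p) (w q)) s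
    * \prod_a d 0 a ^+ (count (fun p => w p == a) s)./2.
Proof.
elim/pair_ind: s => [|p|p q s IHs] /=; rewrite ?mul0r //.
  by rewrite mul1r big1 // => a _; rewrite expr0.
rewrite {}IHs !mxE; case: eqVneq => [eq_pq|_]; last by rewrite !mul0r.
rewrite eq_pq !mulr1n mul1r mulrCA; congr (_ * _).
rewrite (bigD1 (w q)) //= [RHS](bigD1 (w q)) //= eqxx !add1n mulrA -exprS.
congr (_ * _); apply: eq_bigr => a /negPf neq_a.
by rewrite eq_sym neq_a.
Qed.

Lemma pairing_tensor_diag (d : 'rV[R]_n) r (s : 'S_r) (w : 'I_r -> 'I_n) :
  pairing_tensor (diag_mx d) s w
  = pairing_tensor 1%:M s w * \prod_a d 0 a ^+ (count (fun p => w p == a) (enum 'I_r))./2.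
Proof.
rewrite /pairing_tensor pairprod_diag; congr (_ * _).
by apply: eq_bigr => a _; move: (perm_eq_perm_enum s) => /seq.permP->.
Qed.

End DiagonalMetric.

Section WordMatrices.
Variables (R : comNzRingType) (n r : nat).
Notation word := {ffun 'I_r -> 'I_n}.

Definition tensor_power (N : 'M[R]_n) : 'M[R]_#|{: word}| :=
  \matrix_(i, j) \prod_p N ((enum_val i : word) p) ((enum_val j : word) p).

Lemma sum_enum_val (T : finType) (F : T -> R) :
  \sum_(i < #|T|) F (enum_val i) = \sum_x F x.
Proof. by rewrite [RHS](reindex (@enum_val T T)) //; apply/onW_bij/enum_val_bij. Qed.

Lemma sum_word_prod (M N : 'M[R]_n) (y z : 'I_r -> 'I_n) :
  \sum_(w : word) (\prod_p M (y p) (w p)) * (\prod_p N (w p) (z p))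
  = \prod_p (M *m N) (y p) (z p).
Proof.
under [RHS]eq_bigr do rewrite mxE.
by rewrite bigA_distr_bigA; apply: eq_bigr => w _; rewrite big_split.
Qed.

Lemma prod_delta (y z : 'I_r -> 'I_n) :
  \prod_p (1%:M : 'M[R]_n) (y p) (z p) = (finfun y == finfun z)%:R.
Proof.
case: eqVneq => [/ffunP eq_yz | /eqP neq_yz].
  by rewrite big1 // => p _; have:= eq_yz p; rewrite !ffunE => ->; rewrite mxE eqxx.
have [p neq_p | eq_yz] := pickP (fun p => y p != z p).
  by rewrite (bigD1 p) //= mxE (negPf neq_p) mul0r.
by case: neq_yz; apply/ffunP => p; rewrite !ffunE; apply/eqP/(negbFE (eq_yz p)).
Qed.

Lemma tensor_powerM M N : tensor_power (M *m N) = tensor_power M *m tensor_power N.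
Proof.
apply/matrixP => i j; rewrite !mxE -sum_word_prod -sum_enum_val.
by apply: eq_bigr => h _; rewrite !mxE.
Qed.

Lemma tensor_power1 : tensor_power 1%:M = 1%:M.
Proof.
apply/matrixP => i j; rewrite !mxE prod_delta !ffunK ?(inj_eq enum_val_inj) //.
Qed.

Lemma tensor_power_tr N : tensor_power N^T = (tensor_power N)^T.
Proof. by apply/matrixP => i j; rewrite !mxE; apply: eq_bigr => p _; rewrite mxE. Qed.

Definition pairing_mx (K : 'M[R]_n) : 'M[R]_(#|{: 'S_r}|, #|{: word}|) :=
  \matrix_(i, j) pairing_tensor K (enum_val i) (enum_val j : word).

Lemma pairing_mx_basis K N :
  pairing_mx (N *m K *m N^T) = pairing_mx K *m (tensor_power N)^T.
Proof.
apply/matrixP => i j; rewrite !mxE -pairing_tensor_basis -sum_enum_val.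
by apply: eq_bigr => h _; rewrite !mxE mulrC.
Qed.

Lemma pairing_mx_diag d :
  pairing_mx (diag_mx d) = pairing_mx 1%:M *m diag_mx (\row_j
    \prod_a d 0 a ^+ (count (fun p => (enum_val j : word) p == a) (enum 'I_r))./2).
Proof.
by apply/matrixP => i j; rewrite mul_mx_diag !mxE pairing_tensor_diag.
Qed.

End WordMatrices.

Arguments pairing_mx {R n} r K.

Section GramKernel.
Variables (k : fieldType) (n r : nat).
Hypothesis k_char0 : [pchar k] =i pred0.

Lemma map_pairing_mx1 (S : comNzRingType) (f : {rmorphism S -> k}) :
  map_mx f (pairing_mx r (1%:M : 'M[S]_n)) = pairing_mx r 1%:M.
Proof.
apply/matrixP => i j; rewrite !mxE /pairing_tensor rmorph_pairprod.
by apply: eq_pairprod => p q; rewrite !mxE rmorph_nat.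
Qed.

Lemma mulmx_tr_eq0 (F : realFieldType) m p (A : 'M[F]_(m, p)) : A *m A^T = 0 -> A = 0.
Proof.
move=> AA0; apply/matrixP => i j; rewrite mxE.
have : (A *m A^T) i i = 0 by rewrite AA0 mxE.
rewrite mxE => /psumr_eq0P/(_ j) /=; rewrite mxE -expr2 => sq0.
by apply/eqP; rewrite -sqrf_eq0 sq0 // => l _; rewrite mxE -expr2 sqr_ge0.
Qed.

(* Over [rat] the matrix is the Gram matrix of a family of rows for a positive
   definite form. *)
Lemma pairing_mx1_gram_ker m (x : 'M[k]_(m, _)) :
  x *m (pairing_mx r (1%:M : 'M_n) *m (pairing_mx r (1%:M : 'M_n))^T) = 0 ->
  x *m pairing_mx r (1%:M : 'M_n) = 0.
Proof.
set B := pairing_mx r (1%:M : 'M[rat]_n).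
have defB : map_mx (rat_in k_char0) B = pairing_mx r 1%:M by exact: map_pairing_mx1.
(* The matrix has integer entries and the kernel of a matrix commutes with field extension, so it is
   enough to treat the kernel over the rationals. *)
rewrite -!defB map_trmx -map_mxM => /sub_kermxP; rewrite -map_kermx => /submxP[y ->].
rewrite -mulmxA -map_mxM (_ : kermx _ *m B = 0) ?map_mx0 ?mulmx0 //.
by apply: mulmx_tr_eq0; rewrite trmx_mul mulmxA -(mulmxA _ B) mulmx_ker mul0mx.
Qed.

(** Write G = N D N^T and K = N' D^-1 N'^T with N' the inverse transpose of N. In the Gram matrix
    the tensor powers of N and N' cancel, and so do the weights of D and D^-1 on each word ([E]
    below), leaving the standard Gram matrix. *)
Lemma pairing_mx_gram_ker (G K : 'M[k]_n) m (x : 'M[k]_(m, _)) :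
  G^T = G -> K *m G = 1%:M ->
  x *m (pairing_mx r G *m (pairing_mx r K)^T) = 0 -> x *m pairing_mx r G = 0.
Proof.
move=> G_sym KG; have [N N_unit [d def_G]] := sym_diagP k_char0 G_sym.
pose D' : 'rV_n := \row_j (d 0 j)^-1; pose N' := (invmx N)^T.
have [_ G_unit] := mulmx1_unit KG.
have d_neq0 j : d 0 j != 0.
  move: G_unit; rewrite def_G !unitmx_mul unitmx_tr N_unit andbT /= unitmxE det_diag.
  by rewrite unitfE => /prodf_neq0 ->.
have DD' : diag_mx D' *m diag_mx d = 1%:M.
  by rewrite mulmx_diag; apply/matrixP => i j; rewrite !mxE mulVf.
have N'N : N'^T *m N = 1%:M by rewrite trmxK mulVmx.
have def_K : K = N' *m diag_mx D' *m N'^T.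
  apply: (can_inj (mulmxK G_unit)); rewrite KG {1}def_G !mulmxA.
  rewrite -(mulmxA _ N'^T) N'N mulmx1 -(mulmxA N') DD' mulmx1.
  by rewrite -trmx_mul mulmxV ?trmx1.
rewrite {1 2}def_G {1}def_K !pairing_mx_basis !pairing_mx_diag.
rewrite -tensor_power_tr trmx_mul trmxK -!mulmxA (mulmxA (tensor_power _ N^T)).
rewrite -tensor_powerM -(trmxK N') -trmx_mul N'N trmx1 tensor_power1 mul1mx.
rewrite trmx_mul tr_diag_mx (mulmxA (diag_mx _)) mulmx_diag.
set E := diag_mx (\row_j (_ * _)); have -> : E = 1%:M.
  apply/matrixP => i j; rewrite !mxE -big_split big1 //= => a _.
  by rewrite mxE -exprMn mulfV // expr1n.
by rewrite mul1mx => /pairing_mx1_gram_ker x0; rewrite !mulmxA x0 !mul0mx.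
Qed.

End GramKernel.

(** * The projection onto the pairing tensors *)

Section HaarTensor.
Variables (k : fieldType) (n : nat) (G K : 'M[k]_n).

(** Weingarten coefficients. A pseudo-inverse replaces the inverse because the Gram matrix is
    singular in general. *)
Definition haar_coef r (s t : 'S_r) : k :=
  pinvmx (pairing_mx r G *m (pairing_mx r K)^T) (enum_rank s) (enum_rank t).

(* The matrix coefficients of the projection of the r-th tensor power of E onto
   the span of the pairing tensors along the orthogonal of the dual ones. *)
Definition haar_tensor r (j l : 'I_r -> 'I_n) : k :=
  \sum_s \sum_t pairing_tensor K s j * haar_coef s t * pairing_tensor G t l.

Lemma eq_haar_tensor r (j j' l l' : 'I_r -> 'I_n) :
  j =1 j' -> l =1 l' -> haar_tensor j l = haar_tensor j' l'.
Proof.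
move=> eq_j eq_l; apply: eq_bigr => s _; apply: eq_bigr => t _.
by rewrite (eq_pairing_tensor K s eq_j) (eq_pairing_tensor G t eq_l).
Qed.

Let word_rank r (j : 'I_r -> 'I_n) := enum_rank (finfun j).

Let haar_tensor_mx r (j l : 'I_r -> 'I_n) : haar_tensor j l =
  ((pairing_mx r K)^T *m pinvmx (pairing_mx r G *m (pairing_mx r K)^T)
    *m pairing_mx r G) (word_rank j) (word_rank l).
Proof.
rewrite /haar_tensor /haar_coef; move: (pinvmx _) => W.
rewrite mxE exchange_big /= -sum_enum_val; apply: eq_bigr => t _.
rewrite !mxE mulr_suml -sum_enum_val; apply: eq_bigr => s _.
rewrite !mxE /word_rank !enum_rankK !enum_valK; congr (_ * _ * _);
by apply: eq_pairing_tensor => p; rewrite ffunE.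
Qed.

Let pairing_tensor_mx r (C : 'M[k]_n) (s : 'S_r) (j : 'I_r -> 'I_n) :
  pairing_tensor C s j = pairing_mx r C (enum_rank s) (word_rank j).
Proof.
by rewrite mxE /word_rank !enum_rankK; apply: eq_pairing_tensor => p; rewrite ffunE.
Qed.

Hypotheses (k_char0 : [pchar k] =i pred0) (n_gt0 : (0 < n)%N).
Hypotheses (G_sym : G^T = G) (K_sym : K^T = K) (KG : K *m G = 1%:M).

Let GK : G *m K = 1%:M. Proof. exact: mulmx1C. Qed.

(** P fixes V. With A the Gram matrix and W its pseudo-inverse, A W A = A says that the rows of the
    transpose of W A - 1 are relations for the Gram products, hence, by [pairing_mx_gram_ker],
    relations between the tensors themselves. *)
Lemma haar_tensor_pairing r (s : 'S_r) (j : 'I_r -> 'I_n) :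
  \sum_(l : {ffun 'I_r -> 'I_n}) haar_tensor j l * pairing_tensor K s l
  = pairing_tensor K s j.
Proof.
have proj : (pairing_mx r K)^T *m pinvmx (pairing_mx r G *m (pairing_mx r K)^T)
    *m pairing_mx r G *m (pairing_mx r K)^T = (pairing_mx r K)^T.
  set A := pairing_mx r G *m _; have := mulmxKpV (submx_refl A).
  move: (pinvmx A) => W AWA; apply/eqP; rewrite -subr_eq0 -!mulmxA -/A -{2}[(pairing_mx r K)^T]mulmx1 -mulmxBr.
  rewrite -trmx_eq0 trmx_mul trmxK; apply/eqP.
  apply: (pairing_mx_gram_ker k_char0 K_sym GK).
  rewrite -[X in _ *m X]trmxK trmx_mul trmxK -trmx_mul -/A mulmxBr mulmxA.
  by rewrite AWA mulmx1 subrr trmx0.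
transitivity ((pairing_mx r K)^T (word_rank j) (enum_rank s)).
  rewrite -proj mxE -sum_enum_val; apply: eq_bigr => l _.
  rewrite haar_tensor_mx pairing_tensor_mx [(pairing_mx r K)^T l _]mxE.
  by rewrite /word_rank ffunK enum_valK.
by rewrite mxE -pairing_tensor_mx.
Qed.

Lemma pairing_haar_tensor r (s : 'S_r) (l : 'I_r -> 'I_n) :
  \sum_(j : {ffun 'I_r -> 'I_n}) pairing_tensor G s j * haar_tensor j l
  = pairing_tensor G s l.
Proof.
have proj : pairing_mx r G *m ((pairing_mx r K)^T
    *m pinvmx (pairing_mx r G *m (pairing_mx r K)^T) *m pairing_mx r G) = pairing_mx r G.
  set A := pairing_mx r G *m (pairing_mx r K)^T; have := mulmxKpV (submx_refl A).
  move: (pinvmx A) => W AWA; apply/eqP; rewrite -subr_eq0 !mulmxA -/A -{2}[pairing_mx r G]mul1mx -mulmxBl.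
  apply/eqP/(pairing_mx_gram_ker k_char0 G_sym KG).
  by rewrite -/A mulmxBl mul1mx AWA subrr.
rewrite pairing_tensor_mx -proj [RHS]mxE -sum_enum_val; apply: eq_bigr => j _.
by rewrite haar_tensor_mx pairing_tensor_mx /word_rank ffunK enum_valK.
Qed.

(** Let Q be P conjugated by [s]. As [s] permutes the matchings, P Q can be collapsed from either
    side: P fixes the V factor of Q, giving Q, and the transpose of Q fixes the V* factor of P,
    giving P. *)
Lemma haar_tensor_perm r (s : 'S_r) (j l : 'I_r -> 'I_n) :
  haar_tensor (j \o s) (l \o s) = haar_tensor j l.
Proof.
transitivity (\sum_(m : {ffun 'I_r -> 'I_n}) haar_tensor j m * haar_tensor (m \o s) (l \o s)).
  under [RHS]eq_bigr => m _.
    rewrite {2}/haar_tensor mulr_sumr.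
    under eq_bigr do rewrite mulr_sumr.
    over.
  rewrite exchange_big; apply: eq_bigr => t _; rewrite exchange_big.
  apply: eq_bigr => u _ /=.
  rewrite pairing_tensorM -haar_tensor_pairing !mulr_suml; apply: eq_bigr => m _.
  by rewrite -pairing_tensorM !mulrA.
under eq_bigr => m _.
  rewrite {1}/haar_tensor mulr_suml.
  under eq_bigr do rewrite mulr_suml.
  over.
rewrite exchange_big; apply: eq_bigr => t _; rewrite exchange_big.
apply: eq_bigr => u _ /=;
have -> : pairing_tensor G u l = pairing_tensor G (u * s^-1)%g (l \o s).
  rewrite -[in RHS]pairing_tensorM; apply: eq_pairing_tensor => p /=.
  by rewrite permKV.
rewrite -pairing_haar_tensor [in RHS](reindex_words s) mulr_sumr; apply: eq_bigr => m _ /=.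
rewrite -[LHS]mulrA -[LHS]mulrA [RHS]mulrA -[RHS]mulrA -[RHS]mulrA.
congr (_ * (_ * (_ * _))); last by apply: eq_haar_tensor => p //=; rewrite ffunE.
by rewrite -pairing_tensorM; apply: eq_pairing_tensor => p; rewrite /= ffunE permKV.
Qed.

Lemma haar_tensor0 (j l : 'I_0 -> 'I_n) : haar_tensor j l = 1.
Proof.
have := haar_tensor_pairing 1%g j.
rewrite (big_word0 _ (finfun l)) /pairing_tensor enum_ord0 /= mulr1 => <-.
by apply: eq_haar_tensor => -[].
Qed.

Lemma haar_tensor_odd r (j l : 'I_r -> 'I_n) : odd r -> haar_tensor j l = 0.
Proof.
move=> odd_r; rewrite /haar_tensor big1 // => s _; rewrite big1 // => t _.
by rewrite pairing_tensor_odd ?mul0r.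
Qed.

(** Contracting two positions sends V in degree r + 2 to V in degree r, so P may be inserted after
    the contraction [phi]. Conversely, tensoring an element of V* with [G] stays in V*, so the
    projection in degree r + 2 is then absorbed. *)
Lemma haar_tensor_contract r (j l : 'I_r -> 'I_n) i i' :
  \sum_a \sum_b G a b * haar_tensor (word_cons a (word_cons b j)) (word_cons i (word_cons i' l))
  = G i i' * haar_tensor j l.
Proof.
pose phi (m : 'I_r -> 'I_n) l' :=
  \sum_a \sum_b G a b * haar_tensor (word_cons a (word_cons b m)) l'.
rewrite -/(phi j _); set l' := word_cons i _.
transitivity (\sum_(m : {ffun 'I_r -> 'I_n}) haar_tensor j m * phi m l').
  have phiE m : phi m l' = \sum_s \sum_t (\sum_a \sum_b G a b *
      pairing_tensor K s (word_cons a (word_cons b m))) * haar_coef s t * pairing_tensor G t l'.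
    rewrite /phi /haar_tensor; under eq_bigr => a _.
      under eq_bigr => b _.
        rewrite mulr_sumr; under eq_bigr do rewrite mulr_sumr.
        over.
      rewrite exchange_big; under eq_bigr do rewrite exchange_big.
      over.
    rewrite exchange_big; apply: eq_bigr => s _ /=; rewrite exchange_big; apply: eq_bigr => t _ /=.
    rewrite !mulr_suml; apply: eq_bigr => a _; rewrite !mulr_suml; apply: eq_bigr => b _.
    by rewrite !mulrA.
  under [RHS]eq_bigr do rewrite phiE mulr_sumr.
  rewrite phiE [RHS]exchange_big; apply: eq_bigr => s _ /=.
  under [RHS]eq_bigr do rewrite mulr_sumr.
  rewrite [RHS]exchange_big; apply: eq_bigr => t _ /=.
  have [c [u def_u]] := pairing_tensor_contract n_gt0 K_sym KG s.
  under [RHS]eq_bigr do rewrite def_u.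
  rewrite def_u -haar_tensor_pairing mulr_sumr !mulr_suml; apply: eq_bigr => m _.
  by rewrite !mulrA [c * _]mulrC.
under eq_bigr do rewrite /haar_tensor mulr_suml.
rewrite exchange_big mulr_sumr; apply: eq_bigr => s _ /=.
under eq_bigr do rewrite mulr_suml.
rewrite exchange_big mulr_sumr; apply: eq_bigr => t _ /=.
rewrite mulrCA; have [u def_u] := pairing_tensor_extend G t.
rewrite -def_u -/l' -pairing_haar_tensor big_word_cons.
under [in RHS]eq_bigr do rewrite big_word_cons.
rewrite /phi mulr_sumr; under eq_bigr => m _.
  rewrite mulr_sumr; under eq_bigr do rewrite mulr_sumr.
  over.
rewrite exchange_big; apply: eq_bigr => a _ /=; rewrite mulr_sumr exchange_big.
apply: eq_bigr => b _ /=; rewrite mulr_sumr; apply: eq_bigr => m _.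
rewrite -[LHS]mulrA; congr (_ * _).
have eq_w p : finfun (word_cons a (finfun (word_cons b m))) p = word_cons a (word_cons b m) p.
  by rewrite ffunE eq_word_cons2.
rewrite (eq_haar_tensor eq_w (frefl l')) (eq_pairing_tensor G u eq_w) def_u.
by rewrite mulrCA mulrA.
Qed.

Section OrthogonalPoints.
Variables (R : comNzRingType) (f : {rmorphism k -> R}) (g : 'M[R]_n).
Hypothesis g_orth : g^T *m map_mx f G *m g = map_mx f G.

(** The equation of O_n exhibits K g^T G as a left inverse of [g]; over a commutative ring it is
    also a right inverse, which is the dual equation. *)
Lemma orthogonal_point_dual :
  g *m map_mx f K *m g^T = map_mx f K.
Proof.
have gKG : (map_mx f K *m g^T *m map_mx f G) *m g = 1%:M.
  by rewrite -!mulmxA (mulmxA g^T) g_orth -map_mxM KG map_mx1.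
have := mulmx1C gKG; rewrite !mulmxA => gKgG.
by rewrite -[LHS]mulmx1 -(map_mx1 f) -GK map_mxM mulmxA gKgG mul1mx.
Qed.

Lemma rmorph_pairing_tensor r (C : 'M[k]_n) (s : 'S_r) (w : 'I_r -> 'I_n) :
  f (pairing_tensor C s w) = pairing_tensor (map_mx f C) s w.
Proof.
rewrite /pairing_tensor rmorph_pairprod; apply: eq_pairprod => p q.
by rewrite mxE.
Qed.

Lemma orthogonal_haar_tensor r (j l : 'I_r -> 'I_n) :
  \sum_(a : {ffun 'I_r -> 'I_n}) (\prod_p g (j p) (a p)) * f (haar_tensor a l)
  = f (haar_tensor j l).
Proof.
rewrite /haar_tensor; under eq_bigr do rewrite rmorph_sum mulr_sumr.
rewrite exchange_big rmorph_sum; apply: eq_bigr => s _.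
under eq_bigr do rewrite rmorph_sum mulr_sumr.
rewrite exchange_big rmorph_sum; apply: eq_bigr => t _.
under eq_bigr do rewrite !rmorphM -!mulrA mulrA (rmorph_pairing_tensor K).
rewrite -mulr_suml pairing_tensor_basis orthogonal_point_dual.
by rewrite !rmorphM (rmorph_pairing_tensor K) mulrA.
Qed.

Lemma haar_tensor_orthogonal r (j l : 'I_r -> 'I_n) :
  \sum_(a : {ffun 'I_r -> 'I_n}) f (haar_tensor j a) * \prod_p g (a p) (l p)
  = f (haar_tensor j l).
Proof.
rewrite /haar_tensor; under eq_bigr do rewrite rmorph_sum mulr_suml.
rewrite exchange_big rmorph_sum; apply: eq_bigr => s _.
under eq_bigr do rewrite rmorph_sum mulr_suml.
rewrite exchange_big rmorph_sum; apply: eq_bigr => t _.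
have gT : g^T *m map_mx f G *m g^T^T = map_mx f G by rewrite trmxK.
rewrite [in RHS]rmorphM (rmorph_pairing_tensor G) -gT -pairing_tensor_basis mulr_sumr.
apply: eq_bigr => a _; rewrite rmorphM -mulrA; congr (_ * _).
rewrite mulrC (rmorph_pairing_tensor G); congr (_ * _).
by apply: eq_bigr => p _; rewrite mxE.
Qed.

End OrthogonalPoints.

End HaarTensor.

(** * The invariant integral *)

Section MonomialExtension.
Variables (R : comNzRingType) (N : nat).

Definition monomial_extension (phi : 'X_{1..N} -> R) (p : {mpoly R[N]}) : R :=
  \sum_(mm <- msupp p) p@_mm * phi mm.

Lemma monomial_extensionE phi (s : seq 'X_{1..N}) p :
  uniq s -> {subset msupp p <= s} ->
  monomial_extension phi p = \sum_(mm <- s) p@_mm * phi mm.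
Proof.
move=> uniq_s p_s; rewrite /monomial_extension.
rewrite (bigID (mem (msupp p)) xpredT) /= [X in _ + X]big1_seq; last first.
  by move=> mm /andP[/memN_msupp_eq0-> _]; rewrite mul0r.
rewrite addr0 [RHS](bigID (mem (msupp p))) /= [X in _ = _ + X]big1; last first.
  by move=> mm /memN_msupp_eq0->; rewrite mul0r.
rewrite addr0 -big_filter -[RHS]big_filter; apply: perm_big.
apply: uniq_perm; rewrite ?filter_uniq ?msupp_uniq // => mm.
rewrite !mem_filter; case: (boolP (mm \in msupp p)) => //= mm_p.
by rewrite p_s.
Qed.

Lemma monomial_extension_scalar phi : scalar (monomial_extension phi).
Proof.
move=> c p q; pose s := undup (msupp p ++ msupp q ++ msupp (c *: p + q)).
have s_sub r : {subset r <= msupp p ++ msupp q ++ msupp (c *: p + q)} -> {subset r <= s}.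
  by move=> r_sub mm /r_sub; rewrite mem_undup.
rewrite !(@monomial_extensionE _ s) ?undup_uniq //;
  try by apply: s_sub => mm; rewrite !mem_cat => ->; rewrite ?orbT.
rewrite mulr_sumr -big_split /=; apply: eq_bigr => mm _.
by rewrite mcoeffD mcoeffZ mulrDl mulrA.
Qed.

HB.instance Definition _ phi := GRing.isLinear.Build R {mpoly R[N]} R *%R
  (monomial_extension phi) (monomial_extension_scalar phi).

Lemma monomial_extensionX phi mm : monomial_extension phi 'X_[mm] = phi mm.
Proof. by rewrite /monomial_extension msuppX big_seq1 mcoeffX eqxx mul1r. Qed.

Lemma prod_mpolyX (s : seq 'I_N) : \prod_(v <- s) 'X_v = 'X_[R, s2m s].
Proof.
elim: s => [|v s IHs].
  rewrite big_nil; have -> : s2m [::] = 0%MM :> 'X_{1..N} by apply/mnmP => i; rewrite !mnmE.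
  by rewrite mpolyX0.
rewrite big_cons IHs -mpolyXD; congr 'X_[_]; apply/mnmP => i.
by rewrite mnmDE mnm1E !mnmE /=.
Qed.

Lemma perm_m2s (s : seq 'I_N) : perm_eq (m2s (s2m s)) s.
Proof.
apply/allP => i _ /=; have /mnmP/(_ i) := s2mK (s2m s).
by rewrite !mnmE => ->.
Qed.

Lemma mpolyX_m2s (mm : 'X_{1..N}) : 'X_[R, mm] = \prod_(v <- m2s mm) 'X_v.
Proof. by rewrite prod_mpolyX s2mK. Qed.

End MonomialExtension.

Section EntryProducts.
Variables (n : nat).
Implicit Types (R : comNzRingType) (s : seq ('I_n * 'I_n)).

Lemma mxindex_pairK : cancel (@mxindex_pair n) (fun c => mxvec_index c.1 c.2).
Proof.
move=> v; case: (mxvec_indexP v) => i j; rewrite /mxindex_pair /mxvec_index.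
by rewrite cast_ordK enum_rankK.
Qed.

Lemma mxvec_indexK : cancel (fun c : 'I_n * 'I_n => mxvec_index c.1 c.2) (@mxindex_pair n).
Proof. by move=> [i j]; rewrite /mxindex_pair /mxvec_index cast_ordK enum_rankK. Qed.

Definition entry_prod R s : {mpoly R[n * n]} := \prod_(c <- s) generic_mx R n c.1 c.2.

Lemma entry_prodX R s : entry_prod R s = 'X_[s2m [seq mxvec_index c.1 c.2 | c <- s]].
Proof. by rewrite -prod_mpolyX big_map; apply: eq_bigr => c _; rewrite mxE. Qed.

Lemma mpolyX_entry_prod R (mm : 'X_{1..n * n}) :
  'X_[R, mm] = entry_prod R [seq mxindex_pair v | v <- m2s mm].
Proof. by rewrite entry_prodX -map_comp (eq_map mxindex_pairK) map_id s2mK. Qed.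

Lemma monomial_extension_entry_prod R (h : seq ('I_n * 'I_n) -> R) s :
  (forall s t, perm_eq s t -> h s = h t) ->
  monomial_extension (fun mm => h [seq mxindex_pair v | v <- m2s mm]) (entry_prod R s) = h s.
Proof.
move=> h_perm; rewrite entry_prodX monomial_extensionX; apply: h_perm.
rewrite -{2}[s](mapK mxvec_indexK); exact/perm_map/perm_m2s.
Qed.

Lemma entry_prod_ffun R d (j l : 'I_d -> 'I_n) :
  \prod_p generic_mx R n (j p) (l p) = entry_prod R [seq (j p, l p) | p <- enum 'I_d].
Proof. by rewrite /entry_prod big_map big_enum. Qed.

(** Semilinearity along k -> R is needed because the invariance conditions compare R-valued
    functions of polynomials over k. *)
Lemma eq_semilinear_form (k R : comNzRingType) (h : {rmorphism k -> R})
    (v w : {mpoly k[n * n]} -> R) :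
  (forall c p q, v (c *: p + q) = h c * v p + v q) ->
  (forall c p q, w (c *: p + q) = h c * w p + w q) ->
  (forall s, v (entry_prod k s) = w (entry_prod k s)) -> v =1 w.
Proof.
move=> v_lin w_lin eq_vw p.
have f0 (f : {mpoly k[n * n]} -> R) : (forall c p q, f (c *: p + q) = h c * f p + f q) -> f 0 = 0.
  by move=> f_lin; have /esym/eqP := f_lin 1 0 0; rewrite scaler0 addr0 rmorph1 mul1r addrC -subr_eq0 addrK => /eqP.
rewrite [p]mpolyE; elim: (msupp p : seq _) => [|mm s IHs]; first by rewrite big_nil !f0.
by rewrite big_cons v_lin w_lin IHs mpolyX_entry_prod eq_vw.
Qed.

Lemma eq_scalar_form (k : comNzRingType) (v w : {mpoly k[n * n]} -> k) :
  scalar v -> scalar w -> (forall s, v (entry_prod k s) = w (entry_prod k s)) -> v =1 w.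
Proof. exact: (@eq_semilinear_form k k idfun). Qed.

End EntryProducts.

Section HaarForm.
Variables (k : fieldType) (n : nat) (G : 'M[k]_n).

Definition haar_seq (s : seq ('I_n * 'I_n)) : k :=
  haar_tensor G (invmx G) (fun p => (tnth (in_tuple s) p).1) (fun p => (tnth (in_tuple s) p).2).

Lemma haar_seqE d (u : d.-tuple ('I_n * 'I_n)) :
  haar_seq u = haar_tensor G (invmx G) (fun p => (tnth u p).1) (fun p => (tnth u p).2).
Proof.
case: u => s sz_s; have def_d := eqP sz_s; case: d / def_d sz_s => sz_s.
have def_u : in_tuple s = Tuple sz_s by exact: val_inj.
by apply: eq_haar_tensor => p; rewrite def_u.
Qed.

Lemma haar_seq_ffun d (j l : 'I_d -> 'I_n) :
  haar_seq [seq (j p, l p) | p <- enum 'I_d] = haar_tensor G (invmx G) j l.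
Proof.
rewrite (haar_seqE [tuple (j p, l p) | p < d]).
by apply: eq_haar_tensor => p; rewrite tnth_mktuple.
Qed.

Definition haar_form : {mpoly k[n * n]} -> k :=
  monomial_extension (fun mm => haar_seq [seq mxindex_pair v | v <- m2s mm]).

HB.instance Definition _ := GRing.Linear.on haar_form.

End HaarForm.

Section HaarFormTheory.
Variables (k : fieldType) (n : nat) (G : 'M[k]_n).
Hypotheses (k_char0 : [pchar k] =i pred0) (n_gt0 : (0 < n)%N).
Hypotheses (G_sym : G^T = G) (G_unit : G \in unitmx).

Let K_sym : (invmx G)^T = invmx G. Proof. by rewrite trmx_inv G_sym. Qed.
Let KG : invmx G *m G = 1%:M. Proof. exact: mulVmx. Qed.

Lemma haar_seq_perm s t : perm_eq s t -> haar_seq G s = haar_seq G t.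
Proof.
move=> eq_st; have sz_s := perm_size eq_st; pose s' := tcast sz_s (in_tuple s).
have def_s' : s' = s :> seq _ by rewrite val_tcast.
have /tuple_permP[q def_q] : perm_eq s' (in_tuple t) by rewrite def_s'.
rewrite -def_s' def_q (haar_seqE _ [tuple tnth (in_tuple t) (q i) | i < size t]).
rewrite -[RHS](haar_tensor_perm k_char0 G_sym K_sym KG q).
by apply: eq_haar_tensor => p; rewrite tnth_mktuple.
Qed.

Lemma haar_form_entry_prod s : haar_form G (entry_prod k s) = haar_seq G s.
Proof. exact/monomial_extension_entry_prod/haar_seq_perm. Qed.

Lemma haar_form_ffun d (j l : 'I_d -> 'I_n) :
  haar_form G (\prod_p generic_mx k n (j p) (l p)) = haar_tensor G (invmx G) j l.
Proof. by rewrite entry_prod_ffun haar_form_entry_prod haar_seq_ffun. Qed.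

Lemma haar_seq_nil : haar_seq G [::] = 1.
Proof. exact: haar_tensor0. Qed.

Lemma haar_form1 : haar_form G 1 = 1.
Proof.
by have := haar_form_entry_prod [::]; rewrite /entry_prod big_nil haar_seq_nil => ->.
Qed.

(** By linearity it suffices to multiply a generator by a product of entries. The factor (X^T G
    X)_ii' adds two positions in front and contracts them with [G], so [haar_tensor_contract]
    applies. *)
Lemma haar_form_ideal p : orthogonal_ideal G p -> haar_form G p = 0.
Proof.
case=> Q ->; rewrite linear_sum big1 // => i _; rewrite linear_sum big1 //= => i' _.
have -> q : haar_form G (q * orthogonal_eqs G i i')
  = haar_form G (q * ((generic_mx k n)^T *m map_mx (@mpolyC (n * n) k) G *m generic_mx k n) i i')
    - G i i' * haar_form G q.
  rewrite /orthogonal_eqs !mxE mulrBr linearB /= [q * _%:MP]mulrC mul_mpolyC linearZ.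
  by [].
apply/eqP; rewrite subr_eq0; apply/eqP.
have lin1 : scalar (fun q => haar_form G (q * ((generic_mx k n)^T
    *m map_mx (@mpolyC (n * n) k) G *m generic_mx k n) i i')).
  by move=> c p1 p2; rewrite mulrDl linearD -scalerAl linearZ.
have lin2 : scalar (fun q => G i i' * haar_form G q).
  by move=> c p1 p2; rewrite linearD linearZ /= mulrDr mulrCA.
apply: (eq_scalar_form lin1 lin2) => s /=.
pose j q := (tnth (in_tuple s) q).1; pose l q := (tnth (in_tuple s) q).2.
have def_s : entry_prod k s = \prod_q generic_mx k n (j q) (l q).
  by rewrite /entry_prod big_tnth.
rewrite {}def_s haar_form_ffun -(haar_tensor_contract k_char0 n_gt0 G_sym K_sym KG).
rewrite -mulmxA mxE mulr_sumr linear_sum; apply: eq_bigr => a _.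
rewrite [(_ *m generic_mx k n) a i']mxE mulr_sumr mulr_sumr linear_sum.
apply: eq_bigr => b _.
rewrite -haar_form_ffun !big_ord_recl !word_cons0 !word_consS !word_cons0.
under [in RHS]eq_bigr do rewrite !word_consS.
rewrite -[G a b * _]linearZ -mul_mpolyC; congr (haar_form G _).
rewrite [_^T i a]mxE [map_mx _ _ a b]mxE.
by rewrite [LHS]mulrC mulrCA -!mulrA.
Qed.

End HaarFormTheory.

(** * Uniqueness *)

Section AlgebraOfMorphism.
Variables (k Q : comNzRingType).

(** An alias of [Q] remembering the morphism [h], which serves as its structure map as a
    k-algebra. *)
Definition algebra_of of {rmorphism k -> Q} : Type := Q.

Variable h : {rmorphism k -> Q}.
Notation Qh := (algebra_of h).

HB.instance Definition _ := GRing.ComNzRing.on Qh.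

Let scaleh (c : k) (x : Qh) : Qh := h c * x.
Let scalehA c d x : scaleh c (scaleh d x) = scaleh (c * d) x.
Proof. by rewrite /scaleh rmorphM mulrA. Qed.
Let scale1h : left_id 1 scaleh.
Proof. by move=> x; rewrite /scaleh rmorph1 mul1r. Qed.
Let scalehDr : right_distributive scaleh +%R.
Proof. by move=> c x y; rewrite /scaleh mulrDr. Qed.
Let scalehDl x : {morph scaleh^~ x : c d / c + d}.
Proof. by move=> c d; rewrite /scaleh rmorphD mulrDl. Qed.
HB.instance Definition _ :=
  GRing.Zmodule_isLmodule.Build k Qh scalehA scale1h scalehDr scalehDl.

Let scalehAl (c : k) (x y : Qh) : c *: (x * y) = (c *: x) * y.
Proof. exact: mulrA. Qed.
HB.instance Definition _ := GRing.Lmodule_isLalgebra.Build k Qh scalehAl.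
HB.instance Definition _ := GRing.Lalgebra_isComAlgebra.Build k Qh.

Lemma algebra_of_in_alg c : in_alg Qh c = h c.
Proof. exact: mulr1. Qed.

End AlgebraOfMorphism.

Lemma exists_quotient_algebra (k : comNzRingType) (A : comAlgType k) (I : A -> Prop) :
  I 0 -> ~ I 1 -> (forall a u v, I u -> I v -> I (a * u + v)) ->
  exists (Q : comAlgType k) (f : {rmorphism A -> Q}),
    (forall x, f x = 0 <-> I x) /\ (forall c, f (in_alg A c) = in_alg Q c).
Proof.
move=> I0 I1 I_closed.
(* The quotient construction wants a boolean ideal, whereas membership in [I] is a proposition;
   excluded middle decides it. *)
pose S (x : A) : bool := excluded_middle_informative (I x).
have SP x : reflect (I x) (S x) by rewrite /S; case: excluded_middle_informative => ?; constructor.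
have S_ideal : idealr_closed S.
  split; [exact/SP | exact/SP | move=> a u v uS vS; apply/SP; apply: I_closed; exact/SP].
pose J : idealr A := HB.pack S (isIdealr.Build A S S_ideal).
pose pr : {rmorphism A -> Quotient.quot J} := \pi_(Quotient.quot J)%qT.
pose h : {rmorphism k -> Quotient.quot J} := pr \o in_alg A.
exists (algebra_of h), pr; split=> [x | c]; last by rewrite algebra_of_in_alg.
split=> [/eqP | Ix].
  by rewrite -[0](rmorph0 pr) /= -Quotient.idealrBE subr0 => /SP.
by apply/eqP; rewrite -[0](rmorph0 pr) /= -Quotient.idealrBE subr0; apply/SP.
Qed.

Lemma entry_prod_tnth (k : comNzRingType) n (s : seq ('I_n * 'I_n)) :
  entry_prod k s = \prod_q generic_mx k n (tnth (in_tuple s) q).1 (tnth (in_tuple s) q).2.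
Proof. by rewrite /entry_prod big_tnth. Qed.

Section PointAction.
Variables (k : fieldType) (n : nat) (R : comAlgType k) (g : 'M[R]_n).
Variable w : {mpoly k[n * n]} -> k.

Lemma extend_formE :
  extend_form w (R := R) =1 monomial_extension (fun mm => in_alg R (w 'X_[mm])).
Proof. by move=> q; apply: eq_bigr => mm _; rewrite /= mulr_algr. Qed.

Lemma extend_form_ffun d (c : R) (j l : 'I_d -> 'I_n) :
  extend_form w (c *: \prod_p generic_mx R n (j p) (l p))
  = c * in_alg R (w (\prod_p generic_mx k n (j p) (l p))).
Proof.
rewrite extend_formE linearZ /=; congr (_ * _).
by rewrite !entry_prod_ffun !entry_prodX monomial_extensionX.
Qed.

Lemma extend_form_sum I (s : seq I) (F : I -> {mpoly R[n * n]}) :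
  extend_form w (\sum_(i <- s) F i) = \sum_(i <- s) extend_form w (F i).
Proof. by rewrite extend_formE linear_sum; apply: eq_bigr => i _; rewrite extend_formE. Qed.

Lemma mmap_entry_prod (M : 'M[{mpoly R[n * n]}]_n) d (j l : 'I_d -> 'I_n) :
  mmap (@mpolyC (n * n) R \o in_alg R) (fun v => mxvec M 0 v)
    (\prod_p generic_mx k n (j p) (l p)) = \prod_p M (j p) (l p).
Proof.
rewrite rmorph_prod; apply: eq_bigr => p _.
by rewrite /= mxE mmapX mmap1U mxvecE.
Qed.

Lemma extend_form_lshift d (j l : 'I_d -> 'I_n) :
  extend_form w (lshift_mpoly g (\prod_p generic_mx k n (j p) (l p)))
  = \sum_(a : {ffun 'I_d -> 'I_n}) (\prod_p g (j p) (a p))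
      * in_alg R (w (\prod_p generic_mx k n (a p) (l p))).
Proof.
rewrite /lshift_mpoly mmap_entry_prod -sum_word_prod extend_form_sum.
apply: eq_bigr => a _; rewrite -extend_form_ffun -mul_mpolyC rmorph_prod.
by congr (extend_form w (_ * _)); apply: eq_bigr => p _; rewrite mxE.
Qed.

Lemma extend_form_rshift d (j l : 'I_d -> 'I_n) :
  extend_form w (rshift_mpoly g (\prod_p generic_mx k n (j p) (l p)))
  = \sum_(a : {ffun 'I_d -> 'I_n})
      in_alg R (w (\prod_p generic_mx k n (j p) (a p))) * \prod_p g (a p) (l p).
Proof.
rewrite /rshift_mpoly mmap_entry_prod -sum_word_prod extend_form_sum.
apply: eq_bigr => a _; rewrite [RHS]mulrC -extend_form_ffun -mul_mpolyC rmorph_prod mulrC.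
by congr (extend_form w (_ * _)); apply: eq_bigr => p _; rewrite mxE.
Qed.

Hypothesis w_lin : scalar w.

Let shift_semilinear (M : 'M[{mpoly R[n * n]}]_n) c p q :
  extend_form w (mmap (@mpolyC (n * n) R \o in_alg R) (fun v => mxvec M 0 v) (c *: p + q))
  = in_alg R c * extend_form w (mmap (@mpolyC (n * n) R \o in_alg R) (fun v => mxvec M 0 v) p)
    + extend_form w (mmap (@mpolyC (n * n) R \o in_alg R) (fun v => mxvec M 0 v) q).
Proof. by rewrite !extend_formE raddfD /= mmapZ /= mul_mpolyC linearP. Qed.

Let alg_semilinear c p q : in_alg R (w (c *: p + q)) = in_alg R c * in_alg R (w p) + in_alg R (w q).
Proof. by rewrite w_lin rmorphD rmorphM. Qed.

Lemma left_invariant_ffun :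
  (forall p, extend_form w (lshift_mpoly g p) = (w p)%:A) <->
  (forall d (j l : 'I_d -> 'I_n), \sum_(a : {ffun 'I_d -> 'I_n}) (\prod_p g (j p) (a p))
      * in_alg R (w (\prod_p generic_mx k n (a p) (l p)))
    = in_alg R (w (\prod_p generic_mx k n (j p) (l p)))).
Proof.
split=> [w_inv d j l|w_inv p]; first by rewrite -extend_form_lshift w_inv.
have := @eq_semilinear_form n k R (in_alg R)
  (fun q => extend_form w (lshift_mpoly g q)) (in_alg R \o w).
apply=> [c p1 p2|c p1 p2|s]; [exact: shift_semilinear | exact: alg_semilinear |].
by rewrite entry_prod_tnth extend_form_lshift w_inv.
Qed.

Lemma right_invariant_ffun :
  (forall p, extend_form w (rshift_mpoly g p) = (w p)%:A) <->
  (forall d (j l : 'I_d -> 'I_n), \sum_(a : {ffun 'I_d -> 'I_n})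
      in_alg R (w (\prod_p generic_mx k n (j p) (a p))) * \prod_p g (a p) (l p)
    = in_alg R (w (\prod_p generic_mx k n (j p) (l p)))).
Proof.
split=> [w_inv d j l|w_inv p]; first by rewrite -extend_form_rshift w_inv.
have := @eq_semilinear_form n k R (in_alg R)
  (fun q => extend_form w (rshift_mpoly g q)) (in_alg R \o w).
apply=> [c p1 p2|c p1 p2|s]; [exact: shift_semilinear | exact: alg_semilinear |].
by rewrite entry_prod_tnth extend_form_rshift w_inv.
Qed.

End PointAction.

Section HaarUniqueness.
Variables (k : fieldType) (n : nat) (G : 'M[k]_n).
Hypotheses (k_char0 : [pchar k] =i pred0) (n_gt0 : (0 < n)%N).
Hypotheses (G_sym : G^T = G) (G_unit : G \in unitmx).

Let K_sym : (invmx G)^T = invmx G. Proof. by rewrite trmx_inv G_sym. Qed.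
Let KG : invmx G *m G = 1%:M. Proof. exact: mulVmx. Qed.

Let haar_form_scalar : scalar (haar_form G). Proof. exact: linearP. Qed.

Lemma haar_form_left_invariant : left_invariant_integral G (haar_form G).
Proof.
split=> [|p|R g g_orth|]; [exact: linearP | exact: haar_form_ideal | | exact: haar_form1].
apply/(left_invariant_ffun _ haar_form_scalar) => d j l.
rewrite haar_form_ffun //; under eq_bigr do rewrite haar_form_ffun //.
exact: orthogonal_haar_tensor.
Qed.

Lemma haar_form_right_invariant : right_invariant_integral G (haar_form G).
Proof.
split=> [|p|R g g_orth|]; [exact: linearP | exact: haar_form_ideal | | exact: haar_form1].
apply/(right_invariant_ffun _ haar_form_scalar) => d j l.
rewrite haar_form_ffun //; under eq_bigr do rewrite haar_form_ffun //.
exact: haar_tensor_orthogonal.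
Qed.

(** The generic matrix modulo the ideal. That the ideal is proper follows from [haar_form], which
    kills it and takes the value 1 at 1. *)
Lemma universal_orthogonal_point :
  exists (Q : comAlgType k) (f : {rmorphism {mpoly k[n * n]} -> Q}),
    [/\ forall p, f p = 0 <-> orthogonal_ideal G p, forall c, f c%:MP = in_alg Q c
      & orthogonal_point G (map_mx f (generic_mx k n))].
Proof.
have [|||Q [f [fI fC]]] := @exists_quotient_algebra k {mpoly k[n * n]} (orthogonal_ideal G).
- by exists 0; rewrite big1 // => i _; rewrite big1 // => j _; rewrite mxE mul0r.
- move/(haar_form_ideal k_char0 n_gt0 G_sym G_unit); rewrite haar_form1 //.
  exact/eqP/oner_neq0.
- move=> a u v [U ->] [V ->]; exists (a *: U + V).
  rewrite mulr_sumr -big_split; apply: eq_bigr => i _; rewrite mulr_sumr -big_split.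
  by apply: eq_bigr => j _; rewrite !mxE mulrDl mulrA.
have fC' c : f c%:MP = in_alg Q c by rewrite -fC /= alg_mpolyC.
exists Q, f; split=> //; rewrite /orthogonal_point; apply/matrixP => i j.
have /fI/eqP : orthogonal_ideal G (orthogonal_eqs G i j).
  exists (delta_mx i j); rewrite (bigD1 i) //= [X in _ = _ + X]big1 => [|i' neq_i].
    rewrite addr0 (bigD1 j) //= [delta_mx i j i j]mxE !eqxx mul1r big1 ?addr0 // => j' neq_j.
    by rewrite [delta_mx i j i j']mxE (negPf neq_j) andbF mul0r.
  by rewrite big1 // => j' _; rewrite [delta_mx i j i' j']mxE (negPf neq_i) mul0r.
have -> : map_mx (in_alg Q) G = map_mx f (map_mx (@mpolyC _ k) G).
  by apply/matrixP => a b; rewrite !mxE fC'.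
rewrite map_trmx -!map_mxM [map_mx _ _ i j]mxE [map_mx _ _ i j]mxE.
by rewrite /orthogonal_eqs mxE [X in f (_ + X)]mxE rmorphB subr_eq0 => /eqP.
Qed.

(** Forms killing the ideal descend to the quotient: a relation in [Q] with scalar coefficients
    lifts to an element of the ideal, and [v] is applied to the lift. *)
Lemma form_of_quotient (Q : comAlgType k) (f : {rmorphism {mpoly k[n * n]} -> Q}) :
  (forall p, f p = 0 <-> orthogonal_ideal G p) -> (forall c, f c%:MP = in_alg Q c) ->
  forall v, scalar v -> (forall p, orthogonal_ideal G p -> v p = 0) -> v 1 = 1 ->
  forall (I : finType) (c : I -> k) (F : I -> {mpoly k[n * n]}) c0,
  f (\sum_a c a *: F a) = in_alg Q c0 -> \sum_a c a * v (F a) = c0.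
Proof.
move=> fI fC v v_lin v_ideal v1 I c F c0 f_sum.
pose fv : {scalar {mpoly k[n * n]}} := HB.pack v (GRing.isLinear.Build k _ _ _ v v_lin).
have /fI/v_ideal : f (\sum_a c a *: F a - c0%:MP) = 0.
  by apply/eqP; rewrite rmorphB subr_eq0 fC f_sum.
have -> : v = fv by []; rewrite linearB linear_sum -alg_mpolyC linearZ.
have -> : fv 1 = 1 by []; rewrite /= mulr1.
move/eqP; rewrite subr_eq0 => /eqP <-; apply: eq_bigr => a _.
by have -> : v = fv by []; rewrite linearZ.
Qed.

Lemma left_invariant_unique w : left_invariant_integral G w -> w =1 haar_form G.
Proof.
case=> w_lin w_ideal w_inv w1.
suff eq_w d (j l : 'I_d -> 'I_n) :
    w (\prod_p generic_mx k n (j p) (l p)) = haar_tensor G (invmx G) j l.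
  by apply: eq_scalar_form => // s; rewrite entry_prod_tnth eq_w haar_form_ffun.
have [Q [f [fI fC g_orth]]] := universal_orthogonal_point.
set g := map_mx f _ in g_orth.
have f_prod (a b : 'I_d -> 'I_n) : f (\prod_p generic_mx k n (a p) (b p)) = \prod_p g (a p) (b p).
  by rewrite rmorph_prod; apply: eq_bigr => p _; rewrite [RHS]mxE.
transitivity (\sum_(a : {ffun 'I_d -> 'I_n}) haar_tensor G (invmx G) j a
    * w (\prod_p generic_mx k n (a p) (l p))).
  have /(_ d j l) w_g := (left_invariant_ffun g w_lin).1 (w_inv Q g g_orth).
  transitivity (\sum_(a : {ffun 'I_d -> 'I_n})
      w (\prod_p generic_mx k n (a p) (l p)) * haar_form G (\prod_p generic_mx k n (j p) (a p))).
    (* The invariance of [w] at the universal point is an identity in [Q] whose scalars are values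
       of [w]; applying [haar_form] to it yields P w = w. *)
    symmetry; apply: (form_of_quotient fI fC haar_form_scalar).
    - by move=> p; apply: haar_form_ideal.
    - exact: haar_form1.
    rewrite -w_g rmorph_sum; apply: eq_bigr => a _.
    by rewrite -mul_mpolyC rmorphM f_prod fC mulrC.
  by apply: eq_bigr => a _; rewrite haar_form_ffun // mulrC.
(* Now the scalars are entries of [haar_tensor]: [w] is applied to the invariance of [haar_tensor]
   at the universal point, yielding P w = P. *)
apply: (form_of_quotient fI fC w_lin w_ideal w1).
rewrite -(haar_tensor_orthogonal (invmx G) g_orth) rmorph_sum.
by apply: eq_bigr => a _; rewrite -mul_mpolyC rmorphM f_prod fC.
Qed.

(** Mirror image of the left case: the composite w P equals both w and P. *)
Lemma right_invariant_unique w : right_invariant_integral G w -> w =1 haar_form G.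
Proof.
case=> w_lin w_ideal w_inv w1.
suff eq_w d (j l : 'I_d -> 'I_n) :
    w (\prod_p generic_mx k n (j p) (l p)) = haar_tensor G (invmx G) j l.
  by apply: eq_scalar_form => // s; rewrite entry_prod_tnth eq_w haar_form_ffun.
have [Q [f [fI fC g_orth]]] := universal_orthogonal_point.
set g := map_mx f _ in g_orth.
have f_prod (a b : 'I_d -> 'I_n) : f (\prod_p generic_mx k n (a p) (b p)) = \prod_p g (a p) (b p).
  by rewrite rmorph_prod; apply: eq_bigr => p _; rewrite [RHS]mxE.
transitivity (\sum_(a : {ffun 'I_d -> 'I_n}) haar_tensor G (invmx G) a l
    * w (\prod_p generic_mx k n (j p) (a p))).
  have /(_ d j l) w_g := (right_invariant_ffun g w_lin).1 (w_inv Q g g_orth).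
  transitivity (\sum_(a : {ffun 'I_d -> 'I_n})
      w (\prod_p generic_mx k n (j p) (a p)) * haar_form G (\prod_p generic_mx k n (a p) (l p))).
    symmetry; apply: (form_of_quotient fI fC haar_form_scalar).
    - by move=> p; apply: haar_form_ideal.
    - exact: haar_form1.
    rewrite -w_g rmorph_sum; apply: eq_bigr => a _.
    by rewrite -mul_mpolyC rmorphM f_prod fC.
  by apply: eq_bigr => a _; rewrite haar_form_ffun // mulrC.
apply: (form_of_quotient fI fC w_lin w_ideal w1).
rewrite -(orthogonal_haar_tensor KG g_orth) rmorph_sum.
by apply: eq_bigr => a _; rewrite -mul_mpolyC rmorphM f_prod fC mulrC.
Qed.

End HaarUniqueness.

(** * Cycle types *)

Section ConjugacyByCycleType.
Variable T : finType.
Implicit Types (s t g : {perm T}) (x y : T).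

Lemma permX_modn s x i : (s ^+ (i %% #|porbit s x|))%g x = (s ^+ i)%g x.
Proof.
have fix_x j : (s ^+ (j * #|porbit s x|))%g x = x.
  elim: j => [|j IHj]; first by rewrite expg0 perm1.
  by rewrite mulSn expgD permM [(s ^+ _)%g x]permX iter_porbit.
by rewrite {2}(divn_eq i #|porbit s x|) expgD permM fix_x.
Qed.

Lemma eq_permX s x i j :
  ((s ^+ i)%g x == (s ^+ j)%g x) = (i == j %[mod #|porbit s x|]).
Proof.
apply/eqP/eqP => [|eq_ij]; last by rewrite -permX_modn eq_ij permX_modn.
rewrite -(permX_modn s x i) -(permX_modn s x j) !permX.
have o_gt0 : (0 < #|porbit s x|)%N by apply/card_gt0P; exists x; exact: porbit_id.
move: (ltn_pmod i o_gt0) (ltn_pmod j o_gt0); move: (i %% _)%N (j %% _)%N => {}i {}j lt_i lt_j.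
rewrite -(nth_traject s lt_i) -(nth_traject s lt_j) => /eqP.
by rewrite nth_uniq ?size_traject ?uniq_traject_porbit // => /eqP.
Qed.

(** Within each level of [key], the i-th element of [P] goes to the i-th element of [Q]. *)
Lemma matching_by_key (S : finType) (key : S -> nat) (P Q : {set S}) :
  (forall j, #|[set c in P | key c == j]| = #|[set c in Q | key c == j]|) ->
  exists f : S -> S, [/\ {in P, forall c, f c \in Q}, {in P, forall c, key (f c) = key c}
    & {in P &, injective f}].
Proof.
move=> eq_PQ; pose lvl (A : {set S}) j := enum [set c in A | key c == j].
pose f c := nth c (lvl Q (key c)) (index c (lvl P (key c))).
have lvlP c : c \in P -> c \in lvl P (key c) by move=> Pc; rewrite mem_enum inE Pc /=.
have ltQ c : c \in P -> (index c (lvl P (key c)) < size (lvl Q (key c)))%N.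
  by move=> Pc; rewrite -cardE -eq_PQ cardE index_mem lvlP.
have f_lvl c : c \in P -> f c \in lvl Q (key c) by move=> Pc; apply/mem_nth/ltQ.
exists f; split=> [c /f_lvl|c /f_lvl|c c' Pc Pc' eq_f].
- by rewrite mem_enum inE => /andP[].
- by rewrite mem_enum inE => /andP[_ /eqP].
have eq_key : key c = key c'.
  have := f_lvl c Pc; rewrite mem_enum inE => /andP[_ /eqP <-].
  by have := f_lvl c' Pc'; rewrite mem_enum inE eq_f => /andP[_ /eqP ->].
have /eqP : f c = nth c (lvl Q (key c)) (index c' (lvl P (key c))).
  by rewrite eq_f /f eq_key; apply: set_nth_default; rewrite -?eq_key ?eq_key ltQ.
rewrite nth_uniq ?enum_uniq ?ltQ //; last by rewrite eq_key ltQ.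
by move/eqP/index_inj; apply; rewrite ?lvlP // eq_key lvlP.
Qed.

(** Cycles of [s] are matched with cycles of [t] of the same length, base points [a] and [b] are
    chosen in matched cycles, and the conjugator sends s^i(a) to t^i(b); equal lengths make this
    injective. *)
Lemma conj_of_cycle_type s t :
  (forall j, #|[set c in porbits s | #|c| == j]| = #|[set c in porbits t | #|c| == j]|) ->
  exists g, t = (s ^ g)%g.
Proof.
case/(matching_by_key (key := fun c : {set T} => #|c|)) => f [f_porb f_card f_inj].
pose a x := odflt x [pick y in porbit s x].
pose b x := odflt x [pick y in f (porbit s x)].
have porb_x x : porbit s x \in porbits s by apply: imset_f.
have aP x : porbit s (a x) = porbit s x.
  rewrite /a; case: pickP => [y|/(_ x)]; last by rewrite porbit_id.
  by rewrite -eq_porbit_mem => /eqP.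
have a_eq x y : porbit s x = porbit s y -> a x = a y.
  by rewrite /a => ->; case: pickP => // /(_ y); rewrite porbit_id.
have bP x : porbit t (b x) = f (porbit s x).
  have /imsetP[z _ def_z] := f_porb _ (porb_x x); rewrite /b def_z.
  case: pickP => [y|/(_ z)]; last by rewrite porbit_id.
  by rewrite -eq_porbit_mem => /eqP.
have b_eq x y : porbit s x = porbit s y -> b x = b y.
  have /imsetP[z _ def_z] := f_porb _ (porb_x y); rewrite /b => ->; rewrite def_z.
  by case: pickP => // /(_ z); rewrite porbit_id.
have /fin_all_exists[e def_x] x : exists i, x = (s ^+ i)%g (a x).
  by apply/porbitP; rewrite -eq_porbit_mem aP.
pose G x := (t ^+ e x)%g (b x).
have GP x : porbit t (G x) = f (porbit s x) by rewrite porbit_perm bP.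
have card_ab x : #|porbit t (b x)| = #|porbit s (a x)| by rewrite bP aP f_card.
have G_inj : injective G.
  move=> x y eq_G; have eq_xy : porbit s x = porbit s y.
    by apply: f_inj => //; rewrite -!GP eq_G.
  move/eqP: eq_G; rewrite /G (b_eq _ _ eq_xy) eq_permX card_ab -eq_permX => /eqP eq_s.
  by rewrite (def_x x) (a_eq _ _ eq_xy) eq_s -def_x.
exists (perm G_inj); apply/permP => z; rewrite -(permKV (perm G_inj) z); set x := (_ z).
rewrite permJ !permE.
have eq_sx : porbit s (s x) = porbit s x by have := porbit_perm s 1 x; rewrite expg1.
rewrite /G (b_eq _ _ eq_sx) -permM -expgSr; apply/eqP.
rewrite eq_permX card_ab -eq_permX expgSr permM -def_x -(a_eq _ _ eq_sx).
by rewrite -def_x.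
Qed.

Lemma porbits_conj s g : porbits (s ^ g)%g = [set g @: c | c : {set T} in porbits s].
Proof.
have porbitJ x : porbit (s ^ g)%g (g x) = g @: porbit s x.
  apply/setP => y; apply/porbitP/imsetP => [[i ->]|[z /porbitP[i ->] ->]].
    by exists ((s ^+ i)%g x); rewrite ?mem_porbit // -conjXg permJ.
  by exists i; rewrite -conjXg permJ.
apply/setP => c; apply/imsetP/imsetP => [[x _ ->]|[_ /imsetP[x _ ->] ->]].
  by exists (porbit s (g^-1%g x)); rewrite ?imset_f // -porbitJ permKV.
by exists (g x); rewrite ?porbitJ.
Qed.

End ConjugacyByCycleType.

Section BoundedClasses.
Variable n m : nat.
Implicit Types s t : 'S_m.

Definition bounded_perm s := [forall c in porbits s, #|c| <= n]%N.

Lemma bounded_permJ s t : bounded_perm (s ^ t)%g = bounded_perm s.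
Proof.
have imp u v : bounded_perm u -> bounded_perm (u ^ v)%g.
  move/forall_inP=> bu; apply/forall_inP => c; rewrite porbits_conj => /imsetP[d du ->].
  by rewrite card_imset ?bu //; exact: perm_inj.
by apply/idP/idP; [rewrite -{2}(conjgK t s); apply: imp | apply: imp].
Qed.

Lemma class_rep_conj s : bounded_perm s -> exists i t, @class_rep n m i = (s ^ t)%g.
Proof.
move=> bs; have C_in : (s ^: [set: 'S_m])%g \in bounded_classes n m.
  rewrite inE mem_classes ?inE //=; apply/forall_inP => u /imsetP[t _ ->].
  by have := bounded_permJ s t; rewrite bs.
exists (enum_rank_in C_in (s ^: [set: 'S_m])%g); rewrite /class_rep enum_rankK_in //.
by have /imsetP[t _ ->] := mem_repr s (class_refl [set: 'S_m] s); exists t.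
Qed.

Lemma class_rep_bounded i : bounded_perm (@class_rep n m i).
Proof.
have := enum_valP i; rewrite inE => /andP[/imsetP[s _ def_C] /forall_inP b_C].
by apply: b_C; rewrite /class_rep def_C; apply: (mem_repr s); exact: class_refl.
Qed.

Lemma class_rep_inj i j t : @class_rep n m i = (class_rep j ^ t)%g -> i = j.
Proof.
have repP l : exists s, enum_val l = (s ^: [set: 'S_m])%g /\ @class_rep n m l \in enum_val l.
  have := enum_valP l; rewrite inE => /andP[/imsetP[s _ def_C] _]; exists s; split=> //.
  by rewrite /class_rep def_C; apply: (mem_repr s); exact: class_refl.
have [s [def_i s_i]] := repP i; have [u [def_j u_j]] := repP j.
move=> eq_rep; apply: enum_val_inj; rewrite def_i in s_i *; rewrite def_j in u_j *.
rewrite -(class_eqP s_i) -(class_eqP u_j) eq_rep.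
by rewrite classGidl ?inE.
Qed.

End BoundedClasses.

Section CyclePermutation.
Variable T : finType.
Implicit Types (s t u : {perm T}) (B c : {set T}).

Lemma eq_porbit_on s u (D : {set T}) x :
  {in D, forall y, u y = s y /\ s y \in D} -> x \in D -> porbit u x = porbit s x.
Proof.
move=> eq_su Dx.
have eq_i i : (u ^+ i)%g x = (s ^+ i)%g x /\ (s ^+ i)%g x \in D.
  elim: i => [|i [IHi Di]]; first by rewrite !expg0 !perm1.
  by rewrite !expgSr !permM IHi; apply: eq_su.
by apply/setP => y; apply/porbitP/porbitP => -[i ->]; exists i; rewrite (eq_i i).1.
Qed.

Variables (s t : {perm T}) (B c : {set T}).
Hypotheses (c_s : c \in porbits s) (Bc : B \subset c) (t_B : perm_on B t).

Let mem_c x : (s x \in c) = (x \in c).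
Proof.
have /imsetP[z _ ->] := c_s; rewrite -!eq_porbit_mem.
by have := porbit_perm s 1 x; rewrite expg1 => ->.
Qed.

Let porb_out x : x \notin c -> porbit (t * s)%g x = porbit s x.
Proof.
move=> xc; apply: (@eq_porbit_on _ _ (~: c)); rewrite ?inE // => y; rewrite !inE mem_c => yc.
rewrite permM (out_perm t_B) //; apply: contra yc; exact: (subsetP Bc).
Qed.

Let t_c x : (t x \in c) = (x \in c).
Proof.
have [xB|xB] := boolP (x \in B); last by rewrite (out_perm t_B).
by rewrite !(subsetP Bc) // (perm_closed _ t_B).
Qed.

Let porb_in x : x \in c -> porbit (t * s)%g x \subset c.
Proof.
move=> xc; apply/subsetP => _ /porbitP[i ->]; elim: i => [|i IHi]; first by rewrite perm1.
by rewrite expgSr !permM mem_c t_c.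
Qed.

(** The cycles of [s] other than [c] are untouched, and [c] is cut into at least one cycle of the
    product. [P] collects the untouched cycles and one piece of [c]; with equal cardinals nothing
    else remains, so that piece is all of [c]. *)
Lemma porbits_mul_cycle : (#|porbits s| <= #|porbits (t * s)%g|)%N /\
  (#|porbits (t * s)%g| = #|porbits s| -> porbits (t * s)%g = porbits s).
Proof.
have [x _ def_c] := imsetP c_s; have xc : x \in c by rewrite def_c porbit_id.
pose P := porbit (t * s)%g x |: (porbits s :\ c).
have porbE d y : d \in porbits s -> y \in d -> d = porbit s y.
  by case/imsetP => z _ ->; rewrite -eq_porbit_mem => /eqP.
have P_sub : P \subset porbits (t * s)%g.
  rewrite subUset sub1set imset_f //=; apply/subsetP => d; rewrite !inE => /andP[neq_d d_s].
  have [y _ def_d] := imsetP d_s; have yc : y \notin c.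
    apply: contra neq_d => yc; rewrite (porbE _ _ c_s yc) (porbE d y) //.
    by rewrite def_d porbit_id.
  by rewrite def_d -porb_out // imset_f.
have notin_out y : y \in c -> porbit (t * s)%g y \notin porbits s :\ c.
  move=> yc; rewrite !inE; apply/negP => /andP[/negP neq_c d_s]; apply: neq_c.
  by rewrite (porbE _ y d_s (porbit_id _ _)) (porbE _ _ c_s yc).
have card_P : #|P| = #|porbits s| by rewrite cardsU1 notin_out // (cardsD1 c (porbits s)) c_s.
split=> [|eq_card]; first by rewrite -card_P subset_leq_card.
have def_P : P = porbits (t * s)%g by apply/eqP; rewrite eqEcard P_sub card_P eq_card leqnn.
have -> : porbits (t * s)%g = c |: (porbits s :\ c); last by rewrite setD1K.
rewrite -def_P; congr (_ |: _); apply/eqP; rewrite eqEsubset porb_in //=.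
apply/subsetP => y yc; have : porbit (t * s)%g y \in P by rewrite def_P imset_f.
by rewrite in_setU1 (negPf (notin_out y yc)) orbF => /eqP <-; rewrite porbit_id.
Qed.

(** The sign of a permutation is read off the parity of its number of cycles. *)
Lemma odd_mul_cycle : #|porbits (t * s)%g| = #|porbits s| -> odd_perm t = false.
Proof.
move=> eq_card; have := odd_permM t s; rewrite {1 3}/odd_perm eq_card.
by case: (odd_perm t); case: (odd _ (+) odd _).
Qed.

End CyclePermutation.

(** * Reduction to permutations with cycles of length at most n *)

Section BoundedSpan.
Variables (k : fieldType) (n m : nat).
Hypothesis k_char0 : [pchar k] =i pred0.

Definition class_function (phi : 'S_m -> k) := forall s t, phi (s ^ t)%g = phi s.

(** The trace left on functions of permutations by the vanishing of the minors of size n + 1 of an n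
    by n matrix. *)
Definition alternating_relations (phi : 'S_m -> k) :=
  forall s (B : {set 'I_m}), #|B| = n.+1 ->
  \sum_(t : 'S_m | perm_on B t) (-1) ^+ odd_perm t * phi (t * s)%g = 0.

(* For a cycle of length > n of s, the permutations supported on n + 1 points of
   it either increase the number of cycles of s, or are even and give a
   conjugate of s, so that the alternating relation expresses phi s in terms of
   permutations with more cycles. *)
Lemma bounded_span (s : 'S_m) : exists c : 'I_#|bounded_classes n m| -> k,
  forall phi, class_function phi -> alternating_relations phi ->
  phi s = \sum_i c i * phi (class_rep i).
Proof.
have [N] := ubnP (m - ncycles s); elim: N s => // N IHN s; rewrite ltnS => le_N.
have [/class_rep_conj[i [t def_i]]|] := boolP (bounded_perm n s).
  exists (fun j => (j == i)%:R) => phi phi_conj _; rewrite (bigD1 i) //= eqxx mul1r.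
  by rewrite big1 ?addr0 ?def_i ?phi_conj // => j /negPf->; rewrite mul0r.
rewrite negb_forall_in => /exists_inP[c c_s]; rewrite -ltnNge => c_gt.
have [B Bc card_B] : exists2 B : {set 'I_m}, B \subset c & #|B| = n.+1.
  exists [set x in take n.+1 (enum c)].
    by apply/subsetP => x; rewrite inE => /mem_take; rewrite mem_enum.
  rewrite cardsE (card_uniqP _) ?take_uniq ?enum_uniq // size_take -cardE.
  by case: ltnP => // le_c; apply/eqP; rewrite eqn_leq le_c c_gt.
pose E (t : 'S_m) := ncycles (t * s)%g == ncycles s.
have /fin_all_exists[d def_d] (t : 'S_m) : exists c : 'I_#|bounded_classes n m| -> k,
    perm_on B t && ~~ E t -> forall phi, class_function phi -> alternating_relations phi ->
    phi (t * s)%g = \sum_i c i * phi (class_rep i).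
  have [/andP[t_B /eqP neq_t]|] := boolP (perm_on B t && ~~ E t); last by exists (fun=> 0).
  have [le_t _] := porbits_mul_cycle c_s Bc t_B.
  have lt_t : (ncycles s < ncycles (t * s)%g)%N by rewrite ltn_neqAle le_t eq_sym andbT; apply/eqP.
  have le_m : (ncycles (t * s)%g <= m)%N.
    by apply: leq_trans (leq_imset_card _ _) _; rewrite card_ord.
  have [|c' def_c'] := IHN (t * s)%g; last by exists c' => _.
  by apply: leq_trans le_N; apply: ltn_sub2l => //; apply: leq_trans le_m.
(* [M] is the multiplicity of [phi s] in the alternating relation; it is at least 1 because of the
   identity, hence invertible in [k]. *)
pose M := #|[pred t : 'S_m | perm_on B t && E t]|.
have M_neq0 : M%:R != 0 :> k.
  rewrite (char0_natr_eq0 k_char0) -lt0n; apply/card_gt0P; exists 1%g.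
  by rewrite inE /E mul1g eqxx perm_on1.
exists (fun i => - M%:R^-1 * \sum_(t | perm_on B t && ~~ E t) (-1) ^+ odd_perm t * d t i).
move=> phi phi_conj phi_alt; apply: (mulfI M_neq0).
have /eqP := phi_alt s B card_B; rewrite (bigID E) /= addr_eq0 => /eqP.
rewrite (eq_bigr (fun=> phi s)) => [|t /andP[t_B /eqP eq_t]]; last first.
  rewrite (odd_mul_cycle eq_t) mul1r.
  have [_ /(_ eq_t) eq_porb] := porbits_mul_cycle c_s Bc t_B.
  have [|g ->] := @conj_of_cycle_type _ s (t * s)%g; last exact: phi_conj.
  by move=> j; rewrite eq_porb.
rewrite sumr_const => eq_sum; rewrite [LHS]mulr_natl [LHS]eq_sum mulr_sumr -sumrN.
under eq_bigr => t Bt do rewrite (def_d t Bt) // mulr_sumr -sumrN.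
rewrite exchange_big; apply: eq_bigr => i _ /=.
rewrite !mulNr mulrN !mulrA mulfV // mul1r mulr_suml -sumrN.
by apply: eq_bigr => t _; rewrite mulrA.
Qed.

End BoundedSpan.

(** * Traces along cycles *)

Section CycleTrace.
Variables (R : comNzRingType) (n m : nat).
Notation word := {ffun 'I_m -> 'I_n}.

(** The product over the cycles c of [s] of the traces of M^|c|. *)
Definition cycle_trace (M : 'M[R]_n) (s : 'S_m) : R :=
  \sum_(y : word) \prod_i M (y i) (y (s i)).

(** Cyclicity of the trace on all cycles at once: at each index the N' of one factor meets the N of
    the next, and summing over [y] leaves the Kronecker delta of [w] and z o s. *)
Lemma cycle_trace_conj (N N' M : 'M[R]_n) (s : 'S_m) :
  N' *m N = 1%:M -> cycle_trace (N *m M *m N') s = cycle_trace M s.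
Proof.
move=> N'N; rewrite /cycle_trace.
under eq_bigr => y _ do rewrite -(sum_word_prod (N *m M) N' y (y \o s)).
rewrite exchange_big; under eq_bigr => w _.
  under eq_bigr => y _ do rewrite -(sum_word_prod N M y w) mulr_suml.
  rewrite exchange_big.
  under eq_bigr => z _.
    under eq_bigr => y _.
      rewrite (reindex_inj (@perm_inj _ s)) /= -mulrA mulrCA [_ * \prod_p N' _ _]mulrC.
      over.
    rewrite -mulr_sumr (reindex_words s^-1%g) /=.
    under [X in _ * X]eq_bigr => y _.
      under eq_bigr do rewrite ffunE permK.
      under [X in _ * X]eq_bigr do rewrite ffunE permK.
      over.
    rewrite (sum_word_prod N' N w (z \o s)) N'N prod_delta.
    over.
  over.
rewrite exchange_big; apply: eq_bigr => z _ /=.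
rewrite (bigD1 (finfun (z \o s))) //= [X in _ + X]big1 ?addr0 => [|w neq_w]; last first.
  by rewrite ffunK (negPf neq_w) mulr0.
by rewrite ffunK eqxx mulr1; apply: eq_bigr => i _; rewrite ffunE.
Qed.

Lemma cycle_trace_diag (d : 'rV[R]_n) (s : 'S_m) : (0 < n)%N ->
  cycle_trace (diag_mx d) s = \prod_(c in porbits s) \sum_a d 0 a ^+ #|c|.
Proof.
move=> n_gt0; pose a0 : 'I_n := Ordinal n_gt0.
have porb_x x : porbit s x \in porbits s by apply: imset_f.
rewrite (big_distr_big a0) /cycle_trace.
pose cst (y : word) := [forall i, y i == y (s i)].
rewrite (bigID cst) /= [X in _ + X]big1 ?addr0; last first.
  by move=> y /forallPn[i neq_i]; rewrite (bigD1 i) //= mxE (negPf neq_i) mul0r.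
(* Only words constant on cycles contribute; [h] and [h'] identify them with functions on sets of
   positions that take the value [a0] off the cycles, the form in which [big_distr_big] expands the
   product. *)
pose h (f : {ffun {set 'I_m} -> 'I_n}) : word := [ffun i => f (porbit s i)].
pose h' (y : word) : {ffun {set 'I_m} -> 'I_n} :=
  [ffun c => if c \in porbits s then oapp y a0 [pick i in c] else a0].
have cstP y : cst y -> forall i j, porbit s i = porbit s j -> y i = y j.
  move=> /forallP y_cst i j /eqP; rewrite eq_porbit_mem => /porbitP[e ->].
  by elim: e => [|e IHe]; rewrite ?expg0 ?perm1 // expgSr permM -IHe; apply/esym/eqP.
rewrite (reindex_onto h h') => [|y y_cst]; last first.
  apply/ffunP => i; rewrite !ffunE porb_x; case: pickP => [j|/(_ i)]; last by rewrite porbit_id.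
  by rewrite -eq_porbit_mem => /eqP eq_j; apply: cstP.
apply: eq_big => [f|f f_cst].
  have -> : cst (h f).
    by apply/forallP => i; rewrite !ffunE; have := porbit_perm s 1 i; rewrite expg1 => ->.
  apply/eqP/pfamilyP => [def_f | [/supportP f_supp _]].
    by split=> //; apply/supportP => c /negPf c_s; rewrite -def_f ffunE c_s.
  apply/ffunP => c; rewrite ffunE; case: ifP => [/imsetP[x _ ->]|/negbT/f_supp //].
  case: pickP => [j|/(_ x)]; last by rewrite porbit_id.
  by rewrite /= ffunE -eq_porbit_mem => /eqP->.
under eq_bigr => i _.
  have -> : diag_mx d (h f i) (h f (s i)) = d 0 (f (porbit s i)).
    rewrite !ffunE mxE; have := porbit_perm s 1 i; rewrite expg1 => ->.
    by rewrite eqxx mulr1n.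
  over.
rewrite (partition_big (porbit s) (mem (porbits s))) //=.
apply: eq_bigr => c /imsetP[x _ ->].
rewrite (eq_bigr (fun=> d 0 (f (porbit s x)))) => [|i /eqP -> //].
rewrite prodr_const; congr (_ ^+ _); apply: eq_card => i.
by rewrite -eq_porbit_mem.
Qed.

Lemma cycle_trace1 (s : 'S_m) : (0 < n)%N -> cycle_trace 1%:M s = n%:R ^+ ncycles s.
Proof.
move=> n_gt0; rewrite -diag_const_mx cycle_trace_diag // /ncycles -prodr_const.
apply: eq_bigr => c _; under eq_bigr do rewrite mxE expr1n.
by rewrite sumr_const card_ord.
Qed.

End CycleTrace.

Section PairedPositions.
Variables (R : comNzRingType) (n : nat).

Lemma pairprod_positions m (F : 'I_m.*2 -> 'I_m.*2 -> R) :
  pairprod F (enum 'I_m.*2) = \prod_(i < m) F (fst_pos i) (snd_pos i).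
Proof.
elim: m F => [|m IHm] F; first by rewrite enum_ord0 big_ord0.
rewrite enum_ordSS /= pairprod_map IHm big_ord_recl; congr (_ * _).
  by congr (F _ _); apply: val_inj.
by apply: eq_bigr => i _; congr (F _ _); apply: val_inj; rewrite /= /bump /= ?add1n.
Qed.

Lemma pairing_tensor1_positions m (K : 'M[R]_n) (w : 'I_m.*2 -> 'I_n) :
  pairing_tensor K 1 w = \prod_(i < m) K (w (fst_pos i)) (w (snd_pos i)).
Proof.
rewrite pairing_tensorE; under eq_pairprod do rewrite !perm1.
by rewrite -(pairprod_positions (fun p q => K (w p) (w q))).
Qed.

Definition half_pos m (p : 'I_m.*2) : 'I_m := Ordinal (half_pos_subproof p).

Definition word_join (T : Type) m (x y : 'I_m -> T) (p : 'I_m.*2) : T :=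
  if odd p then y (half_pos p) else x (half_pos p).

Lemma half_posK m (p : 'I_m.*2) :
  p = if odd p then snd_pos (half_pos p) else fst_pos (half_pos p).
Proof.
apply: val_inj; case: ifP => odd_p; rewrite /= -[LHS](odd_double_half p) odd_p //.
Qed.

Lemma half_fst m (i : 'I_m) : half_pos (fst_pos i) = i.
Proof. by apply: val_inj; rewrite /= doubleK. Qed.

Lemma half_snd m (i : 'I_m) : half_pos (snd_pos i) = i.
Proof. by apply: val_inj; rewrite /= uphalf_double. Qed.

Lemma word_join_fst (T : Type) m (x y : 'I_m -> T) i : word_join x y (fst_pos i) = x i.
Proof. by rewrite /word_join /= odd_double half_fst. Qed.

Lemma word_join_snd (T : Type) m (x y : 'I_m -> T) i : word_join x y (snd_pos i) = y i.
Proof. by rewrite /word_join /= odd_double /= half_snd. Qed.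

Lemma big_word_join (T : finType) m (F : {ffun 'I_m.*2 -> T} -> R) :
  \sum_w F w = \sum_(x : {ffun 'I_m -> T}) \sum_(y : {ffun 'I_m -> T}) F (finfun (word_join x y)).
Proof.
rewrite pair_big /= (reindex (fun xy : {ffun 'I_m -> T} * {ffun 'I_m -> T} =>
  finfun (word_join xy.1 xy.2))) //=.
exists (fun w : {ffun 'I_m.*2 -> T} => ([ffun i => w (fst_pos i)], [ffun i => w (snd_pos i)])).
  by move=> [x y] _; congr (_, _); apply/ffunP => i; rewrite !ffunE ?word_join_fst ?word_join_snd.
move=> w _; apply/ffunP => p; rewrite ffunE /word_join /=.
by rewrite [in RHS](half_posK p); case: ifP => _; rewrite ffunE.
Qed.

(** Each letter at a position [fst_pos i] occurs in one factor H and one factor K; summing it out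
    multiplies these two matrices and leaves a trace along the cycles of [s]. *)
Lemma sum_pairs_cycle_trace m (H K : 'M[R]_n) (s : 'S_m) :
  \sum_(w : {ffun 'I_m.*2 -> 'I_n}) (\prod_(i < m) H (w (fst_pos i)) (w (snd_pos i)))
     * (\prod_(i < m) K (w (fst_pos i)) (w (snd_pos (s i))))
  = cycle_trace (H^T *m K) s.
Proof.
rewrite big_word_join exchange_big; apply: eq_bigr => y _.
under [RHS]eq_bigr => i _ do rewrite mxE.
rewrite bigA_distr_bigA; apply: eq_bigr => x _; rewrite -big_split.
apply: eq_bigr => i _ /=.
by rewrite !ffunE !word_join_fst !word_join_snd mxE.
Qed.

End PairedPositions.

Section MetricTensors.
Variables (k : fieldType) (n m : nat) (G : 'M[k]_n).
Hypothesis k_char0 : [pchar k] =i pred0.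

(** Among the n + 1 positions of [B] two carry the same letter of [l]. Composing with their
    transposition keeps the tensor and changes the sign, so the sum is its own opposite. *)
Lemma metric_tensor_alternating (j l : 'I_m.*2 -> 'I_n) :
  alternating_relations n (fun s => metric_tensor G s j l).
Proof.
move=> s B card_B; rewrite /metric_tensor.
under eq_bigr do rewrite mulrCA; rewrite -mulr_sumr; apply/eqP; rewrite mulf_eq0; apply/orP; right.
pose a i := l (fst_pos i); pose b i := l (snd_pos i).
have /dinjectivePn[x xB [y yB eq_a]] : ~~ dinjectiveb a B.
  apply/dinjectiveP => /card_in_imset; rewrite card_B => card_a.
  by have := max_card (mem (a @: B)); rewrite card_a card_ord ltnn.
move: yB; rewrite !inE => /andP[neq_yx yB].
have a_swap i : a (tperm x y i) = a i by case: tpermP => // ->.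
set S := \sum_(t | _) _; have : S = - S.
  rewrite {1}/S (reindex_inj (mulgI (tperm x y))) /= -sumrN.
  apply: eq_big => [t|t t_B].
    have xy_B : perm_on B (tperm x y).
      by apply/subsetP => z; rewrite inE; case: tpermP => [->|->|_ _ /eqP].
    apply/idP/idP => [t_B|]; last exact: perm_onM.
    by rewrite -(mulKg (tperm x y) t); apply: perm_onM; rewrite ?tpermV.
  rewrite odd_permM odd_tperm eq_sym neq_yx addTb signrN mulNr; congr (- (_ * _)).
  rewrite (reindex_inj (@perm_inj _ (tperm x y))); apply: eq_bigr => i _ /=.
  by rewrite -[l (fst_pos _)]/(a _) a_swap !permM tpermK.
move/eqP; rewrite -subr_eq0 opprK -mulr2n -mulr_natr mulf_eq0 => /orP[//|].
by rewrite char0_natr_eq0.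
Qed.

Lemma alternating_relations_sum (I : Type) (r : seq I) (c : I -> k) (phi : I -> 'S_m -> k) :
  (forall i, alternating_relations n (phi i)) ->
  alternating_relations n (fun s => \sum_(i <- r) c i * phi i s).
Proof.
move=> phi_alt s B card_B; under eq_bigr do rewrite mulr_sumr.
rewrite exchange_big big1 // => i _; under eq_bigr do rewrite mulrCA.
by rewrite -mulr_sumr phi_alt // mulr0.
Qed.

Lemma eq_alternating_relations (phi psi : 'S_m -> k) : phi =1 psi ->
  alternating_relations n phi -> alternating_relations n psi.
Proof.
by move=> eq_phi phi_alt s B card_B; rewrite -[RHS](phi_alt s B card_B);
   apply: eq_bigr => t _; rewrite eq_phi.
Qed.

Lemma w_tensor_alternating u : alternating_relations n (fun s => @w_tensor k n G m s u).
Proof.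
pose phi (tau : 'S_m.*2) s := metric_tensor G s
  (fun p => (tnth [tuple tnth u (tau i) | i < m.*2] p).2)
  (fun p => (tnth [tuple tnth u (tau i) | i < m.*2] p).1).
apply: (@eq_alternating_relations (fun s => \sum_tau (m.*2`!%:R)^-1 * phi tau s)).
  by move=> s; rewrite -mulr_sumr.
by apply: alternating_relations_sum => tau; apply: metric_tensor_alternating.
Qed.

Lemma w_form_alternating p : alternating_relations n (fun s => @w_form k n G m s p).
Proof.
apply: alternating_relations_sum => mm; case: insub => [u|] /=; first exact: w_tensor_alternating.
by move=> s B _; rewrite big1 // => t _; rewrite mulr0.
Qed.

Lemma a_poly_alternating (C : {mpoly k[n * n]} -> k) : scalar C ->
  alternating_relations n (fun s => C (@a_poly k n G m s)).
Proof.
move=> C_lin.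
pose fC : {scalar {mpoly k[n * n]}} := HB.pack C (GRing.isLinear.Build k _ _ _ C C_lin).
have -> : C = fC by []; rewrite /a_poly.
pose phi (u : m.*2.-tuple ('I_n * 'I_n)) (s : 'S_m) :=
  metric_tensor G s (fun p => (tnth u p).1) (fun p => (tnth u p).2).
apply: (@eq_alternating_relations (fun s => \sum_u
   fC (\prod_(p < m.*2) generic_mx k n (tnth u p).1 (tnth u p).2) * phi u s)).
  by move=> s; rewrite linear_sum; apply: eq_bigr => u _; rewrite linearZ mulrC.
by apply: alternating_relations_sum => u; apply: metric_tensor_alternating.
Qed.

End MetricTensors.

(** * Independence of the power sums *)

Section PowerSums.
Variables (k : fieldType) (n : nat).
Hypothesis k_char0 : [pchar k] =i pred0.
Notation P := {mpoly k[n]}.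

(** Power sums of the squares of the variables: a diagonal X enters the value of w_sigma through X
    X. *)
Definition even_power_sum (j : 'I_n) : P := \sum_i 'X_i ^+ (2 * j.+1).

Local Notation ev := (mmap (@mpolyC n k) even_power_sum).

Lemma mderiv_even_power_sum i j :
  (even_power_sum j)^`M(i) = (2 * j.+1)%:R *: ('X_i * ('X_i ^+ 2) ^+ j).
Proof.
rewrite /even_power_sum linear_sum (bigD1 i) //= big1 ?addr0 => [|l /negPf neq_l].
  rewrite mpolyXn mderivX mulmnE mnm1E eqxx mul1n; congr (_ *: _).
  rewrite -exprM -exprS mpolyXn; congr 'X_[_]; apply/mnmP => l.
  rewrite mnmBE !mulmnE mnm1E; case: (i == l); rewrite ?mul0n // !mul1n.
  by rewrite mulnS addSn subSS subn0.
by rewrite mpolyXn mderivX mulmnE mnm1E neq_l mul0n scale0r.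
Qed.

(** The chain rule, checked on monomials by removing one variable at a time. *)
Lemma mderiv_power_sum_eval i F :
  (ev F)^`M(i) = \sum_j ev F^`M(j) * (even_power_sum j)^`M(i).
Proof.
have ev_sum : ev F = \sum_(mm <- msupp F) F@_mm *: ev 'X_[mm].
  by rewrite {1}[F]mpolyE raddf_sum; apply: eq_bigr => mm _; rewrite /= mmapZ mul_mpolyC.
have evD_sum j : ev F^`M(j) = \sum_(mm <- msupp F) F@_mm *: ev 'X_[mm]^`M(j).
  rewrite {1}[F]mpolyE linear_sum raddf_sum; apply: eq_bigr => mm _.
  by rewrite linearZ /= mmapZ mul_mpolyC.
rewrite ev_sum linear_sum; under [RHS]eq_bigr do rewrite evD_sum mulr_suml.
rewrite [RHS]exchange_big; apply: eq_bigr => mm _; rewrite linearZ /=.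
under [RHS]eq_bigr do rewrite -scalerAl; rewrite -scaler_sumr; congr (_ *: _).
rewrite mpolyX_m2s; elim: (m2s mm) => [|v s IHs].
  rewrite big_nil rmorph1 -mpolyC1 mderivC big1 // => j _.
  by rewrite mderivC rmorph0 mul0r.
rewrite big_cons rmorphM /= mderivM IHs mmapX mmap1U.
under [RHS]eq_bigr do rewrite mderivM rmorphD !rmorphM /= mmapX mmap1U mulrDl -mulrA.
rewrite big_split /= [X in _ = X + _](bigD1 v) //= mderivX mnm1E eqxx scale1r.
have -> : (U_(v) - U_(v) = 0)%MM by apply/mnmP => l; rewrite mnmBE subnn mnm0E.
rewrite mpolyX0 rmorph1 mul1r [X in _ = _ + X + _]big1 => [|j /negPf neq_j].
  rewrite addr0 [_ * ev _]mulrC; congr (_ + _); rewrite mulr_sumr; apply: eq_bigr => j _.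
  by rewrite mulrA.
by rewrite mderivX mnm1E eq_sym neq_j scale0r rmorph0 mul0r.
Qed.

Lemma power_sum_jacobian :
  \det (\matrix_(j < n, i < n) (even_power_sum j)^`M(i)) != 0.
Proof.
have -> : \matrix_(j < n, i < n) (even_power_sum j)^`M(i)
  = diag_mx (\row_(j < n) (2 * j.+1)%:R) *m (Vandermonde n (\row_(i < n) ('X_i : P) ^+ 2)
    *m diag_mx (\row_(i < n) 'X_i)).
  apply/matrixP => j i; rewrite mul_diag_mx mul_mx_diag !mxE mderiv_even_power_sum.
  by rewrite scaler_nat ['X_i * _]mulrC [RHS]mulr_natl.
rewrite !det_mulmx !det_diag det_Vandermonde !mulf_neq0 //; apply/prodf_neq0 => i _.
- rewrite mxE -mpolyC_nat; apply/eqP => /(congr1 (mcoeff 0%MM)); rewrite mcoeffC eqxx mulr1 mcoeff0.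
  by apply/eqP; rewrite char0_natr_eq0.
- apply/prodf_neq0 => j /ltn_eqF lt_ij; rewrite !mxE.
  apply/eqP => /(congr1 (mcoeff (U_(j) *+ 2)%MM)); rewrite !mpolyXn mcoeffB !mcoeffX eqxx mcoeff0.
  have -> : (U_(i) *+ 2 == U_(j) *+ 2 :> 'X_{1..n})%MM = false.
    apply/eqP => /mnmP/(_ j); rewrite !mulmnE !mnm1E eqxx.
    by rewrite -[i == j]/(i == j :> nat) lt_ij.
  by rewrite subr0; apply/eqP/oner_neq0.
by rewrite mxE; apply/eqP => /(congr1 (mcoeff U_(i)%MM)); rewrite mcoeffX eqxx mcoeff0;
  apply/eqP/oner_neq0.
Qed.

(** Jacobian criterion, by induction on the degree. Differentiating a relation and multiplying by
    the adjugate of the Jacobian shows that every partial derivative of [F] is a relation of lower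
    degree, hence 0; in characteristic zero [F] is then constant. *)
Lemma even_power_sums_free F : ev F = 0 -> F = 0.
Proof.
have [N] : exists N, forall mm, (N <= mdeg mm)%N -> F@_mm = 0.
  by exists (msize F) => mm /msize_mdeg_ge/memN_msupp_eq0.
elim: N F => [|N IHN] F F_supp evF; first by apply/mpolyP => mm; rewrite F_supp // mcoeff0.
have dF0 j : F^`M(j) = 0.
  apply: IHN => [mm le_N|].
    by rewrite mcoeff_deriv F_supp ?mul0rn // mdegD mdeg1 addn1 ltnS.
  pose J := \matrix_(j < n, i < n) (even_power_sum j)^`M(i).
  pose r := \row_j ev F^`M(j).
  have rJ : r *m J = 0.
    apply/rowP => i; rewrite !mxE.
    transitivity ((ev F)^`M(i)); last by rewrite evF linear0.
    by rewrite mderiv_power_sum_eval; apply: eq_bigr => l _; rewrite !mxE.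
  have /rowP/(_ j) : r *m (J *m \adj J) = 0 by rewrite mulmxA rJ mul0mx.
  rewrite mul_mx_adj mul_mx_scalar !mxE => /eqP.
  by rewrite mulf_eq0 (negPf power_sum_jacobian) => /eqP.
have def_F : F = (F@_0%MM)%:MP.
  apply/mpolyP => mm; rewrite mcoeffC; have [<-|/eqP mm_neq0] := eqVneq 0%MM mm.
    by rewrite mulr1.
  have [i mm_i] : exists i, (mm i != 0)%N.
    apply/existsP; apply: contra_notT mm_neq0 => /existsPn mm0.
    by apply/mnmP => i; rewrite mnm0E; apply/esym/eqP/negbNE/mm0.
  have := mcoeff_deriv i (mm - U_(i))%MM F; rewrite dF0 mcoeff0 submK; last first.
    by rewrite lep1mP.
  move/esym/eqP; rewrite -[X in X == _]mulr_natr mulf_eq0 char0_natr_eq0 // orbF => /eqP->.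
  by rewrite mulr0.
by move: evF; rewrite def_F mmapC => /eqP; rewrite mpolyC_eq0 => /eqP->.
Qed.

End PowerSums.

(** * Pairs of perfect matchings *)

Section TwoPairings.
Variable I : eqType.
Implicit Types (s t : seq I) (c : I -> bool).

(** The ends of every pair have different colours, phrased as the nonvanishing of a [pairprod] so
    that it transfers along [pairing_eq]. *)
Definition bicolored c s : bool := pairprod (fun x y => (c x != c y)%:R : int) s != 0.

Lemma bicolored_cons c x y s : bicolored c [:: x, y & s] = (c x != c y) && bicolored c s.
Proof. by rewrite /bicolored /= mulf_eq0 negb_or; case: (c x != c y). Qed.

Lemma bicolored_eq c s t : pairing_eq s t -> bicolored c s = bicolored c t.
Proof. by move=> eq_st; rewrite /bicolored eq_st // => x y; rewrite eq_sym. Qed.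

Lemma eq_in_bicolored c c' s : {in s, c =1 c'} -> bicolored c s = bicolored c' s.
Proof.
by move=> eq_c; congr (_ != _); apply: eq_in_pairprod => x y xs ys; rewrite !eq_c.
Qed.

(** Induction removing a pair {x, y} of [s]. If [t] matches x with z and y with z', colour the
    smaller configuration where z is matched with z', then give x and y the colours opposite to
    those of z and z'. If [t] also pairs x with y, these two are coloured freely. *)
Lemma two_pairings_bicolored s t :
  perm_eq s t -> uniq s -> ~~ odd (size s) -> exists c, bicolored c s /\ bicolored c t.
Proof.
elim/pair_ind: s t => [t|//|x y s IHs t eq_t].
  by rewrite perm_sym => /perm_nilP-> _ _; exists xpredT.
rewrite /= negbK inE negb_or -andbA => /and4P[neq_xy xs ys uniq_s] ev_s.
have uniq_t : uniq t by rewrite -(perm_uniq eq_t) /= inE negb_or neq_xy xs ys.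
have ev_t : ~~ odd (size t) by rewrite -(perm_size eq_t) /= negbK.
have xt : x \in t by rewrite -(perm_mem eq_t) mem_head.
have [z [t1 [eq_t1 peq_t1]]] := pairing_pick ev_t xt.
pose col (c : I -> bool) cx cy w := if w == x then cx else if w == y then cy else c w.
have col_x c cx cy : col c cx cy x = cx by rewrite /col eqxx.
have col_y c cx cy : col c cx cy y = cy by rewrite /col eq_sym (negPf neq_xy) eqxx.
have col_s c cx cy w : w \in s -> col c cx cy w = c w.
  rewrite /col => ws; case: eqVneq => [eq_w|_]; first by rewrite -eq_w ws in xs.
  by case: eqVneq => // eq_w; rewrite -eq_w ws in ys.
have eq_yz1 : perm_eq (y :: s) (z :: t1).
  by rewrite -(perm_cons x); apply: perm_trans eq_t1.
have [eq_yz|neq_yz] := eqVneq y z.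
  have eq_s : perm_eq s t1 by rewrite -(perm_cons y) {2}eq_yz.
  have [c [c_s c_t1]] := IHs t1 eq_s uniq_s ev_s; exists (col c true false).
  rewrite (bicolored_eq _ peq_t1) -eq_yz !bicolored_cons col_x col_y /=.
  rewrite !(@eq_in_bicolored (col c true false) c) // => w wt; apply: col_s => //.
  by rewrite (perm_mem eq_s).
have yt1 : y \in t1.
  by have := perm_mem eq_yz1 y; rewrite mem_head inE (negPf neq_yz).
have ev_t1 : ~~ odd (size t1) by case: (perm_size eq_yz1) => <-.
have [z' [t2 [eq_t2 peq_t2]]] := pairing_pick ev_t1 yt1.
have eq_s : perm_eq s [:: z, z' & t2].
  rewrite -(perm_cons y); apply: perm_trans eq_yz1 _.
  rewrite (perm_trans (y := [:: z, y, z' & t2])) ?perm_cons //.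
  by rewrite (perm_catCA [:: z] [:: y] (z' :: t2)).
have [c [c_s]] := IHs _ eq_s uniq_s ev_s; rewrite bicolored_cons => /andP[c_zz' c_t2].
exists (col c (~~ c z) (~~ c z')).
have sub_s w : w \in [:: z, z' & t2] -> w \in s by rewrite (perm_mem eq_s).
have bic_t1 : bicolored (col c (~~ c z) (~~ c z')) t1 = (~~ c z' != c z') && bicolored c t2.
  rewrite (bicolored_eq _ peq_t2) bicolored_cons col_y col_s ?sub_s ?inE ?eqxx ?orbT //.
  congr (_ && _); apply: eq_in_bicolored => w wt; apply/col_s/sub_s.
  by rewrite !inE wt !orbT.
rewrite (bicolored_eq _ peq_t1) !bicolored_cons bic_t1 col_x col_y.
rewrite (@eq_in_bicolored _ c) //; last by move=> w ws; apply: col_s.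
rewrite c_s c_t2 col_s ?sub_s ?mem_head //.
by move: c_zz'; case: (c z); case: (c z').
Qed.

Lemma bicolored_orient c s : bicolored c s -> exists a b,
  [/\ size a = size b, all c a, all (predC c) b, perm_eq s (a ++ b)
    & forall (R : comNzRingType) (f : I -> I -> R), (forall x y, f x y = f y x) ->
      pairprod f s = \prod_(p <- zip a b) f p.1 p.2].
Proof.
elim/pair_ind: s => [_|x|x y s IHs].
- by exists [::], [::]; split=> // R f _; rewrite big_nil.
- by [].
rewrite bicolored_cons => /andP[neq_c /IHs[a [b [sz_ab c_a c_b eq_s def_f]]]].
have perm_ins (u v : I) : perm_eq [:: u, v & s] ((u :: a) ++ v :: b).
  rewrite /= perm_cons -[v :: b]cat1s perm_sym perm_catCA /= perm_cons perm_sym.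
  exact: eq_s.
have [cx|ncx] := boolP (c x).
  exists (x :: a), (y :: b); split=> //=; rewrite ?sz_ab ?cx ?c_a ?c_b ?andbT //.
  - by move: neq_c; rewrite cx; case: (c y).
  - by move=> R f fC; rewrite big_cons def_f.
exists (y :: a), (x :: b); split=> //=; rewrite ?sz_ab ?c_a ?c_b ?ncx ?andbT //.
- by move: neq_c; rewrite (negPf ncx); case: (c y).
- apply: perm_trans (perm_ins y x); rewrite (perm_catCA [:: x] [:: y] s) //.
by move=> R f fC; rewrite big_cons def_f // fC.
Qed.

Lemma zip_reorder (a a' b' : seq I) : perm_eq a a' -> size a' = size b' ->
  exists2 b, perm_eq b b' & forall (R : comNzRingType) (f : I -> I -> R),
    \prod_(p <- zip a' b') f p.1 p.2 = \prod_(p <- zip a b) f p.1 p.2.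
Proof.
case: a' => [|x0 a']; first by move=> /perm_nilP->; exists b'; rewrite ?perm_refl.
move: (x0 :: a') => {}a' /(perm_iotaP x0)[Is eq_Is ->] sz_ab.
exists (map (nth x0 b') Is).
  by rewrite -{2}(mkseq_nth x0 b') /mkseq -sz_ab perm_map.
move=> R f; have -> : zip (map (nth x0 a') Is) (map (nth x0 b') Is)
    = [seq (nth x0 a' i, nth x0 b' i) | i <- Is].
  by elim: Is {eq_Is} => //= i Is ->.
rewrite big_map (perm_big _ eq_Is) /= -{1}(mkseq_nth x0 a') -{1}(mkseq_nth x0 b') -sz_ab.
have -> : zip (mkseq (nth x0 a') (size a')) (mkseq (nth x0 b') (size a'))
    = [seq (nth x0 a' i, nth x0 b' i) | i <- iota 0 (size a')].
  by rewrite /mkseq; elim: (iota _ _) => //= i s ->.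
by rewrite big_map.
Qed.

End TwoPairings.

Section MetricNormalForm.
Variables (k : fieldType) (n m : nat) (G : 'M[k]_n).
Hypothesis G_sym : G^T = G.

Let K_sym : (invmx G)^T = invmx G. Proof. by rewrite trmx_inv G_sym. Qed.

(** A common bicolouring orients the pairs of both matchings. Listing the pairs of [t] as (a_i,
    b_i), [r] puts a_i at position [fst_pos i] and b_i at [snd_pos i], and [u] records that [s]
    joins a_i to b_u(i). *)
Lemma pairing_tensors_metric (t s : 'S_m.*2) : exists (r : 'S_m.*2) (u : 'S_m),
  forall j l : 'I_m.*2 -> 'I_n,
  pairing_tensor G t j * pairing_tensor (invmx G) s l = metric_tensor G u (j \o r) (l \o r).
Proof.
pose lt := [seq t i | i <- enum 'I_m.*2]; pose ls := [seq s i | i <- enum 'I_m.*2].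
have eq_lt : perm_eq lt (enum 'I_m.*2) := perm_eq_perm_enum t.
have eq_ls : perm_eq ls (enum 'I_m.*2) := perm_eq_perm_enum s.
have eq_ts : perm_eq lt ls by apply: perm_trans eq_lt _; rewrite perm_sym.
have sz_lt : size lt = m.*2 by rewrite size_map size_enum_ord.
have [||c [c_t c_s]] := two_pairings_bicolored eq_ts.
- by rewrite (perm_uniq eq_lt) enum_uniq.
- by rewrite sz_lt odd_double.
have [a [b [sz_ab c_a c_b eq_ab def_t]]] := bicolored_orient c_t.
have [a' [b' [sz_ab' c_a' c_b' eq_ab' def_s]]] := bicolored_orient c_s.
have filter_c (p : pred 'I_m.*2) e : all p e -> filter p e = e by move/all_filterP.
have filter_nc (p : pred 'I_m.*2) e : all (predC p) e -> filter p e = [::].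
  by move=> /allP p_e; apply/eqP; rewrite -(negbK (_ == _)) -has_filter -all_predC; apply/allP.
have eq_cat : perm_eq (a ++ b) (a' ++ b').
  by apply: perm_trans eq_ab'; apply: perm_trans eq_ts; rewrite perm_sym.
have eq_a : perm_eq a a'.
  have := perm_filter c eq_cat.
  by rewrite !filter_cat (filter_c c a) ?(filter_c c a') ?(filter_nc c b) ?(filter_nc c b') ?cats0.
have eq_b : perm_eq b b'.
  by rewrite -(perm_cat2l a); apply: perm_trans eq_cat _; rewrite perm_cat2r perm_sym.
have [b2 eq_b2 def_zip] := zip_reorder eq_a sz_ab'.
have sz_a : size a == m.
  rewrite -(inj_eq double_inj) -[(size a).*2]addnn {2}sz_ab -size_cat.
  by rewrite -(perm_size eq_ab) sz_lt.
have sz_b : size b == m by rewrite -sz_ab.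
have sz_b2 : size b2 == m by rewrite (perm_size eq_b2) -(perm_size eq_b).
have eq_bb2 : perm_eq (Tuple sz_b2) (Tuple sz_b).
  by apply: perm_trans eq_b2 _; rewrite perm_sym.
have [u def_u] := tuple_permP eq_bb2.
pose h := word_join (tnth (Tuple sz_a)) (tnth (Tuple sz_b)).
have h_inj : injective h.
  have uniq_ab : uniq (a ++ b) by rewrite -(perm_uniq eq_ab) (perm_uniq eq_lt) enum_uniq.
  move: uniq_ab; rewrite cat_uniq => /and3P[uniq_a /hasPn dis_ab uniq_b].
  have inj_tnth (e : m.-tuple 'I_m.*2) : uniq e -> injective (tnth e) by move/tuple_uniqP.
  have dis i i' : tnth (Tuple sz_b) i <> tnth (Tuple sz_a) i'.
    by move=> eq_ab'2; have := dis_ab _ (mem_tnth i (Tuple sz_b)); rewrite eq_ab'2 mem_tnth.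
  move=> p q; rewrite /h /word_join.
  case odd_p: (odd p); case odd_q: (odd q) => eq_pq.
  - by rewrite (half_posK p) (half_posK q) odd_p odd_q (inj_tnth (Tuple sz_b) _ _ _ eq_pq).
  - by case/dis: eq_pq.
  - by case/esym/dis: eq_pq.
  - by rewrite (half_posK p) (half_posK q) odd_p odd_q (inj_tnth (Tuple sz_a) _ _ _ eq_pq).
exists (perm h_inj), u => j l.
have GC x y : G x y = G y x by rewrite -{1}G_sym mxE.
have KC x y : invmx G x y = invmx G y x by rewrite -{1}K_sym mxE.
rewrite /pairing_tensor def_t // def_s // (def_zip _ (fun x y => invmx G (l x) (l y))) /metric_tensor.
have zipE (e : m.-tuple 'I_m.*2) (F : 'I_m.*2 -> 'I_m.*2 -> k) :
    \prod_(p <- zip a e) F p.1 p.2 = \prod_(i < m) F (tnth (Tuple sz_a) i) (tnth e i).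
  rewrite -[zip a e]/(tval [tuple of zip (Tuple sz_a) e]) big_tuple.
  apply: eq_bigr => i _; pose x0 := tnth e i.
  rewrite (tnth_nth (x0, x0)) !(tnth_nth x0) /= nth_zip //.
  by rewrite size_tuple (eqP sz_a).
rewrite (zipE (Tuple sz_b) (fun x y => G (j x) (j y))).
rewrite (zipE (Tuple sz_b2) (fun x y => invmx G (l x) (l y))).
congr (_ * _); apply: eq_bigr => i _ /=; rewrite !permE /h word_join_fst word_join_snd //.
congr (invmx G _ (l _)).
have -> : tnth (Tuple sz_b2) i = tnth [tuple tnth (Tuple sz_b) (u i) | i < m] i.
  by congr (tnth _ i); apply: val_inj.
by rewrite tnth_mktuple.
Qed.

End MetricNormalForm.

(** * The matrix of the linear system *)

Section SymmetricTensorForms.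
Variables (k : fieldType) (n : nat).

Definition permute_tuple d (u : d.-tuple ('I_n * 'I_n)) (t : 'S_d) :=
  [tuple tnth u (t i) | i < d].

Definition symmetric_tensor d (t : tensor k n d) :=
  forall s u, t (permute_tuple u s) = t u.

Lemma permute_tupleM d u (s t : 'S_d) :
  permute_tuple (permute_tuple u s) t = permute_tuple u (t * s).
Proof. by apply: eq_from_tnth => i; rewrite !tnth_mktuple permM. Qed.

Lemma permute_tuple1 d (u : d.-tuple ('I_n * 'I_n)) : permute_tuple u 1 = u.
Proof. by apply: eq_from_tnth => i; rewrite !tnth_mktuple perm1. Qed.

Lemma symmetrize_symmetric d (t : tensor k n d) : symmetric_tensor (symmetrize t).
Proof.
move=> s u; rewrite /symmetrize; congr (_ * _).
rewrite [RHS](reindex_inj (mulIg s)) /=; apply: eq_bigr => v _; congr (t _).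
exact: permute_tupleM.
Qed.

Lemma sum_symmetric (R : nmodType) d (s : 'S_d) (F : d.-tuple ('I_n * 'I_n) -> R) :
  \sum_u F (permute_tuple u s) = \sum_u F u.
Proof.
have actK : cancel (fun u : d.-tuple ('I_n * 'I_n) => permute_tuple u s)
                   (fun u => permute_tuple u s^-1%g).
  by move=> u; rewrite permute_tupleM mulVg permute_tuple1.
by rewrite [RHS](reindex_inj (can_inj actK)).
Qed.

Lemma tensor_form_scalar d (t : tensor k n d) : scalar (tensor_form t).
Proof. exact: monomial_extension_scalar. Qed.

Lemma insub_tuple d (u : d.-tuple ('I_n * 'I_n)) : insub (val u) = Some u.
Proof. by rewrite valK. Qed.

Lemma tensor_form_entry_prod d (t : tensor k n d) s : symmetric_tensor t ->
  tensor_form t (entry_prod k s) = oapp t 0 (insub s).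
Proof.
move=> t_sym; apply: (monomial_extension_entry_prod (h := fun s => oapp t 0 (insub s))).
move=> s1 s2 eq_s; have eq_sz := perm_size eq_s.
have [sz1|sz1] := eqVneq (size s1) d; last first.
  by rewrite !insubF // -?eq_sz; exact: negPf.
have sz1' : size s1 == d by rewrite sz1.
have sz2' : size s2 == d by rewrite -eq_sz sz1.
rewrite -[s1]/(val (Tuple sz1')) -[s2]/(val (Tuple sz2')) !insub_tuple /=.
have /tuple_permP[q def_q] : perm_eq (Tuple sz1') (Tuple sz2') by [].
by rewrite -[RHS](t_sym q); congr (t _); exact: val_inj.
Qed.

Lemma tensor_form_tuple d (t : tensor k n d) (u : d.-tuple _) : symmetric_tensor t ->
  tensor_form t (entry_prod k u) = t u.
Proof. by move=> t_sym; rewrite tensor_form_entry_prod // insub_tuple. Qed.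

Lemma prod_tuple_entry_prod d (u : d.-tuple ('I_n * 'I_n)) :
  \prod_(p < d) generic_mx k n (tnth u p).1 (tnth u p).2 = entry_prod k u.
Proof. by rewrite /entry_prod big_tuple. Qed.

Lemma big_tuple_words (R : nmodType) d (F : ('I_d -> 'I_n) -> ('I_d -> 'I_n) -> R) :
  (forall j j' l l', j =1 j' -> l =1 l' -> F j l = F j' l') ->
  \sum_(u : d.-tuple ('I_n * 'I_n)) F (fun p => (tnth u p).1) (fun p => (tnth u p).2)
  = \sum_(j : {ffun 'I_d -> 'I_n}) \sum_(l : {ffun 'I_d -> 'I_n}) F j l.
Proof.
move=> F_ext; rewrite pair_big /=.
rewrite [RHS](reindex (fun u : d.-tuple ('I_n * 'I_n) =>
  ([ffun p => (tnth u p).1], [ffun p => (tnth u p).2]))) /=.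
  by apply: eq_bigr => u _; apply: F_ext => p; rewrite ffunE.
exists (fun w : {ffun 'I_d -> 'I_n} * {ffun 'I_d -> 'I_n} => [tuple (w.1 p, w.2 p) | p < d]) => [u _|[j l] _].
  by apply: eq_from_tnth => p; rewrite tnth_mktuple !ffunE -surjective_pairing.
by congr (_, _); apply/ffunP => p; rewrite !ffunE tnth_mktuple.
Qed.

End SymmetricTensorForms.

Section WeingartenMatrix.
Variables (k : fieldType) (n m : nat) (G : 'M[k]_n).
Hypotheses (k_char0 : [pchar k] =i pred0) (n_gt0 : (0 < n)%N).
Hypotheses (G_sym : G^T = G) (G_unit : G \in unitmx).
Notation K := (invmx G).
Notation dbl_tuple := (m.*2.-tuple ('I_n * 'I_n)).
Implicit Types (s t : 'S_m) (u : dbl_tuple).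

Let K_sym : K^T = K. Proof. by rewrite trmx_inv G_sym. Qed.
Let KG : K *m G = 1%:M. Proof. exact: mulVmx. Qed.

Lemma eq_metric_tensor s (j j' l l' : 'I_m.*2 -> 'I_n) :
  j =1 j' -> l =1 l' -> metric_tensor G s j l = metric_tensor G s j' l'.
Proof.
by move=> eq_j eq_l; congr (_ * _); apply: eq_bigr => i _; rewrite ?eq_j ?eq_l.
Qed.

Lemma w_tensor_symmetric s : symmetric_tensor (w_tensor G s).
Proof. exact: symmetrize_symmetric. Qed.

Lemma w_tensorE s u : w_tensor G s u = w_form G s (entry_prod k u).
Proof. by rewrite /w_form tensor_form_tuple //; exact: w_tensor_symmetric. Qed.

Lemma scalar_a_poly (C : {mpoly k[n * n]} -> k) s : scalar C ->
  C (a_poly G s) = \sum_u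
    metric_tensor G s (fun p => (tnth u p).1) (fun p => (tnth u p).2) * C (entry_prod k u).
Proof.
move=> C_lin.
pose fC : {scalar {mpoly k[n * n]}} := HB.pack C (GRing.isLinear.Build k _ _ _ C C_lin).
have -> : C = fC by []; rewrite /a_poly linear_sum; apply: eq_bigr => u _.
by rewrite linearZ prod_tuple_entry_prod.
Qed.

Lemma w_form_a_poly s t : w_form G s (a_poly G t) = (m.*2`!%:R)^-1 *
  \sum_(v : 'S_m.*2) \sum_u
    metric_tensor G t (fun p => (tnth u p).1) (fun p => (tnth u p).2)
    * metric_tensor G s (fun p => (tnth u (v p)).2) (fun p => (tnth u (v p)).1).
Proof.
rewrite scalar_a_poly; last exact: tensor_form_scalar.
rewrite exchange_big mulr_sumr; apply: eq_bigr => u _ /=.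
rewrite -w_tensorE /w_tensor /symmetrize mulrCA; congr (_ * _).
rewrite mulr_sumr; apply: eq_bigr => v _; congr (_ * _).
by apply: eq_metric_tensor => p; rewrite tnth_mktuple.
Qed.

(* Transposing all the matrix units exchanges the roles of the two metrics. *)
Lemma w_form_a_polyC s t : w_form G s (a_poly G t) = w_form G t (a_poly G s).
Proof.
rewrite !w_form_a_poly; congr (_ * _).
rewrite [RHS](reindex_inj invg_inj) /=; apply: eq_bigr => v _.
pose tr u : dbl_tuple := [tuple ((tnth u p).2, (tnth u p).1) | p < m.*2].
have trK : involutive tr.
  by move=> u; apply: eq_from_tnth => p; rewrite !tnth_mktuple -surjective_pairing.
rewrite [LHS](reindex_inj (inv_inj trK)) /= -(sum_symmetric v^-1).
apply: eq_bigr => u _; rewrite mulrC; congr (_ * _);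
by apply: eq_metric_tensor => p; rewrite !tnth_mktuple ?permK.
Qed.

(** The T_2 factor of a_s lies in V* and absorbs P, so the value is the full contraction of the
    metric tensors, the same as at the identity matrix. *)
Lemma haar_form_a_poly s : haar_form G (a_poly G s) = n%:R ^+ ncycles s.
Proof.
rewrite scalar_a_poly; last exact: linearP.
pose F (j l : 'I_m.*2 -> 'I_n) := metric_tensor G s j l * haar_tensor G K j l.
transitivity (\sum_u F (fun p => (tnth u p).1) (fun p => (tnth u p).2)).
  by apply: eq_bigr => u _; rewrite -prod_tuple_entry_prod haar_form_ffun.
rewrite big_tuple_words => [|j j' l l' eq_j eq_l]; last first.
  by rewrite /F (eq_metric_tensor s eq_j eq_l) (eq_haar_tensor _ _ eq_j eq_l).
rewrite exchange_big -cycle_trace1 //.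
transitivity (cycle_trace (G^T *m K) s); last by rewrite G_sym mulmxV.
rewrite -sum_pairs_cycle_trace; apply: eq_bigr => l _.
rewrite -pairing_tensor1_positions -(pairing_haar_tensor k_char0 G_sym KG) mulr_suml.
apply: eq_bigr => j _; rewrite /F /metric_tensor -pairing_tensor1_positions.
by rewrite mulrAC.
Qed.

Lemma pairing_tensors_w_tensor (t s : 'S_m.*2) : exists x : 'S_m, forall u,
  (m.*2`!%:R)^-1 * (\sum_(v : 'S_m.*2) pairing_tensor G t (fun p => (tnth u (v p)).2)
     * pairing_tensor K s (fun p => (tnth u (v p)).1)) = w_tensor G x u.
Proof.
have [r [x def_x]] := pairing_tensors_metric G_sym t s; exists x => u.
rewrite /w_tensor /symmetrize; congr (_ * _).
rewrite [RHS](reindex_inj (mulgI r)) /=; apply: eq_bigr => v _; rewrite def_x.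
by apply: eq_metric_tensor => p; rewrite tnth_mktuple /= permM.
Qed.

Lemma factorial_neq0 d : (d`!%:R : k) != 0.
Proof. by rewrite char0_natr_eq0 // -lt0n fact_gt0. Qed.

(** By [haar_tensor_perm] the tensor P equals its own symmetrization, in which each product of two
    pairing tensors becomes some w_x; [bounded_span] then rewrites w_x on class representatives. *)
Lemma haar_tensor_w_span : exists c : 'I_#|bounded_classes n m| -> k, forall u,
  haar_seq G u = \sum_i c i * w_tensor G (class_rep i) u.
Proof.
have /fin_all_exists[X def_X] (ts : 'S_m.*2 * 'S_m.*2) := pairing_tensors_w_tensor ts.1 ts.2.
have /fin_all_exists[c def_c] ts := bounded_span n k_char0 (X ts).
exists (fun i => \sum_ts haar_coef G K ts.2 ts.1 * c ts i) => u.
transitivity (\sum_ts haar_coef G K ts.2 ts.1 * w_tensor G (X ts) u); last first.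
  under [RHS]eq_bigr do rewrite mulr_suml.
  rewrite exchange_big; apply: eq_bigr => ts _ /=; rewrite w_tensorE.
  rewrite (def_c ts (fun s => w_form G s (entry_prod k u))) => [|s t|].
  - by rewrite mulr_sumr; apply: eq_bigr => i _; rewrite -w_tensorE mulrA.
  - exact: w_form_conj.
  exact: w_form_alternating.
under eq_bigr do rewrite -def_X mulrCA mulr_sumr.
rewrite -mulr_sumr exchange_big /=; apply: (mulfI (factorial_neq0 m.*2)).
rewrite mulVKf ?factorial_neq0 // haar_seqE.
transitivity (\sum_(v : 'S_m.*2) haar_tensor G K
   (fun p => (tnth u (v p)).1) (fun p => (tnth u (v p)).2)).
  rewrite -card_Sn -sumr_const mulr_suml; apply: eq_big => [v|v _]; first by rewrite inE.
  rewrite mul1r; symmetry.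
  exact: (haar_tensor_perm k_char0 G_sym K_sym KG v (fun p => (tnth u p).1) (fun p => (tnth u p).2)).
apply: eq_bigr => v _; rewrite /haar_tensor exchange_big pair_big /=.
by apply: eq_bigr => ts _; rewrite mulrAC [RHS]mulrC [_ * pairing_tensor G _ _]mulrC.
Qed.

End WeingartenMatrix.

(** * Linear independence of the w_sigma *)

Section Independence.
Variables (k : fieldType) (n m : nat) (G : 'M[k]_n).
Hypotheses (k_char0 : [pchar k] =i pred0) (n_gt0 : (0 < n)%N).
Hypotheses (G_sym : G^T = G) (G_unit : G \in unitmx).
Notation K := (invmx G).
Notation dbl_tuple := (m.*2.-tuple ('I_n * 'I_n)).
Implicit Types (s t : 'S_m) (u : dbl_tuple).

(** For cycles of length at most n this exponent vector determines the conjugacy class, so distinct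
    classes give distinct monomials in the power sums. *)
Definition cycle_type_mnm s : 'X_{1..n} :=
  [multinom #|[set c in porbits s | #|c| == j.+1]| | j < n].

Lemma sum_symmetrize (R : comNzRingType) (f : {rmorphism k -> R}) d (t : tensor k n d)
    (h : d.-tuple ('I_n * 'I_n) -> R) :
  (forall v w, h (permute_tuple w v) = h w) ->
  \sum_u f (symmetrize t u) * h u = \sum_u f (t u) * h u.
Proof.
move=> h_sym; rewrite /symmetrize.
under eq_bigr do rewrite rmorphM rmorph_sum -mulrA mulr_suml.
rewrite -mulr_sumr exchange_big /=.
under eq_bigr => v _.
  under eq_bigr => u _ do rewrite -(h_sym v u).
  rewrite (sum_symmetric v (fun w => f (t w) * h w)).
  over.
rewrite sumr_const card_Sn mulrnAr -mulrnAl -(rmorphMn f) -[_^-1 *+ _]mulr_natr.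
by rewrite mulVf ?(factorial_neq0 k_char0) // rmorph1 mul1r.
Qed.

Lemma w_tensor_eval (R : comNzRingType) (f : {rmorphism k -> R}) (T : 'M[R]_n) s :
  \sum_u f (w_tensor G s u) * \prod_p T (tnth u p).1 (tnth u p).2
  = cycle_trace ((T *m map_mx f G *m T^T)^T *m map_mx f K) s.
Proof.
rewrite /w_tensor sum_symmetrize => [|v u]; last first.
  rewrite [RHS](reindex_inj (@perm_inj _ v)); apply: eq_bigr => p _.
  by rewrite tnth_mktuple.
pose F (l j : 'I_m.*2 -> 'I_n) := f (metric_tensor G s j l) * \prod_p T (l p) (j p).
rewrite (big_tuple_words (F := F)) => [|j j' l l' eq_j eq_l]; last first.
  rewrite /F (eq_metric_tensor _ s eq_l eq_j); congr (_ * _).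
  by apply: eq_bigr => p _; rewrite eq_j eq_l.
rewrite -sum_pairs_cycle_trace; apply: eq_bigr => l _.
rewrite -pairing_tensor1_positions -pairing_tensor_basis mulr_suml.
apply: eq_bigr => j _; rewrite /F /metric_tensor rmorphM mulrAC.
rewrite -pairing_tensor1_positions (rmorph_pairing_tensor f G) rmorph_prod [pairing_tensor _ _ _ * _]mulrC.
by congr (_ * _); apply: eq_bigr => i _; rewrite mxE.
Qed.

Lemma cycle_trace_power_sums s : bounded_perm n s ->
  cycle_trace (diag_mx (\row_(i < n) ('X_i : {mpoly k[n]}) ^+ 2)) s
  = mmap (@mpolyC n k) (@even_power_sum k n) 'X_[cycle_type_mnm s].
Proof.
move=> /forall_inP s_bounded; rewrite cycle_trace_diag // mmapX /mmap1.
(* The default index is never reached on a cycle, whose length lies between 1 and n. *)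
pose h (c : {set 'I_m}) : 'I_n := insubd (Ordinal n_gt0) #|c|.-1.
have hP c : c \in porbits s -> (h c).+1 = #|c|.
  move=> c_s; have c_gt0 : (0 < #|c|)%N.
    by case/imsetP: c_s => x _ ->; rewrite lt0n card_porbit_neq0.
  by rewrite val_insubd prednK // s_bounded // prednK.
rewrite (partition_big h xpredT) //=; apply: eq_bigr => j _.
rewrite mnmE -prodr_const; apply: eq_big => [c|c /andP[c_s /eqP <-]].
  by rewrite inE; case c_s: (c \in porbits s) => //=; rewrite -hP.
by apply: eq_bigr => i _; rewrite mxE -exprM hP.
Qed.

Lemma cycle_type_mnm_inj s t : bounded_perm n s -> bounded_perm n t ->
  cycle_type_mnm s = cycle_type_mnm t -> exists g, t = (s ^ g)%g.
Proof.
move=> /forall_inP bs /forall_inP bt /mnmP eq_st; apply: conj_of_cycle_type => j.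
have card0 v : (forall c, c \in porbits v -> #|c| <= n)%N -> (j == 0)%N || (n < j)%N ->
    #|[set c in porbits v | #|c| == j]| = 0%N.
  move=> bv; apply: contraTeq; rewrite -lt0n => /card_gt0P[c]; rewrite inE => /andP[c_v /eqP <-].
  rewrite negb_or -leqNgt bv // andbT.
  by case/imsetP: c_v => x _ ->; rewrite card_porbit_neq0.
have [j0|] := boolP ((j == 0) || (n < j))%N; first by rewrite !card0.
case: j {card0} => // j; rewrite /= -leqNgt => lt_j.
by have := eq_st (Ordinal lt_j); rewrite !mnmE.
Qed.

(** T = N X N' is self-adjoint for A, because N diagonalizes A and X commutes with D. Hence T A T^T
    = T T A, and multiplying by B leaves T T, conjugate to X X. *)
Lemma cycle_trace_conj_diag (R : comNzRingType) (N N' X D A B : 'M[R]_n) s :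
  N' *m N = 1%:M -> A = N *m D *m N^T -> A *m B = 1%:M -> D *m X = X *m D -> X^T = X ->
  A^T = A ->
  cycle_trace ((N *m X *m N' *m A *m (N *m X *m N')^T)^T *m B) s = cycle_trace (X *m X) s.
Proof.
move=> N'N def_A AB DX X_sym A_sym.
rewrite -[RHS](cycle_trace_conj _ s N'N); congr (cycle_trace _ s).
have TAT : N *m X *m N' *m A *m (N *m X *m N')^T = N *m (X *m X) *m N' *m A.
  have N'NT : N^T *m N'^T = 1%:M by rewrite -trmx_mul N'N trmx1.
  rewrite def_A !trmx_mul X_sym !mulmxA -(mulmxA _ N' N) N'N mulmx1.
  rewrite -(mulmxA _ N^T) N'NT mulmx1 -(mulmxA _ D X) DX !mulmxA.
  by rewrite -(mulmxA _ N' N) N'N mulmx1.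
rewrite trmx_mul trmxK [(N *m X *m N' *m A)^T]trmx_mul A_sym mulmxA TAT.
by rewrite -mulmxA AB mulmx1.
Qed.

(** Pairing a vanishing combination with the powers of [T] gives a polynomial relation [F] between
    even power sums, so [F] is 0; its coefficients are the c_i. *)
Lemma w_tensor_free (c : 'I_#|bounded_classes n m| -> k) :
  (forall u, \sum_i c i * w_tensor G (class_rep i) u = 0) -> forall i, c i = 0.
Proof.
move=> c0; have [N N_unit [d def_G]] := sym_diagP k_char0 G_sym.
pose f : {rmorphism k -> {mpoly k[n]}} := @mpolyC n k.
pose X := diag_mx (\row_(i < n) ('X_i : {mpoly k[n]})).
pose T := map_mx f N *m X *m map_mx f (invmx N).
have evalT s : bounded_perm n s -> \sum_u f (w_tensor G s u) * \prod_p T (tnth u p).1 (tnth u p).2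
    = mmap f (@even_power_sum k n) 'X_[cycle_type_mnm s].
  move=> bs; rewrite w_tensor_eval -cycle_trace_power_sums //.
  have -> : diag_mx (\row_(i < n) ('X_i : {mpoly k[n]}) ^+ 2) = X *m X.
    by rewrite mulmx_diag; congr diag_mx; apply/rowP => i; rewrite !mxE expr2.
  apply: (cycle_trace_conj_diag (D := map_mx f (diag_mx d))).
  - by rewrite -map_mxM mulVmx // map_mx1.
  - by rewrite def_G !map_mxM map_trmx.
  - by rewrite -map_mxM mulmxV ?map_mx1.
  - by rewrite map_diag_mx /X !mulmx_diag; congr diag_mx; apply/rowP => i; rewrite !mxE mulrC.
  - exact: tr_diag_mx.
  by rewrite map_trmx G_sym.
pose F : {mpoly k[n]} := \sum_i c i *: 'X_[cycle_type_mnm (class_rep i)].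
have F0 : F = 0.
  apply: (even_power_sums_free k_char0); rewrite /F raddf_sum /=.
  under eq_bigr => i _ do rewrite mmapZ -(evalT _ (class_rep_bounded i)) mulr_sumr.
  rewrite exchange_big big1 // => u _ /=.
  transitivity ((\sum_i f (c i) * f (w_tensor G (class_rep i) u)) * \prod_p T (tnth u p).1 (tnth u p).2).
    by rewrite mulr_suml; apply: eq_bigr => i _; rewrite mulrA.
  have -> : \sum_i f (c i) * f (w_tensor G (class_rep i) u) = f (\sum_i c i * w_tensor G (class_rep i) u).
    by rewrite rmorph_sum; apply: eq_bigr => i _; rewrite rmorphM.
  by rewrite c0 rmorph0 mul0r.
move=> i; have /(congr1 (mcoeff (cycle_type_mnm (class_rep i)))) := F0.
rewrite mcoeff0 /F raddf_sum (bigD1 i) //= mcoeffZ mcoeffX eqxx mulr1 big1 ?addr0 //.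
move=> j neq_j; rewrite mcoeffZ mcoeffX; case: eqP => [eq_ct|_]; last by rewrite mulr0.
have [g def_i] := cycle_type_mnm_inj (class_rep_bounded j) (class_rep_bounded i) eq_ct.
by case/eqP: neq_j; apply/esym/(class_rep_inj def_i).
Qed.

End Independence.

(** * Invertibility and solution of the linear system *)

Section LambdaMatrix.
Variables (k : fieldType) (n m : nat) (G : 'M[k]_n).
Hypotheses (k_char0 : [pchar k] =i pred0) (n_gt0 : (0 < n)%N).
Hypotheses (G_sym : G^T = G) (G_unit : G \in unitmx).
Notation K := (invmx G).
Notation dbl_tuple := (m.*2.-tuple ('I_n * 'I_n)).
Implicit Types (s t : 'S_m) (u : dbl_tuple).

Let K_sym : K^T = K. Proof. by rewrite trmx_inv G_sym. Qed.
Let KG : K *m G = 1%:M. Proof. exact: mulVmx. Qed.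

Lemma metric_tensor_pairing s : exists t : 'S_m.*2, forall j l : 'I_m.*2 -> 'I_n,
  metric_tensor G s j l = pairing_tensor G 1 j * pairing_tensor K t l.
Proof.
pose h : 'I_m.*2 -> 'I_m.*2 := word_join (@fst_pos m) (fun i => snd_pos (s i)).
have h_inj : injective h.
  have odd_h p : odd (h p) = odd p.
    by rewrite /h /word_join; case: ifP => _ /=; rewrite odd_double.
  move=> p q eq_h; have eq_odd : odd p = odd q by rewrite -odd_h eq_h odd_h.
  rewrite (half_posK p) (half_posK q) eq_odd; move: eq_h; rewrite /h /word_join eq_odd.
  case: (odd q) => eq_h; congr (_ _).
    by apply: (@perm_inj _ s); rewrite -[LHS]half_snd eq_h half_snd.
  by rewrite -[LHS]half_fst eq_h half_fst.
exists (perm h_inj) => j l; rewrite /metric_tensor (pairing_tensor_perm K (perm h_inj)).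
rewrite !pairing_tensor1_positions; congr (_ * _); apply: eq_bigr => i _ /=.
by rewrite !permE /h word_join_fst word_join_snd.
Qed.

Lemma haar_tensor_suml d (F : {ffun 'I_d -> 'I_n} -> k) (j : 'I_d -> 'I_n) :
  (forall t : 'S_d, \sum_(a : {ffun 'I_d -> 'I_n}) pairing_tensor G t a * F a = 0) ->
  \sum_(a : {ffun 'I_d -> 'I_n}) haar_tensor G K j a * F a = 0.
Proof.
move=> F0; rewrite /haar_tensor; under eq_bigr do rewrite mulr_suml.
rewrite exchange_big big1 // => s _; under eq_bigr do rewrite mulr_suml.
rewrite exchange_big big1 // => t _; under eq_bigr do rewrite -!mulrA.
by rewrite -!mulr_sumr F0 !mulr0.
Qed.

Lemma haar_tensor_sumr d (F : {ffun 'I_d -> 'I_n} -> k) (l : 'I_d -> 'I_n) :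
  (forall s : 'S_d, \sum_(b : {ffun 'I_d -> 'I_n}) F b * pairing_tensor K s b = 0) ->
  \sum_(b : {ffun 'I_d -> 'I_n}) F b * haar_tensor G K b l = 0.
Proof.
move=> F0; rewrite /haar_tensor; under eq_bigr do rewrite mulr_sumr.
rewrite exchange_big big1 // => s _; under eq_bigr do rewrite mulr_sumr.
rewrite exchange_big big1 // => t _.
transitivity ((\sum_(b : {ffun 'I_d -> 'I_n}) F b * pairing_tensor K s b)
  * (haar_coef G K s t * pairing_tensor G t l)); last by rewrite F0 mul0r.
by rewrite mulr_suml; apply: eq_bigr => b _; rewrite !mulrA.
Qed.

(* A combination of the w_s lies in the range of P (x) P^T, where P is the
   projection haar_tensor, hence is determined by its pairings with the a_t. *)
Lemma w_form_nondegenerate (c : 'I_#|bounded_classes n m| -> k) :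
  (forall j : 'I_#|bounded_classes n m|,
     \sum_i c i * w_form G (class_rep i) (a_poly G (class_rep j)) = 0) ->
  forall i, c i = 0.
Proof.
move=> c0; pose C p := \sum_i c i * w_form G (class_rep i) p.
have C_lin : scalar C.
  move=> a p q; rewrite /C mulr_sumr -big_split; apply: eq_bigr => i _ /=.
  have -> : w_form G (class_rep i) (a *: p + q)
      = a * w_form G (class_rep i) p + w_form G (class_rep i) q by exact: tensor_form_scalar.
  by rewrite mulrDr mulrCA.
(* The hypothesis concerns class representatives with short cycles; the alternating relations extend
   it to every permutation. *)
have Ca0 s : C (a_poly G s) = 0.
  have [d def_d] := bounded_span n k_char0 s.
  rewrite (def_d (fun s => C (a_poly G s))) => [|t v|]; last first.
  - exact: a_poly_alternating.
  - by rewrite a_poly_conj.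
  by rewrite big1 // => i _; rewrite [C _]c0 mulr0.
pose Ct u := \sum_i c i * w_tensor G (class_rep i) u.
have CtE u : Ct u = C (entry_prod k u) by apply: eq_bigr => i _; rewrite w_tensorE.
have Ct_sym : symmetric_tensor Ct.
  by move=> v u; apply: eq_bigr => i _; rewrite (w_tensor_symmetric G (class_rep i) v u).
have /fin_all_exists[tau def_tau] i := metric_tensor_pairing (@class_rep n m i).
pose e i := c i * (m.*2`!%:R)^-1.
pose Cf (j l : 'I_m.*2 -> 'I_n) := \sum_i \sum_(v : 'S_m.*2)
  e i * (pairing_tensor K (tau i * v)%g j * pairing_tensor G v l).
have CfE u : Ct u = Cf (fun p => (tnth u p).1) (fun p => (tnth u p).2).
  apply: eq_bigr => i _; rewrite /w_tensor /symmetrize mulrA mulr_sumr.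
  apply: eq_bigr => v _; congr (_ * _); rewrite def_tau mulrC; congr (_ * _).
    by rewrite -pairing_tensorM; apply: eq_pairing_tensor => p; rewrite tnth_mktuple.
  by rewrite -{2}[v]mul1g -pairing_tensorM; apply: eq_pairing_tensor => p; rewrite tnth_mktuple.
have Cf_ext j j' l l' : j =1 j' -> l =1 l' -> Cf j l = Cf j' l'.
  move=> eq_j eq_l; apply: eq_bigr => i _; apply: eq_bigr => v _.
  by rewrite (eq_pairing_tensor _ _ eq_j) (eq_pairing_tensor _ _ eq_l).
have Cf_l j l : Cf j l = \sum_(a : {ffun 'I_m.*2 -> 'I_n}) haar_tensor G K j a * Cf a l.
  under [RHS]eq_bigr do rewrite mulr_sumr.
  rewrite exchange_big; apply: eq_bigr => i _ /=; under [RHS]eq_bigr do rewrite mulr_sumr.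
  rewrite exchange_big; apply: eq_bigr => v _ /=.
  rewrite -(haar_tensor_pairing k_char0 K_sym KG) mulr_suml mulr_sumr.
  by apply: eq_bigr => a _; rewrite [RHS]mulrCA !mulrA.
have Cf_r j l : Cf j l = \sum_(b : {ffun 'I_m.*2 -> 'I_n}) Cf j b * haar_tensor G K b l.
  under [RHS]eq_bigr do rewrite mulr_suml.
  rewrite exchange_big; apply: eq_bigr => i _ /=; under [RHS]eq_bigr do rewrite mulr_suml.
  rewrite exchange_big; apply: eq_bigr => v _ /=.
  rewrite -(pairing_haar_tensor k_char0 G_sym KG) !mulr_sumr.
  by apply: eq_bigr => b _; rewrite !mulrA.
(* Pairing the combination with any element of V* (x) V amounts, by the normal form of two matchings
   and the symmetry of [Ct], to applying [C] to some a_x. *)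
have Z (t s : 'S_m.*2) : \sum_(b : {ffun 'I_m.*2 -> 'I_n}) (\sum_(a : {ffun 'I_m.*2 -> 'I_n})
    pairing_tensor G t a * Cf a b) * pairing_tensor K s b = 0.
  have [r [x def_x]] := pairing_tensors_metric G_sym t s.
  pose F (j l : 'I_m.*2 -> 'I_n) := metric_tensor G x (j \o r) (l \o r) * Cf j l.
  transitivity (\sum_u F (fun p => (tnth u p).1) (fun p => (tnth u p).2)).
    rewrite big_tuple_words => [|j j' l l' eq_j eq_l]; last first.
      rewrite /F (Cf_ext _ _ _ _ eq_j eq_l); congr (_ * _).
      by apply: eq_metric_tensor => p /=.
    rewrite exchange_big; apply: eq_bigr => b _; rewrite mulr_suml; apply: eq_bigr => a _.
    by rewrite /F -def_x mulrAC.
  rewrite -[RHS](Ca0 x) (scalar_a_poly G x C_lin) -[RHS](sum_symmetric r).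
  apply: eq_bigr => u _; rewrite /F -CfE -CtE Ct_sym; congr (_ * _).
  by apply: eq_metric_tensor => p; rewrite tnth_mktuple.
apply: (w_tensor_free k_char0 n_gt0 G_sym G_unit) => u.
rewrite -/(Ct u) CfE Cf_l; apply: haar_tensor_suml => t.
under eq_bigr do rewrite Cf_r mulr_sumr.
rewrite exchange_big /=; under eq_bigr do under eq_bigr do rewrite mulrA.
under eq_bigr do rewrite -mulr_suml.
by apply: haar_tensor_sumr => s; apply: Z.
Qed.

Let n_exp_neq0 r : (n%:R ^+ r : k) != 0.
Proof. by rewrite expf_neq0 // char0_natr_eq0 // -lt0n. Qed.

Lemma lambda_mx_tr : (lambda_mx G m)^T = lambda_mx G m.
Proof.
apply/matrixP => i j; rewrite !mxE w_form_a_polyC; congr (_ / _).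
exact: mulrC.
Qed.

Lemma lambda_mx_unit : lambda_mx G m \in unitmx.
Proof.
rewrite -row_free_unit; apply: inj_row_free => v vL.
have v0 : forall i, v 0 i / n%:R ^+ ncycles (@class_rep n m i) = 0.
  apply: w_form_nondegenerate => j.
  move/rowP/(_ j): vL; rewrite !mxE => vL.
  apply: (mulIf (invr_neq0 (n_exp_neq0 (ncycles (@class_rep n m j))))).
  rewrite mul0r -[RHS]vL mulr_suml; apply: eq_bigr => i _.
  by rewrite mxE invfM !mulrA; congr (_ * _); rewrite mulrAC.
apply/rowP => i; rewrite mxE; apply/eqP; have /eqP := v0 i.
by rewrite mulf_eq0 invr_eq0 (negPf (n_exp_neq0 _)) orbF.
Qed.

(** Whatever coefficients [c] express P, evaluating at the a_j gives n^r(j); so c_i n^r(i) solves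
    the system, and invertibility identifies it with [lambda_vec]. *)
Lemma haar_seq_lambda u : haar_seq G u =
  \sum_i lambda_vec G m i 0 * (w_tensor G (class_rep i) u / n%:R ^+ ncycles (class_rep i)).
Proof.
have [c def_c] := haar_tensor_w_span m k_char0 G_sym G_unit.
have exp_j (j : 'I_#|bounded_classes n m|) : n%:R ^+ ncycles (class_rep j)
    = \sum_i c i * w_form G (class_rep i) (a_poly G (class_rep j)).
  rewrite -(haar_form_a_poly k_char0 n_gt0 G_sym G_unit) scalar_a_poly; last exact: linearP.
  under eq_bigr do rewrite haar_form_entry_prod // def_c mulr_sumr.
  rewrite exchange_big; apply: eq_bigr => i _ /=.
  rewrite scalar_a_poly; last exact: tensor_form_scalar.
  by rewrite mulr_sumr; apply: eq_bigr => v _; rewrite mulrCA w_tensorE.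
pose x : 'cV_#|bounded_classes n m| := \col_i (c i * n%:R ^+ ncycles (class_rep i)).
have Lx : lambda_mx G m *m x = const_mx 1.
  (* [exp_j] sums over the row index of the matrix while the product sums over its column index;
     symmetry of the matrix reconciles them. *)
  apply: trmx_inj; rewrite trmx_mul lambda_mx_tr; apply/rowP => j; rewrite !mxE.
  apply: (mulIf (n_exp_neq0 (ncycles (@class_rep n m j)))); rewrite mul1r [RHS]exp_j.
  rewrite mulr_suml; apply: eq_bigr => i _; rewrite !mxE.
  rewrite invfM !mulrA divfK ?n_exp_neq0 // mulrAC mulfK ?n_exp_neq0 //.
have -> : lambda_vec G m = x by rewrite /lambda_vec -Lx mulKmx // lambda_mx_unit.
rewrite def_c; apply: eq_bigr => i _; rewrite mxE -mulrA; congr (_ * _).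
by rewrite mulrCA mulfV ?mulr1.
Qed.

End LambdaMatrix.

(** * Summation of the series *)

Section Series.
Variables (k : fieldType) (n : nat) (G : 'M[k]_n).
Hypotheses (k_char0 : [pchar k] =i pred0) (n_gt0 : (0 < n)%N).
Hypotheses (G_sym : G^T = G) (G_unit : G \in unitmx).

(** Only the term with 2m equal to the length of [s] survives; it lies in the range since half the
    length is below [N]. The empty word is covered by the constant term, and for odd lengths both
    sides vanish. *)
Lemma haar_seq_series s N : (size s < N)%N -> haar_seq G s = (s == [::])%:R
  + \sum_(1 <= m < N) \sum_(i < #|bounded_classes n m|) lambda_vec G m i 0
      * (oapp (w_tensor G (class_rep i)) 0 (insub s) / n%:R ^+ ncycles (class_rep i)).
Proof.
move=> lt_sN; pose term m := \sum_(i < #|bounded_classes n m|) lambda_vec G m i 0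
      * (oapp (w_tensor G (class_rep i)) 0 (insub s) / n%:R ^+ ncycles (class_rep i)).
have term0 m : size s != m.*2 -> term m = 0.
  by move=> sz_s; rewrite /term big1 // => i _; rewrite insubF ?mul0r ?mulr0 //; apply: negPf.
have termE m : size s == m.*2 -> term m = haar_seq G s.
  move=> sz_s; rewrite -[s]/(val (Tuple sz_s)) (haar_seq_lambda k_char0 n_gt0 G_sym G_unit).
  by apply: eq_bigr => i _; rewrite (insub_tuple (Tuple sz_s)).
have [s0|s_neq0] := eqVneq s [::].
  have sum0 : \sum_(1 <= m < N) term m = 0.
    apply: big1_seq => m; rewrite mem_index_iota => /andP[_ /andP[m_gt0 _]].
    by apply: term0; rewrite s0 eq_sym double_eq0 -lt0n.
  by rewrite -/(term _) sum0 addr0 s0; exact: haar_seq_nil.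
rewrite add0r; have [odd_s|ev_s] := boolP (odd (size s)).
  rewrite big1 => [|m _]; first by apply: haar_tensor_odd.
  by apply: term0; apply: contraTneq odd_s => ->; rewrite odd_double.
have def_s : (size s)./2.*2 = size s by rewrite -[RHS]odd_double_half (negPf ev_s).
rewrite (bigD1_seq (size s)./2) ?iota_uniq //=; last first.
  rewrite mem_index_iota -double_gt0 def_s lt0n size_eq0 s_neq0 /=.
  by apply: leq_ltn_trans lt_sN; rewrite -{2}def_s -addnn leq_addr.
rewrite -/(term _) termE ?def_s // big1 ?addr0 // => m neq_m.
by apply: term0; rewrite -def_s (inj_eq double_inj) eq_sym.
Qed.

Lemma integral_seriesE : integral_series G =1 haar_form G.
Proof.
move=> p; rewrite /integral_series /haar_form /monomial_extension.
have -> : p@_0%MM = \sum_(mm <- msupp p) p@_mm * ([seq mxindex_pair v | v <- m2s mm] == [::])%:R.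
  rewrite {1}[p]mpolyE raddf_sum; apply: eq_bigr => mm _ /=.
  by rewrite mcoeffZ mcoeffX -size_eq0 size_map size_m2s mdeg_eq0.
under [X in _ + X]eq_bigr => m _.
  under eq_bigr => i _.
    rewrite /w_form /tensor_form mulr_suml mulr_sumr.
    over.
  rewrite exchange_big.
  over.
rewrite exchange_big -big_split; apply: eq_big_seq => mm mm_p /=.
(* One truncation serves for all monomials of [p], since their degrees are below [msize p]. *)
rewrite (@haar_seq_series _ (msize p)) ?size_map ?size_m2s ?msize_mdeg_lt // mulrDr.
congr (_ + _); rewrite mulr_sumr; apply: eq_bigr => m _; rewrite mulr_sumr.
by apply: eq_bigr => i _; rewrite [RHS]mulrCA !mulrA.
Qed.

End Series.


(** * From the metric to its Gram matrix *)

Section GramMatrix.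
Variables (k : fieldType) (n : nat) (E : vectType k) (e : n.-tuple E) (T2 : {symmetric E}).

Lemma gram_mx_sym : (gram_mx T2 e)^T = gram_mx T2 e.
Proof. by apply/matrixP => i j; rewrite !mxE hermC expr0 mul1r. Qed.

Lemma gram_mx_unit : basis_of {:E} e -> nondegenerate T2 -> gram_mx T2 e \in unitmx.
Proof.
move=> e_basis T2_nondeg; rewrite -row_free_unit; apply: inj_row_free => v vG.
pose u := \sum_i v 0 i *: tnth e i.
have u_orth w : T2 u w = 0.
  rewrite (coord_basis e_basis (memvf w)) linear_sumr big1 // => j _.
  rewrite linearZr /=; apply/eqP; rewrite mulf_eq0; apply/orP; right.
  move/rowP/(_ j): vG; rewrite !mxE => <-; rewrite linear_sumlz; apply/eqP/eq_bigr => i _.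
  by rewrite linearZl_LR mxE (tnth_nth 0 e j).
have u0 : u = 0.
  apply/eqP; rewrite -memv0 -(eqP T2_nondeg).
  by apply/mem_orthovP => w _; apply: u_orth.
apply/rowP => i; rewrite mxE.
have /freeP e_free := basis_free e_basis.
apply: (e_free (fun i => v 0 i)); rewrite -[RHS]u0; apply: eq_bigr => j _.
by rewrite (tnth_nth 0).
Qed.

End GramMatrix.

Theorem mainTheorem8 (k : fieldType) (k_char0 : [pchar k] =i pred0)
    (n : nat) (n_gt0 : (0 < n)%N)
    (E : vectType k) (e : n.-tuple E) (e_basis : basis_of {:E} e)
    (T2 : {symmetric E}) (T2_nondeg : nondegenerate T2) :
  (forall m : nat, (0 < m)%N -> lambda_mx (gram_mx T2 e) m \in unitmx) /\
  (forall w : {mpoly k[n * n]} -> k,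
     (left_invariant_integral (gram_mx T2 e) w
        <-> w =1 integral_series (gram_mx T2 e)) /\
     (right_invariant_integral (gram_mx T2 e) w
        <-> w =1 integral_series (gram_mx T2 e))).
Proof.
have G_sym := gram_mx_sym e T2; have G_unit := gram_mx_unit e_basis T2_nondeg.
set G := gram_mx T2 e in G_sym G_unit *.
split=> [m _|w]; first exact: lambda_mx_unit.
have seriesE := integral_seriesE k_char0 n_gt0 G_sym G_unit.
split; split.
- by move=> /(left_invariant_unique k_char0 n_gt0 G_sym G_unit) wE p; rewrite wE seriesE.
(* The invariance predicate speaks of the function itself, so the pointwise equality is first turned
   into an equality of functions. *)
- move=> wE; have {}wE : w = haar_form G.
    by apply: functional_extensionality => p; rewrite wE seriesE.
  by rewrite wE; apply: haar_form_left_invariant.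
- by move=> /(right_invariant_unique k_char0 n_gt0 G_sym G_unit) wE p; rewrite wE seriesE.
move=> wE; have {}wE : w = haar_form G.
  by apply: functional_extensionality => p; rewrite wE seriesE.
by rewrite wE; apply: haar_form_right_invariant.
Qed.
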